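(* Let $\mathbb K$ be a field of characteristic $0$, $x\in\mathbb K$, and let $D_1,D_2$ be dissection diagrams of positive degrees $n_1,n_2$. Then $$L(D_1D_2)=\sum_{\substack{0\le t\le f_{D_1}(0)\\1\le j\le n_2\\0\le\tau\le f_{D_2}(j)}}x^{k_{\{a_{j,n_1}\}}(\Gamma^1_{t,j,\tau}(D_1\otimes D_2))}\Gamma^1_{t,j,\tau}(D_1\otimes D_2)+\sum_{\substack{0\le\tau\le f_{D_2}(0)\\1\le i\le n_1\\0\le t\le f_{D_1}(i)}}x^{k_{\{a_{i,n_2}\}}(\Gamma^1_{\tau,i,t}(D_2\otimes D_1))}\Gamma^1_{\tau,i,t}(D_2\otimes D_1)+\sum_{\substack{\lambda\in\{0,1\}\\0\le t\le f_{D_1}(0)\\0\le\tau\le f_{D_2}(0)}}\Gamma^{\lambda}_{t,\tau}(D_1\otimes D_2),$$ with $a_{j,n_1}=\{j,j+n_1+1\}$ and $a_{i,n_2}=\{i,i+n_2+1\}$. In other words, $$\begin{aligned}L(D_1D_2)=&\sum_{\substack{0\le t\le f_{D_1}(0)\\1\le j\le n_2\\0\le\tau\le l_2(j)-1}}\Gamma^1_{t,j,\tau}(D_1\otimes D_2)+x\sum_{\substack{0\le t\le f_{D_1}(0)\\1\le j\le n_2\\l_2(j)\le\tau\le f_{D_2}(j)}}\Gamma^1_{t,j,\tau}(D_1\otimes D_2)\\&+\sum_{\substack{0\le\tau\le f_{D_2}(0)\\1\le i\le n_1\\0\le t\le l_1(i)-1}}\Gamma^1_{\tau,i,t}(D_2\otimes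 D_1)+x\sum_{\substack{0\le\tau\le f_{D_2}(0)\\1\le i\le n_1\\l_1(i)\le t\le f_{D_1}(i)}}\Gamma^1_{\tau,i,t}(D_2\otimes D_1)+\sum_{\substack{\lambda\in\{0,1\}\\0\le t\le f_{D_1}(0)\\0\le\tau\le f_{D_2}(0)}}\Gamma^{\lambda}_{t,\tau}(D_1\otimes D_2),\end{aligned}$$ where $l_1(i)$ (resp. $l_2(j)$) is the unique index such that the chord $a^i_{D_1,l_1(i)}$ of $D_1$ is labelled $i$ (resp. the chord $a^j_{D_2,l_2(j)}$ of $D_2$ is labelled $j$).
   Context: Dissection diagrams. For $n\ge 0$ let $\Pi_n$ be the regular $(n+1)$-gon with vertices $0,1,\dots,n$ numbered clockwise; vertex $0$ is the root. For $0\le i\le n$, side $i$ goes from vertex $i$ to vertex $i+1$ (with $n+1$ read as $0$). A chord $\{u,v\}$ is a segment joining two distinct vertices (adjacent vertices are allowed; such a chord is distinct from the side). A dissection diagram of degree $n$ is a set of $n$ pairwise non-crossing chords (they may share endpoints) of $\Pi_n$ forming an acyclic graph, hence a spanning tree on $\{0,\dots,n\}$. All chords are oriented towards the root; the chord labelled $i$ ($1\le i\le n$) is the unique chord going out of vertex $i$. $\mathrm{Ch}(D)$ is the set of chords of $D$. The diagram of degree $0$ is identified with $1$; $a$ denotes the diagram of degree $1$. Coproduct. $\mathcal H_D$ is the commutative polynomial algebra on dissection diagrams of positive degree, with $\Delta(D)=\sum_{C\subset \mathrm{Ch}(D)}x^{k_C(D)}q_C(D)\otimes r_C(D)$ (with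 $x^0=1$). Here the $p=|C|$ chords of $C$ cut the polygon into $p+1$ faces; for a face $\alpha$ let $S_C(\alpha)$ be the (nonempty) set of sides of the polygon bordering $\alpha$. $q_C(D)$ is obtained by contracting every chord of $C$ to a point: each face $\alpha$ becomes a polygon with set of sides $S_C(\alpha)$, rooted at the starting vertex of its side of minimal label, carrying the chords of $D$ not in $C$ that lie in $\alpha$; this is a dissection diagram, and $q_C(D)$ is the product of these over all faces. $r_C(D)$ is the dissection diagram of degree $p$ obtained by keeping the chords of $C$ and contracting all sides which are not the minimal side of their face, the root being the image of $0$. $k_C(D)$ is the number of chords of $C$ whose orientation in $D$ is opposite to their orientation (towards the root) in $r_C(D)$. The map $L$. On the vector space $\mathfrak g_{\mathcal D}$ with basis the dissection diagrams of positive degree, let $D_1\circ D_2=\sum_D c(D_1,D_2;D)\,D$, where $c(D_1,D_2;D)$ is the coefficient of $D_1\otimes D_2$ in $\Delta(D)$ (a left pre-Lie product). Then $L(D_1D_2)=D_1\circ(D_2\circ a)-(D_1\circ D_2)\circ a$, which is the Oudom–Guin extension $(D_1D_2)\circ a$ of the pre-Lie product. Chords at a vertex. The fertility $f_D(i)$ is the number of chords of $D$ having $i$ as an endpoint. These chords are listed as $a^i_{D,1},\dots,a^i_{D,f_D(i)}$ in the order in which their other endpoints are met in the sequence $i-1,i-2,\dots,0,n,n-1,\dots,i+1$ (for $i=0$: $n,n-1,\dots,1$). ''The first $t$ chords at $i$'' means $a^i_{D,1},\dots,a^i_{D,t}$. Insertion of a chord in two diagrams. Let $D_1,D_2$ have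 degrees $n_1,n_2\ge1$. All diagrams below are dissection diagrams of degree $n_1+n_2+1$. - For $0\le t\le f_{D_1}(0)$, $1\le j\le n_2$, $0\le\tau\le f_{D_2}(j)$, $\Gamma^1_{t,j,\tau}(D_1\otimes D_2)$ has as chords: $\{j,j+n_1+1\}$; the images of the chords of $D_2$, where an endpoint $u<j$ stays $u$, an endpoint $u>j$ becomes $u+n_1+1$, and the endpoint $j$ stays $j$ for the first $\tau$ chords at $j$ and becomes $j+n_1+1$ for the others; the images of the chords of $D_1$, where an endpoint $v\ge1$ becomes $v+j$ and the endpoint $0$ becomes $j+n_1+1$ for the first $t$ chords at $0$ and $j$ for the others. - For $0\le t\le f_{D_1}(0)$, $0\le\tau\le f_{D_2}(0)$, $\Gamma^0_{t,\tau}(D_1\otimes D_2)$ has as chords: $\{0,n_2+1\}$; the images of the chords of $D_2$, where nonzero endpoints are unchanged and the endpoint $0$ becomes $n_2+1$ for the first $\tau$ chords at $0$ and stays $0$ for the others; the images of the chords of $D_1$, where an endpoint $v\ge1$ becomes $v+n_2+1$ and the endpoint $0$ stays $0$ for the first $t$ chords at $0$ and becomes $n_2+1$ for the others. - For the same $t,\tau$, $\Gamma^1_{t,\tau}(D_1\otimes D_2)$ has as chords: $\{0,n_1+1\}$; the images of the chords of $D_1$, where nonzero endpoints are unchanged and the endpoint $0$ becomes $n_1+1$ for the first $t$ chords at $0$ and stays $0$ for the others; the images of the chords of $D_2$, where an endpoint $v\ge1$ becomes $v+n_1+1$ and the endpoint $0$ stays $0$ for the first $\tau$ chords at $0$ and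 becomes $n_1+1$ for the others. (The notation $\Gamma^1_{\tau,i,t}(D_2\otimes D_1)$ means the first construction with the roles of $D_1$ and $D_2$ exchanged.) *)

(* Defs.v *)
From HB Require Import structures.
From mathcomp Require Import all_boot all_order all_algebra.
From mathcomp Require Import finmap.
From mathcomp.multinomials Require Import monalg.

Set Implicit Arguments.
Unset Strict Implicit.
Unset Printing Implicit Defensive.

Import GRing.Theory.

Local Open Scope fset_scope.

(* The chord {u, v} is the ordered pair (min u v, max u v); a set of n chords
   is read as a graph on the vertices 0, ..., n of the regular (n+1)-gon, so
   its cardinal is its degree and the degree is not stored separately. *)
Definition chords := {fset nat * nat}.

Definition chord (u v : nat) : nat * nat := (minn u v, maxn u v).

Definition deg (E : chords) : nat := #|` E|.

Definition adj (E : chords) : rel nat :=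
  fun u v => (u != v) && (chord u v \in E).

Definition crossing (c d : nat * nat) : bool :=
  (c.1 < d.1 < c.2) && (c.2 < d.2) || (d.1 < c.1 < d.2) && (d.2 < c.2).

(* A graph cycle is a duplicate-free closed walk through at least 3 vertices;
   the bounds on the quantifiers are those of the vertex set. *)
Definition acyclic (E : chords) : bool :=
  [forall k : 'I_(deg E).+2, forall p : k.-tuple 'I_(deg E).+1,
     (2 < k) ==> ~~ ucycleb (adj E) [seq val i | i <- p]].

Definition is_dissection (E : chords) : bool :=
  [&& all (fun c => c.1 < c.2 <= deg E) E,
      all (fun c => all (fun d => ~~ crossing c d) E) E
    & acyclic E].

(* The dissection diagrams of positive degree; the one of degree 0 is fset0. *)
Record dissection := Dissection {
  dchords :> chords;
  _ : is_dissection dchords && (dchords != fset0)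
}.

HB.instance Definition _ := [isSub for dchords].
HB.instance Definition _ := [Choice of dissection by <:].

(* The chord {u, v} is oriented from u to v: the simple path of E from u to
   the root 0 starts with this chord. *)
Definition towards (E : chords) (u v : nat) : bool :=
  [exists k : 'I_(deg E).+1, exists p : k.-tuple 'I_(deg E).+1,
     let s := [seq val i | i <- p] in
     [&& uniq [:: u, v & s], path (adj E) u (v :: s) & last v s == 0]].

(* Side i lies on the arc cut off by the chord d from d.1 clockwise to d.2. *)
Definition side_in (d : nat * nat) (i : nat) : bool := d.1 <= i < d.2.

(* Two sides border the same face iff no chord of C separates them. Every face
   borders a side when C is acyclic, so a face is represented by its side of
   minimal label. *)
Definition same_face (C : chords) (i j : nat) : bool :=
  all (fun d => side_in d i == side_in d j) C.

Definition face_sides (n : nat) (C : chords) (i : nat) : seq nat :=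
  [seq j <- iota 0 n.+1 | same_face C i j].

Definition min_sides (n : nat) (C : chords) : seq nat :=
  [seq i <- iota 0 n.+1 | all (fun j => ~~ same_face C i j) (iota 0 i)].

(* By convexity, a vertex is on the boundary of the face bordered by the side i
   iff it is, in the wide sense, on the same side as i of each chord of C. *)
Definition vertex_on_face (C : chords) (i v : nat) : bool :=
  all (fun d => if side_in d i then d.1 <= v <= d.2 else ~~ (d.1 < v < d.2)) C.

Definition chords_in_face (D C : chords) (i : nat) : chords :=
  [fset c in D | [&& c \notin C, vertex_on_face C i c.1
                   & vertex_on_face C i c.2]].

(* Image of the vertex v when only the sides of the increasing list S survive:
   v is identified with the starting vertex of the first side of S met clockwise
   from v, and the starting vertex of the k-th element of S (from 0) becomes the
   vertex k. *)
Definition contract (S : seq nat) (v : nat) : nat :=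
  count (fun s => s < v) S %% size S.

Definition contract_chords (S : seq nat) (E : chords) : chords :=
  [fset chord (contract S c.1) (contract S c.2) | c in E].

Definition qface (D C : chords) (i : nat) : chords :=
  contract_chords (face_sides (deg D) C i) (chords_in_face D C i).

Definition rpart (D C : chords) : chords :=
  contract_chords (min_sides (deg D) C) C.

Definition kexp (D C : chords) : nat :=
  let f := contract (min_sides (deg D) C) in
  #|` [fset c in C | towards D c.1 c.2 != towards (rpart D C) (f c.1) (f c.2)]|.

(* A diagram as a monomial of the polynomial algebra on the diagrams of positive
   degree; only the diagram fset0 of degree 0 takes the default value 1, since
   the contractions below are dissection diagrams. *)
Definition diagram_monom (E : chords) : {cmonom dissection} :=
  if insub E is Some D then ucm D else mone.

Definition qpart (D C : chords) : {cmonom dissection} :=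
  \big[mmul/mone]_(i <- min_sides (deg D) C) diagram_monom (qface D C i).

Lemma dissection1_proof :
  is_dissection [fset (0, 1)] && ([fset (0, 1)] != fset0).
Proof.
have E1 : deg [fset (0, 1)] = 1 by rewrite /deg cardfs1.
apply/andP; split; last by apply/fset0Pn; exists (0, 1); rewrite inE.
apply/and3P; split.
- by apply/allP=> c; rewrite inE => /eqP->; rewrite E1.
- by apply/allP=> c; rewrite inE => /eqP->; apply/allP=> d; rewrite inE => /eqP->.
- apply/forallP=> k; apply/forallP=> p; apply/implyP=> k2.
  suff: k < 3 by rewrite ltnS leqNgt k2.
  by apply: leq_trans (ltn_ord k) _; rewrite E1.
Qed.

Definition diag_a : dissection := Dissection dissection1_proof.

Local Open Scope ring_scope.

Section PreLie.
Variables (K : fieldType) (x : K).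

(* The tensor square of the polynomial algebra has the pairs of monomials as a
   basis: the pair (q, r) is q (x) r. *)
Definition coproduct (D : dissection) :
    {malg K[({cmonom dissection} * {cmonom dissection})%type]} :=
  \sum_(C <- fpowerset (dchords D))
     << x ^+ kexp D C *g (qpart D C, diagram_monom (rpart D C)) >>.

Definition coef (D1 D2 D : dissection) : K :=
  (coproduct D)@_(ucm D1, ucm D2).

Definition all_chords (n : nat) : chords :=
  [fset c in allpairs pair (iota 0 n.+1) (iota 0 n.+1) | (c.1 < c.2)%N].

Definition dissections (n : nat) : seq dissection :=
  [seq D <- pmap insub (fpowerset (all_chords n)) | deg (dchords D) == n].

(* The coproduct preserves the degree, so coef D1 D2 D = 0 for D of any other
   degree. *)
Definition prelie_basis (D1 D2 : dissection) : {malg K[dissection]} :=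
  \sum_(D <- dissections (deg D1 + deg D2)) coef D1 D2 D *: << D >>.

Definition prelie (u v : {malg K[dissection]}) : {malg K[dissection]} :=
  \sum_(D1 <- msupp u) \sum_(D2 <- msupp v)
     (u@_D1 * v@_D2) *: prelie_basis D1 D2.

(* The basis vector of E; the default 0 is never taken below, where E is always
   a dissection diagram of positive degree. *)
Definition vec (E : chords) : {malg K[dissection]} :=
  if insub E is Some D then << (D : dissection) >> else 0.

Definition L (D1 D2 : dissection) : {malg K[dissection]} :=
  prelie << D1 >> (prelie << D2 >> << diag_a >>)
  - prelie (prelie << D1 >> << D2 >>) << diag_a >>.

End PreLie.

Lemma mem_dissections (n : nat) (D : dissection) :
  (D \in dissections n) = (deg D == n).
Proof.
rewrite mem_filter; case: eqP => //= <-.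
rewrite mem_pmap; apply/mapP; exists (dchords D); last by rewrite valK.
rewrite fpowersetE; apply/fsubsetP => c cD.
have /andP[/and3P[/allP/(_ _ cD)/andP[c12 c2] _ _] _] := valP D.
rewrite in_fset inE c12 andbT; apply/allpairsP; exists c; split.
- by rewrite mem_iota leq0n add0n ltnS; apply: leq_trans c2; apply: ltnW.
- by rewrite mem_iota leq0n add0n ltnS.
- by case: (c).
Qed.

Lemma dissections_uniq (n : nat) : uniq (dissections n).
Proof.
apply/filter_uniq/(pmap_uniq (g := val)); last exact: fset_uniq.
exact: insubK.
Qed.

Local Open Scope nat_scope.

Definition fertility (E : chords) (i : nat) : nat :=
  #|` [fset c in E | (c.1 == i) || (c.2 == i)]|.

(* The other endpoints of the chords at i, met in the order
   i-1, ..., 0, n, n-1, ..., i+1. *)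
Definition neighbours (E : chords) (i : nat) : seq nat :=
  [seq w <- rev (iota 0 i) ++ rev (iota i.+1 (deg E - i)) | chord i w \in E].

Definition first_chords (E : chords) (t i : nat) : pred nat :=
  fun w => w \in take t (neighbours E i).

(* The index (from 1) in the list of chords at i of the chord labelled i. *)
Definition label_index (E : chords) (i : nat) : nat :=
  (find (towards E i) (neighbours E i)).+1.

(* f u w is the image of the endpoint u of the chord {u, w}. *)
Definition map_chords (f : nat -> nat -> nat) (E : chords) : chords :=
  [fset chord (f c.1 c.2) (f c.2 c.1) | c in E].

(* Gamma^1_{t, j, tau} (D1 (x) D2), for 1 <= j <= deg D2. *)
Definition GammaV (t j tau : nat) (D1 D2 : chords) : chords :=
  let n1 := deg D1 in
  [fset chord j (j + n1 + 1)]
  `|` map_chords (fun u w =>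
        if u < j then u
        else if j < u then u + n1 + 1
        else if first_chords D2 tau j w then j else j + n1 + 1) D2
  `|` map_chords (fun v w =>
        if 0 < v then v + j
        else if first_chords D1 t 0 w then j + n1 + 1 else j) D1.

(* Gamma^lambda_{t, tau} (D1 (x) D2). *)
Definition GammaR (lambda : bool) (t tau : nat) (D1 D2 : chords) : chords :=
  let n1 := deg D1 in
  let n2 := deg D2 in
  if lambda then
    [fset chord 0 (n1 + 1)]
    `|` map_chords (fun v w =>
          if 0 < v then v
          else if first_chords D1 t 0 w then n1 + 1 else 0) D1
    `|` map_chords (fun v w =>
          if 0 < v then v + n1 + 1
          else if first_chords D2 tau 0 w then 0 else n1 + 1) D2
  else
    [fset chord 0 (n2 + 1)]
    `|` map_chords (fun v w =>
          if 0 < v then v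
          else if first_chords D2 tau 0 w then n2 + 1 else 0) D2
    `|` map_chords (fun v w =>
          if 0 < v then v + n2 + 1
          else if first_chords D1 t 0 w then 0 else n2 + 1) D1.

(* Main.v *)
(* A chord is a bipartition of the sides of the polygon. A set of n noncrossing
   chords of the (n+1)-gon is a dissection diagram iff any two sides are separated
   by a chord; the chords are then the edges of a tree whose vertices are the
   sides, the dual tree. In these terms q_C(D) deletes the edges in C, r_C(D)
   contracts the edges not in C, and the orientation of a chord is read off the
   order of the two ends of its dual edge. So k_C(D) counts the chords of C whose
   dual edge {p, q} changes direction when p and q are replaced with the minimal
   sides of their faces.

   The coefficient of D in D1 o (D2 o a) is a sum over the pairs (C, c) with c in C
   and C a subset of D. Such a C is the same as c together with a set of chords in
   each of the two parts that c cuts D into, and the exponents add up. The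
   coefficient in (D1 o D2) o a collects the pairs where c cuts off a single side.
   In the other pairs that contribute, C contains all the chords of one part and
   none of the other, so L(D1 D2) is the sum of x^(k_c(D)) D over the D and the
   chords c that cut D into D1 and D2. Conversely D is recovered from c and its two
   parts by distributing the chords at the contracted vertices between the ends of
   c; noncrossingness forces the distributions t, tau of the Gammas. The direction
   of c depends on the end of c to which the chord labelled j is attached. *)

Require Import Defs.
From HB Require Import structures.
From mathcomp Require Import all_boot all_order all_algebra.
From mathcomp Require Import finmap zify.
From mathcomp.multinomials Require Import monalg.

Set Implicit Arguments.
Unset Strict Implicit.
Unset Printing Implicit Defensive.

Import GRing.Theory.

Local Open Scope fset_scope.
Local Open Scope nat_scope.

Implicit Types (c d : nat * nat) (C D E : chords) (S : seq nat).

(** * Faces and dual edges *)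

(** Cycles and simple paths behave badly under cutting and contraction, so they are eliminated at
    once: cycles enter only through [is_dissectionP], oriented paths only through [towardsE], and
    both rest on two-colourings of the vertices that are constant along chords. Afterwards only the
    separation of sides by chords matters.

    Sizes, injectivity and the fact that quotients are diagrams all come from one inequality: a
    chord crossing no other chord adds at most one face. A diagram of degree n has n chords and n +
    1 faces, so the inequality is an equality at every intermediate set of chords.

    The factors of [q_C(D)] and [r_C(D)] are instances of the single operation [restrict], which
    contracts all sides outside a given list; hence iterated quotients reduce to composing lists of
    sides.

    The exponents add up because the half of the polygon that misses side 0 is an interval of sides:
    a side of the other half never lies between a side of this interval and the minimal side of its
    face, which rules out two flips that cancel. *)

Definition planar n C :=
  {in C, forall c, c.1 < c.2 <= n} /\ {in C &, forall c d, ~~ crossing c d}.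

Definition separating n C :=
  forall i j, i <= n -> j <= n -> same_face C i j -> i = j.

(** Separation of the sides replaces acyclicity because it is visibly inherited by contractions. *)
Definition diagram n C := [/\ planar n C, separating n C & #|` C| = n].

Lemma same_faceP C i j :
  reflect {in C, forall c, side_in c i = side_in c j} (same_face C i j).
Proof.
by apply: (iffP allP) => H c cC; [apply/eqP/H | apply/eqP; apply: H].
Qed.

Lemma same_face_refl C i : same_face C i i.
Proof. by apply/same_faceP. Qed.

Lemma same_face_sym C i j : same_face C i j = same_face C j i.
Proof. by apply/same_faceP/same_faceP => H c /H. Qed.

Lemma same_face_trans C : transitive (same_face C).
Proof.
by move=> j i k /same_faceP ij /same_faceP jk; apply/same_faceP => c cC; rewrite ij ?jk.
Qed.

Lemma same_face_sub C D i j : C `<=` D -> same_face D i j -> same_face C i j.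
Proof. by move=> /fsubsetP CD /same_faceP H; apply/same_faceP => c /CD /H. Qed.

Lemma same_faceU1 c C i j :
  same_face (c |` C) i j = (side_in c i == side_in c j) && same_face C i j.
Proof.
apply/same_faceP/andP => [H|[/eqP cij /same_faceP H] d].
  split; first by rewrite H ?fset1U1.
  by apply/same_faceP => d dC; apply: H; rewrite fset1Ur.
by case/fset1UP => [->|/H].
Qed.

(** The sides [i], [j], [k], [l] occupy the four quadrants cut out by [c] and [d], and two chords of
    a convex polygon with a side in each quadrant cross. *)
Lemma crossing_sides c d i j k l :
    side_in c i = side_in c j -> side_in c k = side_in c l ->
    side_in c i != side_in c k ->
    side_in d i != side_in d j -> side_in d k != side_in d l ->
  crossing c d.
Proof. by case: c d => [c1 c2] [d1 d2]; rewrite /side_in /crossing /=; lia. Qed.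

Lemma planar_sub n C D : C `<=` D -> planar n D -> planar n C.
Proof.
by move=> /fsubsetP CD [rD xD]; split=> [c /CD/rD | c d /CD cD /CD dD] //; apply: xD.
Qed.

(** A chord crossing no chord of [C] runs inside a single face of [C]: a chord of [C] between two
    faces split by [d] would cross [d] by [crossing_sides]. *)
Lemma cut_same_face C d i j k l :
    {in C, forall c, ~~ crossing c d} ->
    same_face C i j -> same_face C k l ->
    side_in d i != side_in d j -> side_in d k != side_in d l ->
  same_face C i k.
Proof.
move=> xd /same_faceP ij /same_faceP kl dij dkl; apply/same_faceP => c cC.
apply: contraNeq (xd c cC) => cik.
by apply: (crossing_sides _ _ cik dij dkl); [apply: ij | apply: kl].
Qed.

Definition is_min C i := all (fun j => ~~ same_face C i j) (iota 0 i).

Lemma is_minP C i : reflect (forall j, j < i -> ~~ same_face C i j) (is_min C i).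
Proof.
by apply: (iffP allP) => H j Hj; apply: H; rewrite mem_iota in Hj *; lia.
Qed.

Lemma min_sidesE n C : min_sides n C = [seq i <- iota 0 n.+1 | is_min C i].
Proof. by []. Qed.

Lemma mem_min_sides n C i : (i \in min_sides n C) = (i <= n) && is_min C i.
Proof. by rewrite mem_filter mem_iota andbC. Qed.

Lemma sorted_min_sides n C : sorted ltn (min_sides n C).
Proof. exact/sorted_filter/iota_ltn_sorted/ltn_trans. Qed.

Lemma min_sides_uniq n C : uniq (min_sides n C).
Proof. exact/filter_uniq/iota_uniq. Qed.

(** Only the face in which [d] runs is split. A side that becomes minimal has a smaller side of its
    old face across [d], so by [cut_same_face] all such sides come from one old face. *)
Lemma size_min_sides_add n C d : {in C, forall c, ~~ crossing c d} ->
  size (min_sides n (d |` C)) <= (size (min_sides n C)).+1.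
Proof.
move=> xd; rewrite !min_sidesE !size_filter.
set P := is_min (d |` C); set Q := is_min C.
have -> : count P (iota 0 n.+1) =
    count (predI P Q) (iota 0 n.+1) + count (predI P (predC Q)) (iota 0 n.+1).
  by elim: iota => //= i s ->; case: (P i); case: (Q i); lia.
rewrite -[X in _ <= X]addn1; apply: leq_add; first by apply: sub_count => i /andP[].
rewrite -size_filter.
have: uniq [seq i <- iota 0 n.+1 | predI P (predC Q) i] by rewrite filter_uniq ?iota_uniq.
have: forall i, i \in [seq i <- iota 0 n.+1 | predI P (predC Q) i] -> P i && ~~ Q i.
  by move=> i; rewrite mem_filter => /andP[].
(* The newly minimal sides form a duplicate-free list, so it has at most one entry once any two
   entries [i] and [j] are equal. *)
case: filter => [//|i [//|j s]] H; suff: i = j by move=> ->; rewrite /= inE eqxx.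
have cut k : P k && ~~ Q k -> exists l, [/\ l < k, same_face C k l & side_in d k != side_in d l].
  move=> /andP[/is_minP Pk /allPn[l]]; rewrite mem_iota /= negbK => lk kl.
  by exists l; split=> //; have := Pk l lk; rewrite same_faceU1 kl andbT.
have PQi := H i (mem_head _ _); have [i' [ii' ci di]] := cut i PQi.
have PQj : P j && ~~ Q j by apply: H; rewrite !inE eqxx orbT.
have [j' [jj' cj dj]] := cut j PQj.
have cij := cut_same_face xd ci cj di dj.
have ci'j' : same_face C i' j'.
  by apply: same_face_trans cj; apply: same_face_trans cij; rewrite same_face_sym.
have cut2 k l : same_face C k l -> P k -> P l -> side_in d k = side_in d l -> k = l.
  move=> kl /is_minP Pk /is_minP Pl dkl; case: (ltngtP k l) => // lt.
    by have := Pl _ lt; rewrite same_faceU1 dkl eqxx same_face_sym kl.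
  by have := Pk _ lt; rewrite same_faceU1 dkl eqxx kl.
have [/andP[Pi _] /andP[Pj _]] := (PQi, PQj).
case: (eqVneq (side_in d i) (side_in d j)) => [|dij]; first exact: cut2.
(* otherwise d separates i' and j' as well, so that i' or j' is on the side of
   the larger of i and j *)
have dij' : side_in d i = side_in d j' by move: dij dj; do 3 case: side_in.
have dji' : side_in d j = side_in d i' by move: dij di; do 3 case: side_in.
case: (ltngtP i j) => // lt.
  have: i' < j := ltn_trans ii' lt.
  move/(is_minP _ _ Pj); rewrite same_faceU1 dji' eqxx /=.
  by rewrite (same_face_trans _ ci) // same_face_sym.
have: j' < i := ltn_trans jj' lt.
by move/(is_minP _ _ Pi); rewrite same_faceU1 dij' eqxx (same_face_trans cij cj).
Qed.

Lemma size_min_sides_sub n C D : C `<=` D -> planar n D ->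
  size (min_sides n D) + #|` C| <= size (min_sides n C) + #|` D|.
Proof.
have [k] := ubnP #|` D `\` C|; elim: k D => // k IHk D; rewrite ltnS => Dk CD pD.
have [/eqP|[d dDC]] := fset_0Vmem (D `\` C).
  by rewrite fsetD_eq0 => DC; rewrite (_ : D = C) //; apply/eqP; rewrite eqEfsubset DC.
have /fsetDP[dD dC] := dDC.
have CD' : C `<=` D `\ d by rewrite fsubsetD1 CD.
have cD' := cardfsD1 d D; rewrite dD in cD'.
have lt : #|` (D `\ d) `\` C| < k.
  apply: leq_trans Dk; rewrite (cardfsD1 d (D `\` C)) dDC add1n ltnS fsubset_leq_card //.
  by apply/fsubsetP => e; rewrite !inE => /and3P[-> -> ->].
have le := IHk _ lt CD' (planar_sub (fsubD1set _ _) pD).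
have xd : {in D `\ d, forall e, ~~ crossing e d}.
  by case: pD => _ xD e eD; apply: xD => //; apply: (fsubsetP (fsubD1set D d)).
have := size_min_sides_add n xd; rewrite fsetD1K //.
by move: le; rewrite cD'; lia.
Qed.

Lemma min_sides_separating n C : separating n C -> min_sides n C = iota 0 n.+1.
Proof.
move=> sC; rewrite min_sidesE; apply/all_filterP/allP => i; rewrite mem_iota => /andP[_ ltin].
apply/is_minP => j ji; apply/negP => /sC; lia.
Qed.

Lemma size_min_sides0 n : size (min_sides n fset0) = 1.
Proof.
rewrite min_sidesE /= (_ : filter _ _ = [::]) //.
apply/eqP; rewrite -(negbK (_ == _)) -has_filter; apply/hasPn => i; rewrite mem_iota => /andP[i0 _].
by apply/negP => /is_minP/(_ 0 i0)/negP; apply; apply/same_faceP.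
Qed.

Lemma separating_card n C : planar n C -> separating n C -> n <= #|` C|.
Proof.
move=> pC sC; have := size_min_sides_sub (fsub0set C) pC.
by rewrite min_sides_separating // size_iota size_min_sides0 cardfs0; lia.
Qed.

(** The bounds on the faces gained from [fset0] to [C] and from [C] to [D] add up to exactly what
    [D] attains, so both are equalities. *)
Lemma size_min_sides n C D : diagram n D -> C `<=` D ->
  size (min_sides n C) = #|` C|.+1.
Proof.
case=> pD sD cD CD; have := size_min_sides_sub CD pD.
have := size_min_sides_sub (fsub0set C) (planar_sub CD pD).
by rewrite (min_sides_separating sD) size_iota size_min_sides0 cardfs0 cD; lia.
Qed.

(* The sides p and q are separated by the chord c of D and by no other: the
   dual of c is the chord {p, q} of the polygon whose vertices are the sides. *)
Definition dual n D c p q :=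
  [/\ p <= n, q <= n, side_in c p != side_in c q & same_face (D `\ c) p q].

Lemma dual_sym n D c p q : dual n D c p q -> dual n D c q p.
Proof. by case=> ? ? ? ?; split=> //; rewrite 1?eq_sym // same_face_sym. Qed.

Lemma dual_other n D c p q d :
  dual n D c p q -> d \in D -> d != c -> side_in d p = side_in d q.
Proof. by case=> _ _ _ /same_faceP H dD dc; apply: H; rewrite !inE dc. Qed.

(** Without [c] there are only [n] faces for [n + 1] sides, so some [q] shares its face with a
    smaller [p]; as [D] separates all sides, [c] separates these two. *)
Lemma dual_exists n D c : diagram n D -> c \in D -> exists p q, dual n D c p q.
Proof.
move=> dD cD; have := size_min_sides dD (fsubD1set D c).
have [_ sD nD] := dD; have := cardfsD1 c D; rewrite cD nD => nE szE.
have : ~~ all (is_min (D `\ c)) (iota 0 n.+1).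
  apply/negP => /all_filterP; rewrite -min_sidesE => eqE.
  by move: szE; rewrite eqE size_iota; lia.
case/allPn => q; rewrite mem_iota => qn /allPn[p]; rewrite mem_iota negbK => pq qp.
exists q, p; split=> //; [lia..|].
apply/negP => /eqP cqp; suff: q = p by lia.
by apply: sD; [lia..|rewrite -(fsetD1K cD) same_faceU1 cqp eqxx].
Qed.

(** * Spanning trees and the orientation of chords *)

(** Such colourings are the unions of connected components. Stating connectedness and independence
    with them turns the tree property into linear algebra over the field with two elements. *)
Definition preserved C (g : nat -> bool) := {in C, forall c, g c.1 = g c.2}.

Definition in_range n C := {in C, forall c, c.1 < c.2 <= n}.

Definition connected n C :=
  forall g : nat -> bool, preserved C g -> forall v, v <= n -> g v = g 0.

(** Every chord is a bridge; this is acyclicity expressed without cycles. *)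
Definition independent C :=
  {in C, forall c, exists2 g : nat -> bool, preserved (C `\ c) g & g c.1 != g c.2}.

Lemma preserved_adj C g u v : preserved C g -> adj C u v -> g u = g v.
Proof.
move=> gC /andP[_ /gC]; rewrite /chord /=.
by case: (leqP u v) => [|_ ->].
Qed.

Lemma preserved_path C g u p : preserved C g -> path (adj C) u p ->
  {in u :: p, forall w, g w = g u}.
Proof.
move=> gC; elim: p u => [|v p IHp] u /= => [_ w|/andP[uv /IHp vp] w].
  by rewrite inE => /eqP->.
rewrite inE => /predU1P[-> //|/vp ->].
by rewrite (preserved_adj gC uv).
Qed.

(* There are 2^(n+1) colourings of the vertices, and the 2^n sums of the
   colourings that witness independence, up to a constant, exhaust them. *)
Lemma independent_connected n C :
  in_range n C -> #|` C| = n -> independent C -> connected n C.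
Proof.
move=> rC cC iC.
pose e (k : 'I_n) := nth (0, 0) C k.
have eC k : e k \in (C : {fset _}) by apply: mem_nth; rewrite -cC in k *; exact: ltn_ord.
have e_inj : injective e.
  move=> k l /eqP; rewrite nth_uniq -?[size _]/(#|` C|) ?cC ?fset_uniq //.
  by move=> /eqP/val_inj.
have e_onto c : c \in C -> exists k, c = e k.
  move=> cC'; have lt : index c C < n by rewrite -cC index_mem.
  by exists (Ordinal lt); rewrite /e /= nth_index.
have /fin_all_exists[G HG] : forall k, exists g : nat -> bool,
    preserved (C `\ e k) g /\ g (e k).1 != g (e k).2.
  by move=> k; have [g] := iC _ (eC k); exists g.
pose f (Ab : {ffun 'I_n -> bool} * bool) : {ffun 'I_n.+1 -> bool} :=
  [ffun v : 'I_n.+1 => Ab.2 (+) \big[addb/false]_(k | Ab.1 k) G k v].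
(* Only the [k]-th witness differs at the two ends of [e k], so [A] can be read off the sum
   [f (A, b)]. *)
have fE A b k (i j : 'I_n.+1) : i = (e k).1 :> nat -> j = (e k).2 :> nat ->
    f (A, b) i (+) f (A, b) j = A k.
  move=> ik jk; rewrite !ffunE /= addbACA addbb -big_split /= big_mkcond (bigD1 k) //=.
  rewrite big1 => [|l lk].
    have [_] := HG k; rewrite ik jk; case: (A k) => //.
    by do 2 case: (G k _).
  case: (A l) => //; have [/(_ (e k))] := HG l.
  rewrite !inE eC (inj_eq e_inj) eq_sym lk => /(_ isT) E _.
  by rewrite ik jk E addbb.
have lt1 k : (e k).1 < n.+1 by have := rC _ (eC k); lia.
have lt2 k : (e k).2 < n.+1 by have := rC _ (eC k); lia.
have f_inj : injective f.
  move=> [A b] [A' b'] eqf.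
  have eqA : A = A'.
    apply/ffunP => k; rewrite -(fE A b k (Ordinal (lt1 k)) (Ordinal (lt2 k))) // eqf.
    exact: fE.
  move/ffunP/(_ ord0): eqf; rewrite !ffunE /= eqA => /addIb ->; by [].
move=> g gC v vn.
have : [ffun i : 'I_n.+1 => g i] \in codom f.
  apply: inj_card_onto => //.
  by rewrite card_prod !card_ffun card_bool !card_ord expnS mulnC.
case/codomP => -[A b] gE.
have A0 k : A k = false.
  rewrite -(fE A b k (Ordinal (lt1 k)) (Ordinal (lt2 k))) // -gE !ffunE /=.
  by rewrite (gC _ (eC k)) addbb.
have gb i : i <= n -> g i = b.
  rewrite -ltnS => lti; move/ffunP/(_ (Ordinal lti)): gE; rewrite !ffunE /= => ->.
  by rewrite big_pred0 // addbF.
by rewrite !gb.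
Qed.

(** For sides [i < j], a chord separates them iff exactly one of its ends is among the vertices
    [i + 1, ..., j]. If no chord does, colouring these vertices contradicts connectedness. *)
Lemma connected_separating n C : in_range n C -> connected n C -> separating n C.
Proof.
move=> rC nC.
have lt i j : i < j -> j <= n -> same_face C i j -> false.
  move=> ij jn /same_faceP H.
  suff gC : preserved C (fun v => i < v <= j) by have /= := nC _ gC j jn; lia.
  by move=> c cC /=; have := H c cC; have := rC c cC; rewrite /side_in; lia.
move=> i j lein lejn ij; case: (ltngtP i j) => // cmp; first by have := lt i j cmp lejn ij.
by have := lt j i cmp lein; rewrite same_face_sym => /(_ ij).
Qed.

(** Side [p] joins the vertices [p] and [p + 1], so removing the sides [p] and [q] leaves two arcs
    of vertices; this is the arc without the root. For a dual pair it is the part of the tree that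
    the chord cuts off from the root. *)
Definition dual_colour (p q v : nat) := minn p q < v <= maxn p q.

Lemma dual_colour_preserved n D c p q :
  in_range n D -> dual n D c p q -> preserved (D `\ c) (dual_colour p q).
Proof.
move=> rD dc d; rewrite !inE => /andP[dc' dD].
have := dual_other dc dD dc'; have := rD d dD; have [pn qn _ _] := dc.
by rewrite /side_in /dual_colour; lia.
Qed.

Lemma dual_colour_cut n c p q :
  c.1 < c.2 <= n -> p <= n -> q <= n -> side_in c p != side_in c q ->
  dual_colour p q c.1 != dual_colour p q c.2.
Proof. by rewrite /side_in /dual_colour; lia. Qed.

Lemma diagram_independent n C : diagram n C -> independent C.
Proof.
move=> dC c cC; have [[rC _] _ _] := dC; have [p [q dc]] := dual_exists dC cC.
exists (dual_colour p q); first exact: dual_colour_preserved dc.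
by have [pn qn cpq _] := dc; apply: (dual_colour_cut (n := n)) => //; apply: rC.
Qed.

Lemma diagram_connected n C : diagram n C -> connected n C.
Proof.
move=> dC; have [[rC _] _ cC] := dC.
by apply: independent_connected => //; exact: diagram_independent dC.
Qed.

Definition ord_adj n C : rel 'I_n.+1 := fun i j => adj C i j.

Lemma connect_preserved n C (i : 'I_n.+1) :
  in_range n C -> preserved C (fun v => connect (@ord_adj n C) i (inord v)).
Proof.
move=> rC c cC; have rc : c.1 < c.2 <= n := rC c cC.
have [lt1 lt2] : c.1 < n.+1 /\ c.2 < n.+1 by lia.
have ac : ord_adj C (inord c.1 : 'I_n.+1) (inord c.2).
  rewrite /ord_adj /adj !inordK //.
  have -> : chord c.1 c.2 = c by rewrite /chord; case: (c) rc => a b /= H; congr (_, _); lia.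
  by rewrite cC andbT; lia.
have ca : ord_adj C (inord c.2 : 'I_n.+1) (inord c.1).
  by move: ac; rewrite /ord_adj /adj eq_sym /chord minnC maxnC.
by apply/idP/idP => H; apply: (connect_trans H); apply: connect1.
Qed.

(** The witness is reachability from [c.1] without [c]: if it reached [c.2], a simple path closed up
    by [c] would be a cycle. *)
Lemma acyclic_independent E : in_range (deg E) E -> acyclic E -> independent E.
Proof.
move=> rE aE c cE; set n := deg E in rE *; have rc : c.1 < c.2 <= n := rE c cE.
have rE' : in_range n (E `\ c) by move=> d; rewrite !inE => /andP[_ /rE].
pose u : 'I_n.+1 := inord c.1; pose v : 'I_n.+1 := inord c.2.
have uE : u = c.1 :> nat by rewrite inordK //; lia.
have vE : v = c.2 :> nat by rewrite inordK //; lia.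
have cuv : chord u v = c.
  by rewrite uE vE /chord; case: (c) rc => a b /= H; congr (_, _); lia.
exists (fun w => connect (@ord_adj n (E `\ c)) u (inord w)).
  exact: connect_preserved.
rewrite connect0; apply/negP => /eqP/esym/connectP[p0 /shortenP[p pp pu _] vp] {p0}.
(* A path with a single step would be the removed chord [c]; so the cycle has at least the three
   vertices demanded by [acyclic]. *)
have p2 : 1 < size p.
  case: p pp pu vp => [|w [|//]] /=; first by move=> _ _ /(congr1 val) /=; rewrite -/v uE vE; lia.
  move=> /andP[uw _] _ vw; move: uw; rewrite -vw -/v /ord_adj /adj cuv.
  by rewrite !inE eqxx /= andbF.
have pn : (size p).+1 < n.+2.
  have := card_uniqP pu; have := max_card [in u :: p].
  by rewrite card_ord /= => le <-; rewrite ltnS.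
have /forallP/(_ (Ordinal pn))/forallP/(_ (in_tuple (u :: p))) := aE.
move/implyP/(_ p2)/negP; apply; apply/andP; split; last by rewrite map_inj_uniq //; exact: val_inj.
rewrite [map _ _]/= /= -map_rcons path_map rcons_path.
apply/andP; split.
  apply: sub_path pp => i j; rewrite /ord_adj /= /adj !inE => /and3P[-> _ ->] //.
rewrite -vp /= -/v /adj /= eq_sym /chord minnC maxnC -/(chord u v) cuv cE andbT.
by rewrite uE vE; lia.
Qed.

Lemma chordC u v : chord u v = chord v u.
Proof. by rewrite /chord minnC maxnC. Qed.

Lemma chord_eqE u v w z :
  (chord u v == chord w z) = (u == w) && (v == z) || (u == z) && (v == w).
Proof. by rewrite /chord xpair_eqE; lia. Qed.

Lemma adjD1 E c u v : adj (E `\ c) u v = adj E u v && (chord u v != c).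
Proof. by rewrite /adj in_fsetD1 andbCA andbC. Qed.

Lemma path_adjD1 E u v x p : u \notin x :: p ->
  path (adj E) x p -> path (adj (E `\ chord u v)) x p.
Proof.
move=> ux; apply: (sub_in_path (P := predC1 u)) => [y z /= yu zu|].
  by rewrite adjD1 => ->; rewrite chord_eqE (negPf yu) (negPf zu) andbF.
by apply/allP => y yp; apply: contraNneq ux => <-.
Qed.

(** The rest of a cycle leads from [v] back to [u] without the chord between them, so no colouring
    constant along the other chords tells its ends apart. *)
Lemma independent_acyclic E : independent E -> acyclic E.
Proof.
move=> iE; apply/forallP => k; apply/forallP => -[s /= /eqP sk]; apply/implyP => k2.
have : 2 < size [seq val i | i <- s] by rewrite size_map sk.
move: [seq val i | i <- s] => {s sk} [|u [|v [|w s]]] // _.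
apply/negP => /andP[]; set t := w :: s.
rewrite /cycle rcons_path => /andP[/andP[uv pt] lu] /and3P[].
rewrite in_cons negb_or => /andP[uv' ut] vt _.
have [g gE] := iE _ (andP uv).2; case/negP.
have lu' : adj (E `\ chord u v) (last v t) u.
  rewrite adjD1 lu chord_eqE negb_or eqxx andbT (negPf uv') andbF.
  by apply: contraNneq vt => <-; exact: mem_last.
have uvt : u \notin v :: t by rewrite in_cons negb_or uv' ut.
have := preserved_path gE (@path_adjD1 E u v v t uvt pt) (mem_last v t).
rewrite (preserved_adj gE lu') => guv.
by rewrite /chord /=; case: (leqP u v) => _; rewrite guv.
Qed.

Lemma is_dissectionP E : reflect (diagram (deg E) E) (is_dissection E).
Proof.
apply: (iffP and3P) => [[/allP rE /allP xE aE]|dE].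
  have pE : planar (deg E) E by split=> // c d cE dE; apply: (allP (xE c cE)).
  split=> //; apply: connected_separating => //; apply: independent_connected => //.
  exact: acyclic_independent.
have [[rE xE] _ _] := dE; split; last by apply: independent_acyclic; exact: diagram_independent dE.
  by apply/allP.
by apply/allP => c cE; apply/allP => d dE'; apply: xE.
Qed.

(** A simple path that starts with a chord never uses it again, so the chord points to the root
    exactly when its start lies in the part it cuts off from the root. *)
Lemma towardsE n E u v p q : diagram n E -> u <= n -> v <= n ->
  chord u v \in E -> dual n E (chord u v) p q ->
  towards E u v = dual_colour p q u.
Proof.
move=> dE un vn uvE dpq; have [[rE _] _ cE] := dE.
set c := chord u v in uvE dpq; have [pn qn cpq _] := dpq.
have gE := dual_colour_preserved rE dpq.
have := dual_colour_cut (rE c uvE) pn qn cpq.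
move: gE; have : dual_colour p q 0 = false by rewrite /dual_colour; lia.
move: (dual_colour p q) => g g0 gE gc.
have uv : u != v by have := rE c uvE; rewrite /c /chord /=; lia.
have guv : g u != g v.
  by move: gc; rewrite /c /chord /=; case: (leqP u v) => // _; rewrite eq_sym.
rewrite /towards /deg cE.
apply/existsP/idP => [[k /existsP[s /= /and3P[us /andP[_ ps] /eqP ls]]]|gu].
  have us' : u \notin v :: [seq val i | i <- s] by case/andP: us.
  have := preserved_path gE (path_adjD1 v us' ps) (mem_last _ _).
  by rewrite ls g0 => gv; move: guv; rewrite -gv; case: (g u).
have gv : g v = false by move: guv; rewrite gu; case: (g v).
have rE' : in_range n (E `\ c) by move=> d; rewrite !inE => /andP[_ /rE].
have un' : u < n.+1 by []. have vn' : v < n.+1 by [].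
pose h w := connect (@ord_adj n (E `\ c)) (inord v) (inord w).
have hE : preserved (E `\ c) h by exact: connect_preserved.
have hv : h v by rewrite /h connect0.
(* Either [h] or its sum with the dual colouring [g] agrees at [u] and [v], hence is constant along
   all of [E]; connectedness then compares the values at [v] and 0. *)
have h0 : h 0.
  have ext (f : nat -> bool) : preserved (E `\ c) f -> f u = f v -> preserved E f.
    move=> fE fuv d dE'; case: (eqVneq d c) => [->|dc]; last by apply: fE; rewrite !inE dc.
    by rewrite /c /chord /=; case: (leqP u v).
  case hu : (h u).
    have hE' : preserved E h by apply: ext => //; rewrite hu hv.
    by rewrite -(diagram_connected dE hE' vn).
  have hgE : preserved E (fun w => h w (+) g w).
    by apply: ext => [d dE'|]; rewrite ?hE ?gE //= hu hv gu gv.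
  by have := diagram_connected dE hgE vn; rewrite /= hv gv g0 !addbF => <-.
case/connectP: h0 => p0 /shortenP[s ps us _] s0 {p0}.
have v0 : (inord v : 'I_n.+1) = v :> nat by rewrite inordK.
have pE : path (adj (E `\ c)) v [seq val i | i <- s].
  by rewrite -[v in path _ v]v0 path_map.
have gs := preserved_path gE pE.
have un2 : uniq [:: u, v & [seq val i | i <- s]].
  rewrite cons_uniq; apply/andP; split.
    by apply/negP => /gs; rewrite gu gv.
  by rewrite -[v in v :: _]v0 -map_cons map_inj_uniq //; exact: val_inj.
have ls : size s < n.+1.
  have := card_uniqP us; have := max_card [in (inord v : 'I_n.+1) :: s].
  by rewrite card_ord /= => + eq; rewrite eq.
exists (Ordinal ls); apply/existsP; exists (in_tuple s); rewrite /= in un2 *.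
rewrite un2 /= /adj uv uvE /=; apply/andP; split.
  by apply: sub_path pE => i j; rewrite adjD1 => /andP[].
by rewrite -[v in last v _]v0 last_map -s0 inordK.
Qed.

(** * Contraction of sides *)

Definition cuts S c := has (fun s => side_in c s != side_in c (head 0 S)) S.

Lemma cutsP S c :
  reflect (exists i j, [/\ i \in S, j \in S & side_in c i != side_in c j]) (cuts S c).
Proof.
apply: (iffP hasP) => [[s sS cs]|[i [j [iS jS cij]]]].
  by exists s, (head 0 S); split=> //; case: (S) sS => //= *; rewrite mem_head.
case: (eqVneq (side_in c i) (side_in c (head 0 S))) => ci; last by exists i.
by exists j; rewrite // -ci eq_sym.
Qed.

Lemma cutsPn S c :
  reflect {in S &, forall i j, side_in c i = side_in c j} (~~ cuts S c).
Proof.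
apply: (iffP idP) => [/cutsP H i j iS jS|H].
  by apply/eqP; apply: contra_notT H => cij; exists i, j.
by apply/cutsP => -[i [j [iS jS]]]; rewrite (H i j iS jS) eqxx.
Qed.

Definition image_chord S c := chord (contract S c.1) (contract S c.2).

(** Chords that separate no two sides of [S] would become loops and are dropped. With [S] a face
    this is a factor of [q_C(D)], with [S] the minimal sides it is [r_C(D)]. *)
Definition restrict S C := [fset image_chord S c | c in C & cuts S c].

Lemma count_none (P : pred nat) S : {in S, forall i, ~~ P i} -> count P S = 0.
Proof. by move/hasPn; rewrite has_count -eqn0Ngt => /eqP. Qed.

Lemma count_ltn_nth S k v : sorted ltn S -> k < size S ->
  (nth 0 S k < v) = (k < count (fun s => s < v) S).
Proof.
elim: S k => // s S IHS k /= sS ltk; have sS' := path_sorted sS.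
have := order_path_min ltn_trans sS => /allP leS.
case: k ltk => [_|k ltk] /=.
  case: (ltnP s v) => // les; rewrite (_ : count _ _ = 0) //.
  by apply: count_none => i /leS /=; lia.
rewrite IHS //; case: (ltnP s v) => [_|les]; first by rewrite add1n.
 rewrite (_ : count _ _ = 0) //.
by apply: count_none => i /leS /=; lia.
Qed.

Lemma contract_lt S v : S != [::] -> contract S v < size S.
Proof. by case: S => // s S _; apply: ltn_pmod. Qed.

Lemma contractE S v : contract S v =
  if count (fun s => s < v) S == size S then 0 else count (fun s => s < v) S.
Proof.
rewrite /contract; case: eqP => [->|ne]; first exact: modnn.
by rewrite modn_small // ltn_neqAle count_size andbT; apply/eqP.
Qed.

(** The correction by the last side is a normalisation: the arc from the smaller to the larger end
    of a chord never contains the last side. If the last side of [S] is on the arc of [c], the upper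
    end wraps round to 0 and the image describes the complementary arc. *)
Lemma side_in_image S c k : sorted ltn S -> k < size S -> c.1 <= c.2 ->
  side_in (image_chord S c) k =
  side_in c (nth 0 S k) (+) side_in c (last 0 S).
Proof.
move=> sS ltk lec; rewrite /side_in /image_chord !contractE -nth_last.
have := count_size (fun s => s < c.2) S.
have : count (fun s => s < c.1) S <= count (fun s => s < c.2) S.
  by apply: sub_count => i /=; lia.
have E v j : j < size S -> (nth 0 S j < v) = (j < count (fun s => s < v) S).
  exact: count_ltn_nth.
rewrite !(leqNgt c.1) !E; [|lia..]; rewrite /chord /=.
move: (count _ _) (count _ _) => a b.
by case: (a =P _); case: (b =P _); lia.
Qed.

Lemma image_chord_loop S c : sorted ltn S -> c.1 <= c.2 ->
  ((image_chord S c).1 < (image_chord S c).2) = cuts S c.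
Proof.
move=> sS lec; case: (eqVneq S [::]) => [->|S0].
  by rewrite /image_chord /contract /= !modn0 ltnn.
apply/idP/idP => [lt|].
  have lt1 : (image_chord S c).1 < size S.
    have := contract_lt c.1 S0; have := contract_lt c.2 S0.
    by rewrite /image_chord /chord /=; lia.
  have := side_in_image sS lt1 lec; rewrite {1}/side_in leqnn lt /=.
  move/esym => H; apply/cutsP; exists (nth 0 S (image_chord S c).1), (last 0 S).
  split; [exact: mem_nth|by case: (S) S0 => // *; exact: mem_last|].
  by move: H; do 2 case: side_in.
have lastS : last 0 S = nth 0 S (size S).-1 by rewrite nth_last.
case/cutsP=> i [j [iS jS]].
have [si sj] : index i S < size S /\ index j S < size S by rewrite !index_mem.
have := side_in_image sS si lec; have := side_in_image sS sj lec.
rewrite !nth_index // /side_in; lia.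
Qed.

Lemma mem_restrict S C d :
  reflect (exists2 c, c \in C & cuts S c /\ d = image_chord S c) (d \in restrict S C).
Proof.
apply: (iffP idP) => [/imfsetP[c /=]|[c cC [cS ->]]].
  by rewrite inE /= => /andP[cC cS] ->; exists c.
by apply/imfsetP; exists c => //=; rewrite inE /= cC.
Qed.

Lemma image_in_restrict S C c : c \in C -> cuts S c -> image_chord S c \in restrict S C.
Proof. by move=> cC cS; apply/mem_restrict; exists c. Qed.

Lemma restrict_in_range n S C : sorted ltn S -> in_range n C ->
  in_range (size S).-1 (restrict S C).
Proof.
move=> sS rC d /mem_restrict[c cC [cS ->]]; have /andP[/ltnW lec _] := rC c cC.
have S0 : S != [::] by apply: contraTneq cS => ->.
rewrite image_chord_loop // cS /=.
have := contract_lt c.1 S0; have := contract_lt c.2 S0.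
by rewrite /image_chord /chord /=; lia.
Qed.

Lemma in_range_le n C c : in_range n C -> c \in C -> c.1 <= c.2.
Proof. by move=> rC /rC/andP[/ltnW]. Qed.

Lemma same_face_restrict n S C k l : sorted ltn S -> in_range n C ->
  k < size S -> l < size S ->
  same_face (restrict S C) k l = same_face C (nth 0 S k) (nth 0 S l).
Proof.
move=> sS rC kS lS; apply/same_faceP/same_faceP => H c cC; last first.
  case/mem_restrict: cC => d dC [_ ->].
  by rewrite !side_in_image ?(in_range_le rC dC) // (H d dC).
case: (boolP (cuts S c)) => [cS|/cutsPn]; last by apply; apply: mem_nth.
have := H _ (image_in_restrict cC cS).
by rewrite !side_in_image ?(in_range_le rC cC) // => /addIb.
Qed.

(** With [quadrants_crossing], this describes crossings by four nonempty quadrants, a condition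
    insensitive to the complementation in [side_in_image]. *)
Lemma crossing_quadrants n c d : c.1 < c.2 <= n -> d.1 < d.2 <= n -> crossing c d ->
  forall a b, exists2 i, i <= n & side_in c i = a /\ side_in d i = b.
Proof.
rewrite /crossing /side_in => rc rd xcd [] [].
- by exists (maxn c.1 d.1); lia.
- by exists (if c.1 < d.1 then c.1 else d.2); case: ifP; lia.
- by exists (if c.1 < d.1 then c.2 else d.1); case: ifP; lia.
- by exists n; lia.
Qed.

Lemma quadrants_crossing c d :
  (forall a b, exists i, side_in c i = a /\ side_in d i = b) -> crossing c d.
Proof.
move=> H; have [i [ci di]] := H true true; have [j [cj dj]] := H true false.
have [k [ck dk]] := H false true; have [l [cl dl]] := H false false.
by apply: (@crossing_sides c d i j k l); rewrite ?ci ?di ?cj ?dj ?ck ?dk ?cl ?dl.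
Qed.

Lemma restrict_planar n S C : sorted ltn S -> planar n C ->
  planar (size S).-1 (restrict S C).
Proof.
move=> sS [rC xC]; have rR := restrict_in_range sS rC; split=> // d e dR eR.
have [rd re] := (rR d dR, rR e eR).
case/mem_restrict: dR rd => c cC [cS ->] rc; case/mem_restrict: eR re => c' cC' [cS' ->] rc'.
apply: contra (xC c c' cC cC') => x; apply: quadrants_crossing => a b.
have [k lek] := crossing_quadrants rc rc' x (a (+) side_in c (last 0 S))
                                            (b (+) side_in c' (last 0 S)).
have ltk : k < size S by move: cS lek; case: (S) => // *.
rewrite !side_in_image ?(in_range_le rC cC) ?(in_range_le rC cC') // => -[/addIb ca /addIb cb].
by exists (nth 0 S k).
Qed.

Lemma restrict_separating n S C : sorted ltn S -> in_range n C -> S != [::] ->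
  {in S &, forall i j, same_face C i j -> i = j} ->
  separating (size S).-1 (restrict S C).
Proof.
move=> sS rC S0 sepS k l lek lel.
have [ltk ltl] : k < size S /\ l < size S by case: (S) S0 lek lel.
rewrite (same_face_restrict sS rC) // => /sepS H.
apply/eqP; rewrite -(nth_uniq 0 ltk ltl); first by rewrite H ?mem_nth.
exact: (sorted_uniq ltn_trans ltnn).
Qed.

(** The delicate case is a vertex past all of [S], which the first contraction wraps to 0: all sides
    selected by [T] precede it, so the composite wraps it too. *)
Lemma contract_comp S T v : sorted ltn S -> {in T, forall k, k < size S} ->
  contract T (contract S v) = contract [seq nth 0 S k | k <- T] v.
Proof.
move=> sS TS; rewrite -[LHS]/(count (fun k => k < contract S v) T %% size T).
rewrite [RHS]/contract size_map count_map.
have E : count (preim (nth 0 S) (fun s => s < v)) T =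
    count (fun k => k < count (fun s => s < v) S) T.
  by apply: eq_in_count => k /TS kS /=; exact: count_ltn_nth.
rewrite E contractE; case: eqP => // ->.
rewrite (_ : count (fun k => k < 0) T = 0); last by elim: (T).
rewrite (_ : count _ T = size T); first by rewrite modnn mod0n.
by apply/eqP; rewrite -all_count; apply/allP => k /TS.
Qed.

Lemma image_chord_comp S T c : sorted ltn S -> {in T, forall k, k < size S} ->
  image_chord T (image_chord S c) = image_chord [seq nth 0 S k | k <- T] c.
Proof.
move=> sS TS; rewrite [in RHS]/image_chord -!contract_comp // /image_chord /chord /=.
by case: (leqP (contract S c.1)) => // _; rewrite minnC maxnC.
Qed.

Lemma sorted_sub_nth S T : sorted ltn S -> sorted ltn T ->
  {in T, forall k, k < size S} -> sorted ltn [seq nth 0 S k | k <- T].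
Proof.
move=> sS sT TS; apply: (homo_sorted_in (P := mem T)) sT; last exact/allP.
move=> k l /TS kS /TS lS kl; exact: (sorted_ltn_nth ltn_trans 0 sS).
Qed.

Lemma cuts_image S T c : sorted ltn S -> sorted ltn T ->
  {in T, forall k, k < size S} -> c.1 <= c.2 ->
  cuts T (image_chord S c) = cuts [seq nth 0 S k | k <- T] c.
Proof.
move=> sS sT TS lec.
rewrite -image_chord_loop //; last by rewrite /image_chord /chord /=; lia.
by rewrite image_chord_comp // image_chord_loop // sorted_sub_nth.
Qed.

Lemma cuts_sub S T c : {subset T <= S} -> cuts T c -> cuts S c.
Proof.
by move=> TS /cutsP[i [j [iT jT cij]]]; apply/cutsP; exists i, j; split=> //; apply: TS.
Qed.

Lemma restrict_comp n S T C : sorted ltn S -> sorted ltn T ->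
  {in T, forall k, k < size S} -> in_range n C ->
  restrict T (restrict S C) = restrict [seq nth 0 S k | k <- T] C.
Proof.
move=> sS sT TS rC; apply/fsetP => d; apply/mem_restrict/mem_restrict.
  move=> [_ /mem_restrict[c cC [cS ->]] []].
  rewrite cuts_image ?(in_range_le rC cC) // image_chord_comp // => cT ->.
  by exists c.
move=> [c cC [cT ->]]; exists (image_chord S c); last first.
  by rewrite cuts_image ?(in_range_le rC cC) // image_chord_comp.
apply: image_in_restrict => //; apply: cuts_sub cT => i /mapP[k kT ->].
by apply: mem_nth; exact: TS.
Qed.

(** * Faces and quotients of a diagram *)

Definition min_side C i := find (same_face C i) (iota 0 i.+1).

Lemma min_sideP C i :
  [/\ min_side C i <= i, same_face C i (min_side C i)
    & forall j, same_face C i j -> min_side C i <= j].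
Proof.
have hasi : has (same_face C i) (iota 0 i.+1).
  by apply/hasP; exists i; rewrite ?same_face_refl // mem_iota; lia.
have lt : min_side C i < i.+1 by rewrite -(size_iota 0 i.+1) -has_find.
have ij : same_face C i (min_side C i).
  by have := nth_find 0 hasi; rewrite -/(min_side C i) nth_iota.
split=> // j ijj; rewrite leqNgt; apply/negP => ltj.
by have := before_find 0 ltj; rewrite nth_iota ?ijj //; lia.
Qed.

Lemma min_side_le C i : min_side C i <= i. Proof. by case: (min_sideP C i). Qed.

Lemma min_side_face C i : same_face C i (min_side C i).
Proof. by case: (min_sideP C i). Qed.

Lemma min_side_min C i j : same_face C i j -> min_side C i <= j.
Proof. by case: (min_sideP C i) => _ _; apply. Qed.

Lemma is_min_min_side C i : is_min C (min_side C i).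
Proof.
apply/is_minP => j lt; apply/negP => H; have := same_face_trans (min_side_face C i) H.
by move/min_side_min; lia.
Qed.

Lemma min_side_in n C i : i <= n -> min_side C i \in min_sides n C.
Proof. by move=> ilen; rewrite mem_min_sides is_min_min_side (leq_trans (min_side_le C i)). Qed.

Lemma min_side_id n C i : i \in min_sides n C -> min_side C i = i.
Proof.
rewrite mem_min_sides => /andP[_ /is_minP H]; have := min_side_le C i.
rewrite leq_eqVlt => /predU1P[] // /H; by rewrite min_side_face.
Qed.

Lemma eq_min_side C i j : same_face C i j -> min_side C i = min_side C j.
Proof.
move=> ij; apply/eqP; rewrite eqn_leq !min_side_min ?min_side_face //.
  by rewrite (same_face_trans _ (min_side_face C i)) // same_face_sym.
exact: same_face_trans (min_side_face C j).
Qed.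

Lemma min_sides_same_face n C i j :
  i \in min_sides n C -> j \in min_sides n C -> same_face C i j -> i = j.
Proof.
by move=> /min_side_id iM /min_side_id jM /eq_min_side; rewrite iM jM.
Qed.

Lemma mem_face_sides n C i j : (j \in face_sides n C i) = (j <= n) && same_face C i j.
Proof. by rewrite mem_filter mem_iota andbC. Qed.

Lemma sorted_face_sides n C i : sorted ltn (face_sides n C i).
Proof. exact/sorted_filter/iota_ltn_sorted/ltn_trans. Qed.

Lemma face_sides_neq0 n C i : i <= n -> face_sides n C i != [::].
Proof.
move=> ilen; have : i \in face_sides n C i by rewrite mem_face_sides ilen same_face_refl.
by apply: contraTneq => ->.
Qed.

Definition cutting S C := [fset c in C | cuts S c].

Lemma mem_cutting S C c : (c \in cutting S C) = (c \in C) && cuts S c.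
Proof. by rewrite !inE. Qed.

Lemma restrictE S C : restrict S C = image_chord S @` cutting S C.
Proof.
apply/fsetP => d; apply/mem_restrict/imfsetP => [[c cC [cS ->]]|[c]].
  by exists c => //=; rewrite mem_cutting cC.
by rewrite /= mem_cutting => /andP[cC cS] ->; exists c.
Qed.

Lemma cuts_face_notin n C i c : c \in C -> ~~ cuts (face_sides n C i) c.
Proof.
move=> cC; apply/cutsPn => j k; rewrite !mem_face_sides.
move=> /andP[_ /same_faceP ij] /andP[_ /same_faceP ik].
by rewrite -ij ?ik.
Qed.

(** A chord cutting the face separates no two sides of another face of [C]. Hence the chords of [D]
    not cutting it already make every side outside it minimal, so they number at least
    [n + 1 - size S] of the [n] chords. *)
Lemma size_face_sides n D C i : diagram n D -> C `<=` D -> i <= n ->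
  #|` cutting (face_sides n C i) D| < size (face_sides n C i).
Proof.
move=> dD CD ilen; set S := face_sides n C i; have [pD sD cD] := dD.
pose C' := [fset c in D | ~~ cuts S c].
have C'D : C' `<=` D by apply/fsubsetP => c; rewrite !inE => /andP[].
have CC' : C `<=` C'.
  by apply/fsubsetP => c cC; rewrite !inE (fsubsetP CD) //= (cuts_face_notin n i).
have cardE : #|` cutting S D| + #|` C'| = n.
  rewrite -cD -(cardfsID (cutting S D) D).
  have -> : D `&` cutting S D = cutting S D.
    by apply/fsetP => c; rewrite !inE; case: (c \in D).
  have -> : D `\` cutting S D = C' => //.
  by apply/fsetP => c; rewrite !inE; case: (c \in D); rewrite ?andbF ?andbT.
have szM := size_min_sides dD C'D.
suff : (n.+1 - size S).+1 <= size (min_sides n C').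
  have : size S <= n.+1 by rewrite size_filter -[X in _ <= X](size_iota 0) count_size.
  by rewrite szM; lia.
have -> : (n.+1 - size S).+1 = size (min_side C i :: [seq j <- iota 0 n.+1 | ~~ same_face C i j]).
  have e : count (fun j => same_face C i j) (iota 0 n.+1) +
      count (fun j => ~~ same_face C i j) (iota 0 n.+1) = n.+1.
    exact: etrans (count_predC _ _) (size_iota _ _).
  rewrite -[RHS]/((size [seq j <- iota 0 n.+1 | ~~ same_face C i j]).+1).
  by rewrite /S /face_sides !size_filter; lia.
apply: uniq_leq_size.
  by rewrite cons_uniq mem_filter min_side_face filter_uniq // iota_uniq.
have cutC' c : c \in D -> cuts S c = false -> c \in C'.
  by move=> cD' cS; rewrite !inE cD' cS.
move=> j; rewrite inE => /predU1P[->|].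
  rewrite mem_min_sides (leq_trans (min_side_le C i)) //=.
  apply/is_minP => k; have /is_minP H := is_min_min_side C i.
  by move/H; apply: contra; exact: same_face_sub.
rewrite mem_filter mem_iota mem_min_sides => /andP[ij /andP[_ jn]]; rewrite -ltnS jn /=.
apply/is_minP => k kj; apply/negP => jk.
have jkC := same_face_sub CC' jk.
suff : j = k by lia.
apply: sD; [lia..|]; apply/same_faceP => c cD'.
case cS: (cuts S c); last by have /same_faceP := jk; apply; exact: cutC'.
apply/eqP; apply: contraNT ij => cjk.
case/cutsP: cS => i1 [i2 [+ + ci]]; rewrite !mem_face_sides => /andP[_ f1] /andP[_ f2].
have xc : {in C, forall d, ~~ crossing d c}.
  by move=> d dC; case: pD => _ xD; apply: xD => //; apply: (fsubsetP CD).
apply: (same_face_trans f1); apply: (cut_same_face xc _ jkC ci cjk).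
by rewrite (same_face_trans _ f2) // same_face_sym.
Qed.

(** A squeeze: separating [size S] sides takes at least [size S - 1] chords, and the restriction is
    an image of the cutting chords, of which there are no more. The equality of the two cardinals is
    what makes [image_chord] injective on the latter. *)
Lemma face_card n D C i : diagram n D -> C `<=` D -> i <= n ->
  #|` restrict (face_sides n C i) D| = (size (face_sides n C i)).-1 /\
  #|` cutting (face_sides n C i) D| = (size (face_sides n C i)).-1.
Proof.
move=> dD CD ilen; set S := face_sides n C i; have [pD sD cD] := dD.
have S0 : S != [::] by exact: face_sides_neq0.
have sS : sorted ltn S by exact: sorted_face_sides.
have le1 : #|` restrict S D| <= #|` cutting S D| by rewrite restrictE leq_imfset_card.
have lt2 : #|` cutting S D| < size S by exact: size_face_sides.
have le3 : (size S).-1 <= #|` restrict S D|.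
  apply: separating_card; first exact: (restrict_planar sS pD).
  apply: (@restrict_separating n) => //; first by case: pD.
  by move=> j k; rewrite !mem_face_sides => /andP[jn _] /andP[kn _]; apply: sD.
by lia.
Qed.

Lemma restrict_face n D C i : diagram n D -> C `<=` D -> i <= n ->
  diagram (size (face_sides n C i)).-1 (restrict (face_sides n C i) D).
Proof.
move=> dD CD ilen; have [cR _] := face_card dD CD ilen; have [pD sD cD] := dD.
have sS := sorted_face_sides n C i.
split=> //; first exact: (restrict_planar sS pD).
apply: (@restrict_separating n) => //; [by case: pD|exact: face_sides_neq0|].
by move=> j k; rewrite !mem_face_sides => /andP[jn _] /andP[kn _]; apply: sD.
Qed.

Lemma image_face_inj n D C i : diagram n D -> C `<=` D -> i <= n ->
  {in cutting (face_sides n C i) D &, injective (image_chord (face_sides n C i))}.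
Proof.
move=> dD CD ilen; apply/card_in_imfsetP; rewrite -restrictE.
by have [-> ->] := face_card dD CD ilen.
Qed.

Lemma cuts_min_sides n C c : in_range n C -> c \in C -> cuts (min_sides n C) c.
Proof.
move=> rC cC; have /andP[lt le] := rC c cC; apply/cutsP.
exists (min_side C c.1), (min_side C n); split; [apply: min_side_in; lia|exact: min_side_in|].
have /same_faceP/(_ c cC) <- := min_side_face C c.1.
have /same_faceP/(_ c cC) <- := min_side_face C n.
by rewrite /side_in; lia.
Qed.

Lemma cutting_min_sides n C : in_range n C -> cutting (min_sides n C) C = C.
Proof.
move=> rC; apply/fsetP => c; rewrite mem_cutting.
by case cC: (c \in C) => //=; exact: cuts_min_sides.
Qed.

(** The squeeze of [face_card] again: the restriction separates one side more than [C] has chords,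
    and it is an image of [C]. *)
Lemma restrict_min_sides n D C : diagram n D -> C `<=` D ->
  diagram #|` C| (restrict (min_sides n C) C).
Proof.
move=> dD CD; have [pD _ _] := dD; have pC := planar_sub CD pD; have [rC _] := pC.
have szM := size_min_sides dD CD; have sM := sorted_min_sides n C.
have M0 : min_sides n C != [::] by case: (min_sides n C) szM.
have mE : (size (min_sides n C)).-1 = #|` C| by rewrite szM.
have pR := restrict_planar sM pC; rewrite mE in pR.
have sR : separating #|` C| (restrict (min_sides n C) C).
  rewrite -mE; apply: (@restrict_separating n) => //.
  by move=> i j; exact: min_sides_same_face.
split=> //; apply/eqP; rewrite eqn_leq (separating_card pR sR) andbT.
by rewrite restrictE cutting_min_sides // leq_imfset_card.
Qed.

Lemma image_min_sides_inj n D C : diagram n D -> C `<=` D ->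
  {in C &, injective (image_chord (min_sides n C))}.
Proof.
move=> dD CD; have [pD _ _] := dD; have [rC _] := planar_sub CD pD.
apply/card_in_imfsetP.
have <- : restrict (min_sides n C) C = image_chord (min_sides n C) @` C.
  by rewrite restrictE cutting_min_sides.
by have [_ _ ->] := restrict_min_sides dD CD.
Qed.

Lemma rpartE n D C : diagram n D -> C `<=` D ->
  rpart D C = restrict (min_sides n C) C.
Proof.
move=> dD CD; have [pD _ cD] := dD; have [rC _] := planar_sub CD pD.
by rewrite /rpart /deg cD restrictE cutting_min_sides.
Qed.

Lemma qfaceE n D C i : diagram n D -> C `<=` D -> i <= n ->
  qface D C i = restrict (face_sides n C i) D.
Proof.
move=> dD CD ilen; have [[rD xD] _ cD] := dD.
rewrite /qface /deg cD restrictE.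
suff -> : chords_in_face D C i = cutting (face_sides n C i) D by [].
apply/fsetP => c.
rewrite mem_cutting !inE; case cD': (c \in D) => //=.
apply/and3P/idP => [[cC v1 v2]|cS]; last first.
  split; first by apply: contraL cS; exact: cuts_face_notin.
    apply/allP => d dC; have dD' := fsubsetP CD d dC.
    have := xD d c dD' cD'; have := rD d dD'; have := rD c cD'.
    case/cutsP: cS => j [k []]; rewrite !mem_face_sides.
    move=> /andP[_ /same_faceP/(_ d dC)] + /andP[_ /same_faceP/(_ d dC)].
    by rewrite /crossing /side_in; case: ifP; lia.
  apply/allP => d dC; have dD' := fsubsetP CD d dC.
  have := xD d c dD' cD'; have := rD d dD'; have := rD c cD'.
  case/cutsP: cS => j [k []]; rewrite !mem_face_sides.
  move=> /andP[_ /same_faceP/(_ d dC)] + /andP[_ /same_faceP/(_ d dC)].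
  by rewrite /crossing /side_in; case: ifP; lia.
(* The dual sides [p], [q] of a chord outside [C] share a face of [C]. If some [d] in [C] put that
   face across from [i], the ends of [c], being on the side of [i], would not let [c] separate [p]
   from [q]. *)
have [p [q dpq]] := dual_exists dD cD'; have [pn qn cpq /same_faceP f] := dpq.
have pq : same_face C p q.
  apply/same_faceP => d dC; apply: f; rewrite !inE (fsubsetP CD) // andbT.
  by apply: contraNneq cC => <-.
case ip : (same_face C i p).
  apply/cutsP; exists p, q; rewrite !mem_face_sides pn qn ip; split=> //.
  exact: same_face_trans pq.
case/negP: (negbT ip); apply/same_faceP => d dC; apply/eqP; apply: contraNT cpq => dip.
have := allP v1 d dC; have := allP v2 d dC; move/same_faceP: pq => /(_ d dC).
have := rD d (fsubsetP CD d dC); have := rD c cD'; move: dip.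
by rewrite /side_in; case: ifP; lia.
Qed.

Lemma dual_restrict n S D c k l : sorted ltn S -> in_range n D -> c \in D ->
  k < size S -> l < size S -> dual n D c (nth 0 S k) (nth 0 S l) ->
  dual (size S).-1 (restrict S D) (image_chord S c) k l.
Proof.
move=> sS rD cD kS lS dc; have [_ _ ckl _] := dc; split; [lia|lia| |].
  by rewrite !side_in_image ?(in_range_le rD cD) // (inj_eq (@addIb _)).
apply/same_faceP => d'; rewrite !inE => /andP[neq /mem_restrict[d dD [_ d'E]]].
have dc' : d != c by apply: contraNneq neq => <-; rewrite d'E.
by rewrite d'E !side_in_image ?(in_range_le rD dD) // (dual_other dc dD dc').
Qed.

Lemma dual_sub n C D c p q : C `<=` D -> dual n D c p q -> dual n C c p q.
Proof.
move=> CD [pn qn cpq f]; split=> //; apply: same_face_sub f.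
exact: fsetSD.
Qed.

Lemma dual_min_side n C D c p q : C `<=` D -> c \in C -> dual n D c p q ->
  dual n C c (min_side C p) (min_side C q).
Proof.
move=> CD cC /(dual_sub CD)[pn qn cpq f].
have sub i : same_face (C `\ c) i (min_side C i).
  exact: same_face_sub (fsubD1set _ _) (min_side_face C i).
split; try by rewrite (leq_trans (min_side_le _ _)).
  have /same_faceP/(_ c cC) <- := min_side_face C p.
  by have /same_faceP/(_ c cC) <- := min_side_face C q.
apply: same_face_trans (sub q); apply: same_face_trans f.
by rewrite same_face_sym.
Qed.

Lemma dual_colour_contract S k l v : sorted ltn S -> k < size S -> l < size S ->
  dual_colour k l (contract S v) = dual_colour (nth 0 S k) (nth 0 S l) v.
Proof.
move=> sS kS lS; rewrite /dual_colour contractE.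
have := count_ltn_nth v sS kS; have := count_ltn_nth v sS lS.
have : k <= l -> nth 0 S k <= nth 0 S l.
  by move=> kl; have := sorted_leq_nth leq_trans leqnn 0 (sub_sorted ltnW sS) k l kS lS kl.
have : l <= k -> nth 0 S l <= nth 0 S k.
  by move=> kl; have := sorted_leq_nth leq_trans leqnn 0 (sub_sorted ltnW sS) l k lS kS kl.
have := count_size (fun s => s < v) S.
by case: eqP; lia.
Qed.

(** * Exponents *)

Definition flipped D C c :=
  let f := contract (min_sides (deg D) C) in
  towards D c.1 c.2 != towards (rpart D C) (f c.1) (f c.2).

Lemma kexpE D C : kexp D C = \sum_(c <- C) flipped D C c.
Proof.
rewrite /kexp card_fset_sum1 -big_fset_condE big_mkcond /=.
by apply: eq_bigr => c _; rewrite /flipped; case: (_ != _).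
Qed.

Lemma chord_sort u w : u <= w -> chord u w = (u, w).
Proof. by move=> uw; rewrite /chord (minn_idPl uw) (maxn_idPr uw). Qed.

Lemma chord_span j n : chord j (j + n + 1) = (j, j + n + 1).
Proof. by rewrite chord_sort //; lia. Qed.

Lemma chord_id c : c.1 <= c.2 -> chord c.1 c.2 = c.
Proof. by case: c => a b /= ab; rewrite /chord (minn_idPl ab) (maxn_idPr ab). Qed.

(** Both orientations are tested at [c.1] with [towardsE]. The minimal sides of the faces of [p] and
    [q] are dual to [c] in [C], and for a pair of sides separated by [c] the colour of [c.1] depends
    only on their order. *)
Lemma flippedE n D C c p q : diagram n D -> C `<=` D -> c \in C ->
  dual n D c p q ->
  flipped D C c = ((p < q) != (min_side C p < min_side C q)).
Proof.
move=> dD CD cC dpq; have cD := fsubsetP CD c cC; have [[rD _] _ nD] := dD.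
have rC : in_range n C by move=> d /(fsubsetP CD)/rD.
have /andP[ltc lec] := rD c cD; have [pn qn cpq _] := dpq.
have -> : flipped D C c = (dual_colour p q c.1 !=
            dual_colour (min_side C p) (min_side C q) c.1).
  rewrite /flipped /deg nD (rpartE dD CD); congr (_ != _).
    by apply: (towardsE dD); rewrite ?chord_id //; lia.
  set M := min_sides n C.
  have sM : sorted ltn M by exact: sorted_min_sides.
  have szM : (size M).-1 = #|` C| by rewrite (size_min_sides dD CD).
  have M0 : M != [::] by rewrite -size_eq0 (size_min_sides dD CD).
  have [iM jM] : min_side C p \in M /\ min_side C q \in M by rewrite !min_side_in.
  have [kM lM] : index (min_side C p) M < size M /\ index (min_side C q) M < size M.
    by rewrite !index_mem.
  rewrite -(nth_index 0 iM) -(nth_index 0 jM) -dual_colour_contract //.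
  apply: (towardsE (restrict_min_sides dD CD)); rewrite -?szM.
  - by have := contract_lt c.1 M0; lia.
  - by have := contract_lt c.2 M0; lia.
  - exact: image_in_restrict (cuts_min_sides rC cC).
  - apply: (dual_restrict sM rC cC) => //; rewrite !nth_index //.
    exact: dual_min_side dpq.
have /same_faceP/(_ c cC) := min_side_face C p.
have /same_faceP/(_ c cC) := min_side_face C q.
have := min_side_le C p; have := min_side_le C q.
by move: cpq; rewrite /side_in /dual_colour; lia.
Qed.

Lemma min_side1 c p : (min_side [fset c] p == 0) = (side_in c p == side_in c 0).
Proof.
have E i : same_face [fset c] p i = (side_in c p == side_in c i).
  by apply/same_faceP/eqP => [H|eqc d]; [apply: H; rewrite inE | rewrite inE => /eqP->].
apply/idP/idP => [/eqP m0|]; first by have := min_side_face [fset c] p; rewrite m0 E.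
by rewrite -E => /min_side_min; rewrite leqn0.
Qed.

(** For a single chord the minimal side is 0 in the half of side 0 and positive in the other, so the
    order after contraction only depends on which of [p], [q] is in the half of side 0. *)
Lemma flipped1 n D c p q : diagram n D -> c \in D -> dual n D c p q ->
  flipped D [fset c] c = ((p < q) != (side_in c p == side_in c 0)).
Proof.
move=> dD cD dpq; rewrite (flippedE dD _ _ dpq) ?fsub1set ?fset11 //; congr (_ != _).
have [_ _ cpq _] := dpq.
have := min_side1 c p; have := min_side1 c q.
by case: (min_side _ p) => [|x]; case: (min_side _ q) => [|y];
   move: cpq; do 3 case: side_in.
Qed.

Lemma kexp1 n D c p q : diagram n D -> c \in D -> dual n D c p q ->
  kexp D [fset c] = ((p < q) != (side_in c p == side_in c 0)).
Proof. by move=> dD cD dpq; rewrite kexpE big_seq_fset1 (flipped1 dD cD dpq). Qed.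

(* The flips of c from D to r_C(D) and from r_C(D) to r_c(D) never cancel. *)
Lemma flip_split n D C c p q : diagram n D -> C `<=` D -> c \in C ->
  dual n D c p q ->
  ((p < q) != (min_side C p < min_side C q)) +
    ((min_side C p < min_side C q) != (side_in c p == side_in c 0)) =
  ((p < q) != (side_in c p == side_in c 0)) :> nat.
Proof.
move=> dD CD cC dpq; have [pn qn cpq _] := dpq.
have /same_faceP/(_ c cC) := min_side_face C p.
have /same_faceP/(_ c cC) := min_side_face C q.
have := min_side_le C p; have := min_side_le C q.
by move: cpq; rewrite /side_in; lia.
Qed.

Lemma min_side_restrict n S C k : sorted ltn S -> in_range n C -> k < size S ->
  min_side C (nth 0 S k) \in S ->
  nth 0 S (min_side (restrict S C) k) = min_side C (nth 0 S k).
Proof.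
move=> sS rC kS mS; set m := min_side C _ in mS *.
have mSi : index m S < size S by rewrite index_mem.
have lek := min_side_le (restrict S C) k.
suff -> : min_side (restrict S C) k = index m S by rewrite nth_index.
have ltS : min_side (restrict S C) k < size S by lia.
apply/eqP; rewrite eqn_leq; apply/andP; split.
  apply: min_side_min; rewrite (same_face_restrict sS rC) // nth_index //.
  exact: min_side_face.
have := min_side_face (restrict S C) k.
rewrite (same_face_restrict sS rC) // => /min_side_min; rewrite -/m -{1}(nth_index 0 mS).
rewrite leqNgt [index _ _ <= _]leqNgt; apply: contra.
exact: (sorted_ltn_nth ltn_trans 0 sS).
Qed.

Lemma eq_sorted_ltn (s t : seq nat) : sorted ltn s -> sorted ltn t -> s =i t -> s = t.
Proof. exact: (irr_sorted_eq ltn_trans ltnn). Qed.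

(** * Cutting a diagram along a chord *)

Definition half_plane n c b := [seq i <- iota 0 n.+1 | side_in c i == b].

Lemma mem_half_plane n c b i : (i \in half_plane n c b) = (i <= n) && (side_in c i == b).
Proof. by rewrite mem_filter mem_iota andbC. Qed.

Lemma sorted_half_plane n c b : sorted ltn (half_plane n c b).
Proof. exact/sorted_filter/iota_ltn_sorted/ltn_trans. Qed.

Lemma half_plane_face n c i : face_sides n [fset c] i = half_plane n c (side_in c i).
Proof.
apply: (eq_sorted_ltn (sorted_face_sides _ _ _) (sorted_half_plane _ _ _)).
move=> j; rewrite mem_face_sides mem_half_plane; congr (_ && _).
by apply/same_faceP/eqP => [-> //|cj d]; rewrite inE // => /eqP->.
Qed.

Lemma half_plane_faceE n c b : c.1 < c.2 <= n ->
  exists2 i, i <= n & half_plane n c b = face_sides n [fset c] i.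
Proof.
move=> rc; exists (if b then c.1 else n); first by case: b; lia.
by rewrite half_plane_face; congr half_plane; rewrite /side_in; case: b; lia.
Qed.

(** The list is a union of faces of [C]. Restriction to it then keeps these faces whole and, the
    renumbering being increasing, also their minimal sides. *)
Definition saturated n C S :=
  {in S, forall i, i <= n /\ forall j, j <= n -> same_face C i j -> j \in S}.

Lemma half_plane_saturated n C c b : c \in C -> saturated n C (half_plane n c b).
Proof.
move=> cC i; rewrite mem_half_plane => /andP[ilen /eqP <-]; split=> // j jn.
by rewrite mem_half_plane jn => /same_faceP/(_ c cC) ->; rewrite eqxx.
Qed.

Section Saturated.
Variables (n : nat) (S : seq nat) (D C : chords).
Hypotheses (sS : sorted ltn S) (S0 : S != [::]) (dD : diagram n D) (CD : C `<=` D).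
Hypothesis satS : saturated n C S.

Let rC : in_range n C.
Proof. by have [[rD _] _ _] := dD; move=> c /(fsubsetP CD)/rD. Qed.

Let lt_size k : (k <= (size S).-1) = (k < size S).
Proof. by case: (S) S0. Qed.

Lemma nth_face_sides k : k < size S ->
  [seq nth 0 S l | l <- face_sides (size S).-1 (restrict S C) k] =
  face_sides n C (nth 0 S k).
Proof.
move=> kS; apply: (eq_sorted_ltn _ (sorted_face_sides _ _ _)).
  apply: sorted_sub_nth => //; first exact: sorted_face_sides.
  by move=> l; rewrite mem_face_sides lt_size => /andP[].
have [kn satk] := satS (mem_nth 0 kS).
move=> j; apply/mapP/idP => [[l]|].
  rewrite !mem_face_sides lt_size => /andP[lS]; rewrite (same_face_restrict sS rC) // => kl ->.
  by rewrite kl (satS (mem_nth 0 lS)).1.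
rewrite mem_face_sides => /andP[jn kj]; have jS := satk j jn kj.
exists (index j S); last by rewrite nth_index.
by rewrite mem_face_sides lt_size index_mem jS (same_face_restrict sS rC) ?index_mem // nth_index.
Qed.

Lemma nth_min_sides :
  [seq nth 0 S l | l <- min_sides (size S).-1 (restrict S C)] =
  [seq i <- min_sides n C | i \in S].
Proof.
have H k : k < size S -> is_min (restrict S C) k = is_min C (nth 0 S k).
  move=> kS; have [kn satk] := satS (mem_nth 0 kS).
  apply/is_minP/is_minP => Hk j jk.
    apply/negP => kj; have jS := satk j (leq_trans (ltnW jk) kn) kj.
    suff jk' : index j S < k.
      by have := Hk _ jk'; rewrite (same_face_restrict sS rC) ?index_mem // nth_index // kj.
    move: jk; rewrite -{1}(nth_index 0 jS) !ltnNge; apply: contra => le.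
    by apply: (sorted_leq_nth leq_trans leqnn 0 (sub_sorted ltnW sS)) => //=; rewrite inE ?index_mem.
  rewrite (same_face_restrict sS rC) //; last exact: ltn_trans kS.
  apply: Hk; apply: (sorted_ltn_nth ltn_trans 0 sS) => //; rewrite inE //; exact: ltn_trans kS.
apply: eq_sorted_ltn.
- apply: sorted_sub_nth => //; first exact: sorted_min_sides.
  by move=> l; rewrite mem_min_sides lt_size => /andP[].
- exact: (sorted_filter ltn_trans _ (sorted_min_sides _ _)).
move=> j; apply/mapP/idP => [[l]|].
  rewrite mem_filter !mem_min_sides lt_size => /andP[lS]; rewrite H // => mj ->.
  by rewrite mj mem_nth // (satS (mem_nth 0 lS)).1.
rewrite mem_filter mem_min_sides => /and3P[jS jn mj].
exists (index j S); last by rewrite nth_index.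
by rewrite mem_min_sides lt_size index_mem jS H ?index_mem // nth_index.
Qed.

End Saturated.

(** * Diagrams as monomials *)

Lemma diagram_dissection (F : dissection) : diagram (deg F) F /\ 0 < deg F.
Proof.
have /andP[/is_dissectionP dF F0] := valP F; split=> //.
by rewrite /deg cardfs_gt0.
Qed.

Lemma diagram0 E : diagram 0 E -> E = fset0.
Proof. by case=> _ _ /eqP; rewrite cardfs_eq0 => /eqP. Qed.

Lemma diagram_monom0 : diagram_monom fset0 = mone.
Proof. by rewrite /diagram_monom; case: insubP => // F; rewrite eqxx andbF. Qed.

Lemma ucm_eq (I : choiceType) (i j : I) : (ucm i == ucm j) = (i == j).
Proof.
apply/eqP/eqP => [H|-> //]; have : ucm i j = 1 by rewrite H ucmE eqxx.
by rewrite ucmE; case: eqP.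
Qed.

Lemma diagram_monom_eq E (F : dissection) : (diagram_monom E == ucm F) = (E == dchords F).
Proof.
rewrite /diagram_monom; case: insubP => [G _ <-|nE]; first by rewrite ucm_eq.
rewrite eq_sym cm1_eq1; apply/esym/negP => /eqP EF; move: nE; rewrite EF.
by case/negP; exact: (valP F).
Qed.

Lemma diagram_exists n E : diagram n E -> E != fset0 -> exists F : dissection, E = dchords F.
Proof.
move=> dE E0; have [_ _ cE] := dE.
have dsE : is_dissection E && (E != fset0).
  by rewrite E0 andbT; apply/is_dissectionP; rewrite /deg cE.
by exists (Dissection dsE).
Qed.

Lemma mdeg_diagram_monom n E : diagram n E -> mdeg (diagram_monom E) = (E != fset0).
Proof.
move=> dE; case: eqP => [->|/eqP E0]; first by rewrite diagram_monom0 mdeg1.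
have [F EF] := diagram_exists dE E0; have /eqP -> : diagram_monom E == ucm F.
  by rewrite diagram_monom_eq EF.
exact: mdegU.
Qed.

(** Compare the numbers of factors: a nonempty diagram counts for one, so a product equal to a
    single variable has one trivial factor. *)
Lemma mul_diagram_monom_eq n1 n2 E1 E2 (F : dissection) :
  diagram n1 E1 -> diagram n2 E2 ->
  (mmul (diagram_monom E1) (diagram_monom E2) == ucm F) =
  (E1 == dchords F) && (E2 == fset0) || (E1 == fset0) && (E2 == dchords F).
Proof.
move=> d1 d2; have F0 : dchords F != fset0 by case/andP: (valP F).
case: (eqVneq E1 fset0) => [->|E10].
  by rewrite diagram_monom0 mul1m diagram_monom_eq (eq_sym fset0) (negPf F0).
case: (eqVneq E2 fset0) => [->|E20].
  by rewrite diagram_monom0 mulm1 diagram_monom_eq andbT orbF.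
rewrite andbF; apply/negP => /eqP/(congr1 mdeg).
by rewrite mdegM (mdeg_diagram_monom d1) (mdeg_diagram_monom d2) E10 E20 mdegU.
Qed.

Lemma qpartE n D C : diagram n D -> C `<=` D ->
  qpart D C = \big[mmul/mone]_(i <- min_sides n C)
                 diagram_monom (restrict (face_sides n C i) D).
Proof.
move=> dD CD; have [_ _ cD] := dD; rewrite /qpart /deg cD.
apply: eq_big_seq => i; rewrite mem_min_sides => /andP[ilen _].
by rewrite (qfaceE dD CD).
Qed.

Lemma nth_ltn S k l : sorted ltn S -> k < size S -> l < size S ->
  (nth 0 S k < nth 0 S l) = (k < l).
Proof.
move=> sS kS lS; apply/idP/idP; last exact: (sorted_ltn_nth ltn_trans 0 sS).
rewrite !ltnNge; apply: contra => le.
exact: (sorted_leq_nth leq_trans leqnn 0 (sub_sorted ltnW sS)).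
Qed.

Lemma restrictS S C D : C `<=` D -> restrict S C `<=` restrict S D.
Proof.
move=> /fsubsetP CD; apply/fsubsetP => d /mem_restrict[c cC [cS ->]].
exact: image_in_restrict (CD _ cC) cS.
Qed.

Section BigRestrict.
Variables (V : Type) (idx : V) (op : Monoid.com_law idx).

Lemma big_cutting S C (F : nat * nat -> V) :
  \big[op/idx]_(d <- cutting S C) F d = \big[op/idx]_(d <- C | cuts S d) F d.
Proof. by rewrite [RHS]big_fset_condE. Qed.

Lemma big_restrict S C (F : nat * nat -> V) :
    {in cutting S C &, injective (image_chord S)} ->
  \big[op/idx]_(d <- restrict S C) F d =
  \big[op/idx]_(d <- C | cuts S d) F (image_chord S d).
Proof.
move=> inj; rewrite -(big_cutting S C (F \o image_chord S)) restrictE /cutting.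
by rewrite big_imfset //= big_filter big_fset_condE.
Qed.

End BigRestrict.

Lemma not_cuts_half n c b : ~~ cuts (half_plane n c b) c.
Proof.
by apply/cutsPn => i j; rewrite !mem_half_plane => /andP[_ /eqP->] /andP[_ /eqP->].
Qed.

(** * The two halves on either side of a chord *)

Section Halves.
Variables (n : nat) (D : chords) (c : nat * nat).
Hypotheses (dD : diagram n D) (cD : c \in D).

Local Notation H b := (half_plane n c b).

Let rD : in_range n D. Proof. by have [[]] := dD. Qed.
Let c1D : [fset c] `<=` D. Proof. by rewrite fsub1set. Qed.

Lemma half_neq0 b : H b != [::].
Proof. by have [i ilen ->] := half_plane_faceE b (rD cD); exact: face_sides_neq0. Qed.

Lemma restrict_half_diagram b : diagram (size (H b)).-1 (restrict (H b) D).
Proof. by have [i ilen ->] := half_plane_faceE b (rD cD); exact: restrict_face c1D _. Qed.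

Lemma image_half_inj b : {in cutting (H b) D &, injective (image_chord (H b))}.
Proof. by have [i ilen ->] := half_plane_faceE b (rD cD); exact: image_face_inj c1D _. Qed.

Lemma dual_half d p q : d \in D -> d != c -> dual n D d p q -> side_in c p = side_in c q.
Proof. by move=> dD' dc dpq; apply: dual_other dpq cD _; rewrite eq_sym. Qed.

(** The chord cuts the half that holds its dual sides; if it cut the other half as well, it would
    cross [c]. *)
Lemma cuts_half_dual d p q b : d \in D -> d != c -> dual n D d p q ->
  cuts (H b) d = (side_in c p == b).
Proof.
move=> dD' dc dpq; have cpq := dual_half dD' dc dpq; have [pn qn ppq _] := dpq.
apply/idP/eqP => [/cutsP[i [j [+ + dij]]]|<-]; last first.
  by apply/cutsP; exists p, q; rewrite !mem_half_plane pn qn -cpq eqxx.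
rewrite !mem_half_plane => /andP[_ /eqP ci] /andP[_ /eqP cj].
apply/eqP; apply/negPn/negP => cpb.
have [[_ xD] _ _] := dD; case/negP: (xD c d cD dD').
by apply: (@crossing_sides c d p q i j); rewrite ?ci ?cj -?cpq.
Qed.

Lemma cuts_halfN d b : d \in D -> d != c -> cuts (H (~~ b)) d = ~~ cuts (H b) d.
Proof.
move=> dD' dc; have [p [q dpq]] := dual_exists dD dD'.
by rewrite !(cuts_half_dual _ dD' dc dpq); case: b; case: side_in.
Qed.

Lemma size_halves : size (H true) + size (H false) = n.+1.
Proof.
rewrite !size_filter -[RHS](size_iota 0) -(count_predC (fun i => side_in c i == true)).
by congr (_ + _); apply: eq_count => i /=; case: side_in.
Qed.

Section Split.
Variable C : chords.
Hypotheses (CD : C `<=` D) (cC : c \in C).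

Let rC : in_range n C. Proof. by move=> d /(fsubsetP CD)/rD. Qed.
Local Notation M := (min_sides n C).
Local Notation R b := (restrict (H b) D).
Local Notation RC b := (restrict (H b) C).

Let satH b : saturated n C (H b). Proof. exact: half_plane_saturated. Qed.
Let sH b : sorted ltn (H b). Proof. exact: sorted_half_plane. Qed.
Let RCR b : RC b `<=` R b. Proof. exact: restrictS. Qed.

Lemma sum_halves (F : nat * nat -> nat) :
  \sum_(d <- C) F d =
  F c + (\sum_(d <- cutting (H true) C) F d + \sum_(d <- cutting (H false) C) F d).
Proof.
rewrite (big_fsetD1 c) //=; congr (_ + _).
rewrite (big_fsetID _ (cuts (H true))) /=; congr (_ + _); apply: eq_fbigl => d.
  rewrite !inE; case: (eqVneq d c) => [->|dc] //=.
  by rewrite (negPf (not_cuts_half _ _ _)) andbF.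
rewrite !inE; case: (eqVneq d c) => [->|dc] /=.
  by rewrite (negPf (not_cuts_half _ _ _)) andbF.
by case dC: (d \in C) => //=; rewrite -(cuts_halfN _ (fsubsetP CD _ dC) dc).
Qed.

(** Flips only compare sides, and the increasing renumbering of a half commutes with passing to
    minimal sides because the half is a union of faces of [C]. *)
Lemma kexp_half b :
  kexp (R b) (RC b) = \sum_(d <- cutting (H b) C) flipped D C d.
Proof.
have sub : {subset cutting (H b) C <= cutting (H b) D}.
  by move=> d; rewrite !mem_cutting => /andP[/(fsubsetP CD) ->].
have inj : {in cutting (H b) C &, injective (image_chord (H b))}.
  by move=> d e dH eH; apply: image_half_inj; exact: sub.
rewrite kexpE big_restrict // big_cutting.
rewrite big_seq_cond [RHS]big_seq_cond; apply: eq_bigr => d /andP[dC dH]; congr nat_of_bool.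
have dD' := fsubsetP CD _ dC.
have dc : d != c by apply: contraTneq dH => ->; exact: not_cuts_half.
have [p [q dpq]] := dual_exists dD dD'; have [pn qn _ _] := dpq.
have := dH; rewrite (cuts_half_dual _ dD' dc dpq) => /eqP cp.
have pH : p \in H b by rewrite mem_half_plane pn cp eqxx.
have qH : q \in H b by rewrite mem_half_plane qn -(dual_half dD' dc dpq) cp eqxx.
set k := index p (H b); set l := index q (H b).
have kH : k < size (H b) by rewrite index_mem.
have lH : l < size (H b) by rewrite index_mem.
have pE : nth 0 (H b) k = p by rewrite nth_index.
have qE : nth 0 (H b) l = q by rewrite nth_index.
have dkl : dual (size (H b)).-1 (R b) (image_chord (H b) d) k l.
  by apply: (dual_restrict (sH b) rD) => //; rewrite pE qE.
rewrite (flippedE (restrict_half_diagram b) (RCR b) _ dkl); last exact: image_in_restrict.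
rewrite (flippedE dD CD dC dpq) -(nth_ltn (sH b) kH lH) pE qE; congr (_ != _).
have mp : min_side C p \in H b.
  by have [_] := satH pH; apply; [exact: leq_trans (min_side_le C p) pn|exact: min_side_face].
have mq : min_side C q \in H b.
  by have [_] := satH qH; apply; [exact: leq_trans (min_side_le C q) qn|exact: min_side_face].
rewrite -(nth_ltn (sH b)); first last.
- exact: leq_ltn_trans (min_side_le _ _) lH.
- exact: leq_ltn_trans (min_side_le _ _) kH.
by rewrite !(min_side_restrict (sH b) rC) ?pE ?qE.
Qed.

Lemma qpart_half b :
  qpart (R b) (RC b) = \big[mmul/mone]_(i <- M | i \in H b)
                          diagram_monom (restrict (face_sides n C i) D).
Proof.
rewrite (qpartE (restrict_half_diagram b) (RCR b)) -[RHS]big_filter.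
rewrite -(nth_min_sides (sH b) (half_neq0 b) dD CD (@satH b)) big_map.
apply: eq_big_seq => k; rewrite mem_min_sides => /andP[kn _].
have kH : k < size (H b) by case: (H b) (half_neq0 b) kn.
rewrite (restrict_comp (n := n)) //; first last.
- by move=> l; rewrite mem_face_sides => /andP[]; case: (H b) (half_neq0 b).
- exact: sorted_face_sides.
by rewrite (nth_face_sides (sH b) (half_neq0 b) dD CD (@satH b)).
Qed.

Lemma qpart_halves : qpart D C = mmul (qpart (R true) (RC true)) (qpart (R false) (RC false)).
Proof.
rewrite !qpart_half (qpartE dD CD) (bigID (fun i => i \in H true)) /=; congr mmul.
rewrite big_seq_cond [RHS]big_seq_cond; apply: eq_bigl => i.
case iM: (i \in M) => //=; move: iM; rewrite !mem_half_plane mem_min_sides => /andP[-> _] /=.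
by case: side_in.
Qed.

Lemma rpart_half b : rpart (R b) (RC b) = restrict [seq i <- M | i \in H b] C.
Proof.
rewrite (rpartE (restrict_half_diagram b) (RCR b)) (restrict_comp (n := n)) //.
- by rewrite (nth_min_sides (sH b) (half_neq0 b) dD CD (@satH b)).
- exact: sorted_min_sides.
- by move=> l; rewrite mem_min_sides => /andP[]; case: (H b) (half_neq0 b).
Qed.

End Split.

Lemma qpart1 : qpart D [fset c] =
  mmul (diagram_monom (restrict (H true) D)) (diagram_monom (restrict (H false) D)).
Proof.
rewrite (qpart_halves c1D (fset11 c)) !(qpart_half c1D (fset11 c)).
(* The sides [c.1] and [n] are samples of the sides on the arc of [c] and off it. *)
have one b : [seq i <- min_sides n [fset c] | i \in H b] =
    [:: min_side [fset c] (if b then c.1 else n)].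
  set i := if b then c.1 else n.
  have in_ : i <= n by have := rD cD; rewrite /i; case: (b); lia.
  have ci : side_in c i = b by have := rD cD; rewrite /i /side_in; case: (b); lia.
  have cm : side_in c (min_side [fset c] i) = b.
    by have /same_faceP <- := min_side_face [fset c] i; rewrite ?inE.
  apply: eq_sorted_ltn => //; first exact: (sorted_filter ltn_trans _ (sorted_min_sides _ _)).
  move=> j; rewrite mem_filter mem_seq1 mem_half_plane.
  apply/andP/eqP => [[/andP[jn /eqP cj] jM]|->].
    apply: min_sides_same_face jM (min_side_in _ in_) _.
    by apply/same_faceP => d; rewrite inE => /eqP->; rewrite cm.
  by rewrite cm eqxx andbT min_side_in // (leq_trans (min_side_le _ _)).
have face b : face_sides n [fset c] (min_side [fset c] (if b then c.1 else n)) = H b.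
  rewrite half_plane_face; congr half_plane.
  have /same_faceP <- := min_side_face [fset c] (if b then c.1 else n); rewrite ?inE //.
  by have := rD cD; rewrite /side_in; case: b; lia.
by rewrite -big_filter one big_seq1 -big_filter one big_seq1 (face true) (face false).
Qed.

End Halves.

(** * Cutting along a set of chords, then along one of them *)

Section Split2.
Variables (n : nat) (D C : chords) (c : nat * nat).
Hypotheses (dD : diagram n D) (CD : C `<=` D) (cC : c \in C).

Local Notation H b := (half_plane n c b).
Local Notation R b := (restrict (H b) D).
Local Notation RC b := (restrict (H b) C).
Local Notation M := (min_sides n C).

Let cD : c \in D. Proof. exact: fsubsetP CD c cC. Qed.
Let rC : in_range n C. Proof. by have [[rD _] _ _] := dD; move=> d /(fsubsetP CD)/rD. Qed.
Let lec : c.1 <= c.2. Proof. exact: in_range_le rC cC. Qed.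
Let sM : sorted ltn M. Proof. exact: sorted_min_sides. Qed.
Let dE : diagram #|` C| (rpart D C).
Proof. by rewrite (rpartE dD CD); exact: restrict_min_sides dD CD. Qed.
Let szM : size M = #|` C|.+1. Proof. exact: size_min_sides dD CD. Qed.

Lemma image_in_rpart : image_chord M c \in rpart D C.
Proof. by rewrite (rpartE dD CD); exact: image_in_restrict (cuts_min_sides rC cC). Qed.

Lemma qpart_rpart :
  qpart (rpart D C) [fset image_chord M c] =
  mmul (diagram_monom (rpart (R true) (RC true)))
       (diagram_monom (rpart (R false) (RC false))).
Proof.
rewrite (qpart1 dE image_in_rpart) !(rpart_half dD cD CD cC) (rpartE dD CD).
have E b : restrict (half_plane #|` C| (image_chord M c) b) (restrict M C) =
           restrict [seq i <- M | i \in H (b (+) side_in c (last 0 M))] C.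
  rewrite (restrict_comp (n := n)) //; first last.
  - by move=> k; rewrite mem_half_plane szM ltnS => /andP[].
  - exact: sorted_half_plane.
  congr (restrict _ C).
  apply: eq_sorted_ltn.
  - apply: sorted_sub_nth => //; first exact: sorted_half_plane.
    by move=> k; rewrite mem_half_plane szM ltnS => /andP[].
  - exact: (sorted_filter ltn_trans).
  have side k : k < size M -> (side_in (image_chord M c) k == b) =
      (side_in c (nth 0 M k) == b (+) side_in c (last 0 M)).
    by move=> kM; rewrite side_in_image //; case: b; do 2 case: side_in.
  move=> i; apply/mapP/idP => [[k]|].
    rewrite mem_half_plane -ltnS -szM => /andP[kM]; rewrite side // => ck ->.
    have iM := mem_nth 0 kM; rewrite mem_filter mem_half_plane ck iM !andbT.
    by move: iM; rewrite mem_min_sides => /andP[].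
  rewrite mem_filter mem_half_plane => /andP[/andP[ilen ci] iM].
  exists (index i M); last by rewrite nth_index.
  by rewrite mem_half_plane -ltnS -szM index_mem iM side ?index_mem // nth_index.
(* If the last minimal side is on the arc of [c], the image of [c] has its halves exchanged, which
   commutativity absorbs. *)
rewrite (E true) (E false); case: (side_in c (last 0 M)); last by [].
exact: mulmC.
Qed.

(** The chords of [C] other than [c] contribute the same on both sides, half by half; the
    contributions of [c] are matched by [flip_split]. *)
Lemma kexp_halves :
  kexp D C + kexp (rpart D C) [fset image_chord M c] =
  kexp D [fset c] + (kexp (R true) (RC true) + kexp (R false) (RC false)).
Proof.
rewrite (kexpE D) (sum_halves dD cD CD cC) !(kexp_half dD cD CD cC).
rewrite addnAC [RHS]addnC addnC; congr (_ + _).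
have [p [q dpq]] := dual_exists dD cD; have [pn qn cpq _] := dpq.
have [iM jM] : min_side C p \in M /\ min_side C q \in M by rewrite !min_side_in.
set k := index (min_side C p) M; set l := index (min_side C q) M.
have kM : k < size M by rewrite index_mem.
have lM : l < size M by rewrite index_mem.
have dkl : dual #|` C| (rpart D C) (image_chord M c) k l.
  rewrite (rpartE dD CD) -[#|` C|]/(#|` C|.+1.-1) -szM.
  apply: (dual_restrict sM rC cC) => //; rewrite !nth_index //.
  exact: dual_min_side dpq.
rewrite (kexp1 dE image_in_rpart dkl) (kexp1 dD cD dpq) (flippedE dD CD cC dpq).
rewrite -(flip_split dD CD cC dpq); congr (_ + _ : nat).
have M0 : nth 0 M 0 = 0 by [].
rewrite !side_in_image // ?szM // M0 nth_index // (inj_eq (@addIb _)).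
have /same_faceP/(_ c cC) <- := min_side_face C p.
by rewrite -(nth_ltn sM kM lM) !nth_index.
Qed.

End Split2.

Section Pairs.
Variables (n : nat) (D : chords) (c : nat * nat).
Hypotheses (dD : diagram n D) (cD : c \in D).

Local Notation H b := (half_plane n c b).
Local Notation R b := (restrict (H b) D).

Lemma halves_perm :
  perm_eq [seq (restrict (H true) C, restrict (H false) C)
             | C : chords <- [seq C <- fpowerset D | c \in (C : chords)]]
          (allpairs pair (fpowerset (R true)) (fpowerset (R false))).
Proof.
apply: uniq_perm.
- rewrite map_inj_in_uniq ?filter_uniq ?fset_uniq // => C C'.
  rewrite !mem_filter !fpowersetE => /andP[cC CD] /andP[cC' CD'] [eq1 eq2].
  have eqb b : restrict (H b) C = restrict (H b) C' by case: b.
  have sub C1 C2 : C1 `<=` D -> C2 `<=` D -> c \in C2 ->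
      (forall b, restrict (H b) C1 = restrict (H b) C2) -> C1 `<=` C2.
    move=> C1D C2D cC2 eqR; apply/fsubsetP => d dC1; case: (eqVneq d c) => [->//|dc].
    have dD' := fsubsetP C1D d dC1.
    have [b bd] : exists b, cuts (H b) d.
      case dt : (cuts (H true) d); [by exists true|exists false].
      by have := cuts_halfN dD cD true dD' dc; rewrite dt.
    have := image_in_restrict dC1 bd; rewrite eqR => /mem_restrict[e eC2 [eb]].
    move/(image_half_inj dD cD) => -> //; rewrite mem_cutting ?dD' //.
    by rewrite (fsubsetP C2D).
  by apply/eqP; rewrite eqEfsubset; apply/andP; split; apply: sub.
- by apply: allpairs_uniq; rewrite ?fset_uniq // => -[? ?] [? ?].
case=> C1 C2; apply/mapP/allpairsP => [[C]|[[C1' C2'] /= [+ + [-> ->]]]].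
  rewrite mem_filter fpowersetE => /andP[cC CD] [-> ->].
  by exists (restrict (H true) C, restrict (H false) C); rewrite !fpowersetE !restrictS.
rewrite !fpowersetE => C1R C2R.
pose P b := if b then C1' else C2'.
have PR b : P b `<=` R b by case: b.
(* The inverse map: [c] together with every chord whose image in the half that it cuts has been
   selected. *)
pose C := [fset d in D | [|| d == c, cuts (H true) d && (image_chord (H true) d \in C1')
                        | cuts (H false) d && (image_chord (H false) d \in C2')]].
have cC : c \in C by rewrite !inE cD eqxx.
exists C; first by rewrite mem_filter cC fpowersetE; apply/fsubsetP => d; rewrite !inE => /andP[].
have E b : P b = restrict (H b) C.
  apply/fsetP => e; apply/idP/mem_restrict => [eP|[d]].
    have /mem_restrict[d dD' [db eE]] := fsubsetP (PR b) e eP.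
    exists d => //; rewrite !inE dD' /=.
    by case: (b) eP db eE => /= eP db eE; rewrite db -eE eP ?orbT.
  rewrite !inE => /andP[dD' Pd] [db ->].
  have dc : d != c by apply: contraTneq db => ->; exact: not_cuts_half.
  have dN : cuts (H (~~ b)) d = false by rewrite (cuts_halfN dD cD) // db.
  by move: Pd; rewrite (negPf dc) /=; case: (b) db dN => /= -> ->; rewrite ?orbF.
by rewrite -(E true) -(E false).
Qed.

Lemma sum_pairs (V : nmodType) (F : chords -> V) (G : chords -> chords -> V) :
    (forall C, C `<=` D -> c \in C -> F C = G (restrict (H true) C) (restrict (H false) C)) ->
  (\sum_(C <- fpowerset D | c \in (C : chords)) F C =
  \sum_(C1 <- fpowerset (R true)) \sum_(C2 <- fpowerset (R false)) G C1 C2)%R.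
Proof.
move=> FG; transitivity (\sum_(p <- allpairs pair (fpowerset (R true)) (fpowerset (R false)))
                          G p.1 p.2)%R; last by rewrite big_allpairs.
rewrite -(perm_big _ halves_perm) big_map big_filter.
rewrite [LHS]big_seq_cond [RHS]big_seq_cond; apply: eq_bigr => C.
by rewrite fpowersetE => /andP[CD cC]; exact: FG.
Qed.

End Pairs.

(** * Coefficients of the pre-Lie products *)

Lemma count_ltn_iota v a m : count (fun s => s < v) (iota a m) = minn (v - a) m.
Proof. by elim: m a => [|m IHm] a /=; [lia|rewrite IHm; lia]. Qed.

Lemma contract_iota n v : v <= n -> contract (iota 0 n.+1) v = v.
Proof. by move=> vn; rewrite /contract count_ltn_iota size_iota modn_small; lia. Qed.

Lemma restrict_iota n C : in_range n C -> restrict (iota 0 n.+1) C = C.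
Proof.
move=> rC; have E c : c \in C -> image_chord (iota 0 n.+1) c = c.
  move=> /rC rc; rewrite /image_chord !contract_iota; [|lia..].
  by apply: chord_id; lia.
have K c : c \in C -> cuts (iota 0 n.+1) c.
  move=> /rC rc; apply/cutsP; exists c.1, n; rewrite !mem_iota /side_in.
  by split; lia.
apply/fsetP => d; apply/mem_restrict/idP => [[c cC [_ ->]]|dC]; first by rewrite E.
by exists d => //; rewrite E // K.
Qed.

Lemma same_face0 i j : same_face fset0 i j.
Proof. by apply/same_faceP. Qed.

Lemma min_sides0 n : min_sides n fset0 = [:: 0].
Proof.
apply: eq_sorted_ltn => //; first exact: sorted_min_sides.
move=> i; rewrite mem_seq1 mem_min_sides.
apply/andP/eqP => [[_ /is_minP H]|-> //]; case: i H => // i /(_ 0 isT).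
by rewrite same_face0.
Qed.

Lemma qpart0 n D : diagram n D -> qpart D fset0 = diagram_monom D.
Proof.
move=> dD; rewrite (qpartE dD (fsub0set _)) min_sides0 big_seq1.
have -> : face_sides n fset0 0 = iota 0 n.+1.
  by apply/all_filterP/allP => i _; exact: same_face0.
by rewrite restrict_iota //; have [[]] := dD.
Qed.

Lemma rpart0 n D : diagram n D -> rpart D fset0 = fset0.
Proof.
move=> dD; rewrite (rpartE dD (fsub0set _)).
by apply/fsetP => d; rewrite !inE; apply/mem_restrict => -[].
Qed.

Lemma kexp0 D : kexp D fset0 = 0.
Proof. by rewrite kexpE big_seq_fset0. Qed.

Lemma min_sides_diagram n D : diagram n D -> min_sides n D = iota 0 n.+1.
Proof. by case=> _ sD _; exact: min_sides_separating. Qed.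

Lemma face_sides_diagram n D i : diagram n D -> i <= n -> face_sides n D i = [:: i].
Proof.
move=> dD ilen; apply: eq_sorted_ltn => //; first exact: sorted_face_sides.
move=> j; rewrite mem_face_sides mem_seq1; apply/andP/eqP => [[jn]|->].
  by have [_ sD _] := dD; rewrite same_face_sym; exact: sD.
by rewrite same_face_refl.
Qed.

Lemma qpart_full n D : diagram n D -> qpart D D = mone.
Proof.
move=> dD; rewrite (qpartE dD (fsubset_refl _)) big_seq big1 // => i.
rewrite mem_min_sides => /andP[ilen _].
have := restrict_face dD (fsubset_refl D) ilen; rewrite (face_sides_diagram dD) //=.
by move/diagram0 ->; exact: diagram_monom0.
Qed.

Lemma rpart_full n D : diagram n D -> rpart D D = D.
Proof.
move=> dD; rewrite (rpartE dD (fsubset_refl _)) (min_sides_diagram dD) restrict_iota //.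
by have [[]] := dD.
Qed.

Lemma kexp_full n D : diagram n D -> kexp D D = 0.
Proof.
move=> dD; rewrite kexpE big_seq big1 // => c cD.
have [p [q dpq]] := dual_exists dD cD; have [pn qn _ _] := dpq.
have id i : i <= n -> min_side D i = i.
  by move=> ilen; apply: (@min_side_id n); rewrite (min_sides_diagram dD) mem_iota.
by rewrite (flippedE dD _ cD dpq) ?fsubset_refl // !id // eqxx.
Qed.

(** A chord of [D] missing from [C] survives in the face of its dual sides, and that factor is then
    not 1. *)
Lemma qpart_eq1 n D C : diagram n D -> C `<=` D -> qpart D C = mone -> C = D.
Proof.
move=> dD CD q1; apply/eqP; rewrite eqEfsubset CD; apply/fsubsetP => d dD'.
apply/negPn/negP => dC.
have [p [q dpq]] := dual_exists dD dD'; have [pn qn ppq f] := dpq.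
have pq : same_face C p q by apply: same_face_sub f; rewrite fsubsetD1 CD.
have mM := min_side_in C pn; have mn := leq_trans (min_side_le C p) pn.
have : mdeg (qpart D C) = 0 by rewrite q1 mdeg1.
rewrite (qpartE dD CD) mdeg_prod (bigD1_seq (min_side C p)) ?min_sides_uniq //=.
rewrite (mdeg_diagram_monom (restrict_face dD CD mn)).
suff -> : restrict (face_sides n C (min_side C p)) D != fset0 by [].
apply/fset0Pn; exists (image_chord (face_sides n C (min_side C p)) d).
have mp : same_face C (min_side C p) p by rewrite same_face_sym min_side_face.
apply: image_in_restrict => //; apply/cutsP; exists p, q.
by rewrite !mem_face_sides pn qn mp (same_face_trans mp pq).
Qed.

Lemma rpart_eq0 n D C : diagram n D -> C `<=` D -> rpart D C = fset0 -> C = fset0.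
Proof.
move=> dD CD r0; have := restrict_min_sides dD CD; rewrite -(rpartE dD CD) r0.
by case=> _ _; rewrite cardfs0 => /esym/eqP; rewrite cardfs_eq0 => /eqP.
Qed.

Lemma rpart_diagram n D C : diagram n D -> C `<=` D -> diagram #|` C| (rpart D C).
Proof. by move=> dD CD; rewrite (rpartE dD CD); exact: restrict_min_sides dD CD. Qed.

Section PairCondition.
Variables (n1 n2 : nat) (R1 R2 : chords) (D1 D2 : dissection).
Hypotheses (d1 : diagram n1 R1) (d2 : diagram n2 R2).

Definition pair_cond C1 C2 :=
  (mmul (qpart R1 C1) (qpart R2 C2) == ucm D1) &&
  (mmul (diagram_monom (rpart R1 C1)) (diagram_monom (rpart R2 C2)) == ucm D2).

Let D1_neq0 : dchords D1 != fset0. Proof. by case/andP: (valP D1). Qed.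
Let D2_neq0 : dchords D2 != fset0. Proof. by case/andP: (valP D2). Qed.

(** If the product of the two [rpart] is a single variable, one of them is trivial, hence so is the
    subset behind it. That half then enters [qpart] whole and exhausts the single factor allowed, so
    the other [qpart] is 1 and the other subset is full. *)
Lemma pair_condE C1 C2 : R1 != fset0 -> R2 != fset0 -> C1 `<=` R1 -> C2 `<=` R2 ->
  pair_cond C1 C2 =
    [&& C1 == R1, C2 == fset0, R1 == dchords D2 & R2 == dchords D1] ||
    [&& C1 == fset0, C2 == R2, R1 == dchords D1 & R2 == dchords D2].
Proof.
move=> R10 R20 C1R C2R; apply/idP/idP.
  case/andP=> qE; rewrite (mul_diagram_monom_eq _ (rpart_diagram d1 C1R) (rpart_diagram d2 C2R)).
  have deg1 m1 m2 : mdeg m2 = 1 -> mmul m1 m2 = ucm D1 -> m1 = mone /\ m2 = ucm D1.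
    move=> m21 mE; have : mdeg m1 = 0.
      by have := congr1 mdeg mE; rewrite mdegM m21 mdegU; lia.
    by move/mdeg_eq0I => m11; move: mE; rewrite m11 mul1m.
  case/orP=> /andP[/eqP r1 /eqP r2].
    have C20 := rpart_eq0 d2 C2R r2; move: qE; rewrite C20 (qpart0 d2) => /eqP/deg1[].
      by rewrite (mdeg_diagram_monom d2) R20.
    move/(qpart_eq1 d1 C1R) => C1E /eqP; rewrite diagram_monom_eq => ->.
    by rewrite -r1 C1E (rpart_full d1) !eqxx.
  have C10 := rpart_eq0 d1 C1R r1; move: qE; rewrite C10 (qpart0 d1) mulmC => /eqP/deg1[].
    by rewrite (mdeg_diagram_monom d1) R10.
  move/(qpart_eq1 d2 C2R) => C2E /eqP; rewrite diagram_monom_eq => ->.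
  by rewrite -r2 C2E (rpart_full d2) !eqxx orbT.
case/orP => /and4P[/eqP-> /eqP-> e1 e2]; rewrite /pair_cond.
  rewrite (qpart_full d1) (qpart0 d2) (rpart_full d1) (rpart0 d2) mul1m diagram_monom0 mulm1.
  by rewrite !diagram_monom_eq e1 e2.
rewrite (qpart_full d2) (qpart0 d1) (rpart_full d2) (rpart0 d1) mulm1 diagram_monom0 mul1m.
by rewrite !diagram_monom_eq e1 e2.
Qed.

End PairCondition.

Section Sums.
Variables (K : fieldType) (x : K).

Definition coef_chords (q : {cmonom dissection}) r D : K :=
  (\sum_(C <- fpowerset D | (qpart D C == q) && (rpart D C == r)) x ^+ kexp D C)%R.

Lemma coef_chordsE (D1 D2 D : dissection) :
  coef x D1 D2 D = coef_chords (ucm D1) (dchords D2) (dchords D).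
Proof.
rewrite /coef /coproduct raddf_sum /= [RHS]big_mkcond; apply: eq_bigr => C _.
by rewrite mcoeffU xpair_eqE diagram_monom_eq; case: ifP.
Qed.

Lemma sum2_delta (T : eqType) (s1 s2 : seq T) a b (t : bool) (v : T -> T -> K) :
    uniq s1 -> uniq s2 -> a \in s1 -> b \in s2 ->
  (\sum_(C1 <- s1) \sum_(C2 <- s2) (if [&& C1 == a, C2 == b & t] then v C1 C2 else 0) =
   if t then v a b else 0)%R.
Proof.
move=> u1 u2 a1 b2; rewrite (bigD1_seq a) //= (bigD1_seq b) //= !eqxx /=.
rewrite !big1 ?addr0 // => [C1 /negPf ne|C2 /negPf ->] //.
by rewrite big1 // => C2 _; rewrite ne.
Qed.

(** The last summand lives on the cuts with a half of degree 0 and is the one that [L] cancels.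
    Elsewhere only [x ^+ k] remains, because [kexp] vanishes on empty and on full subsets. *)
Lemma pair_sum n1 n2 k R1 R2 (D1 D2 : dissection) :
  diagram n1 R1 -> diagram n2 R2 -> 0 < n1 + n2 ->
  (\sum_(C1 <- fpowerset R1) \sum_(C2 <- fpowerset R2)
     (if pair_cond R1 R2 D1 D2 C1 C2 then x ^+ (k + (kexp R1 C1 + kexp R2 C2)) else 0) =
   x ^+ k * (((R1 == dchords D1) && (R2 == dchords D2))%:R +
             ((R1 == dchords D2) && (R2 == dchords D1))%:R) +
   x ^+ k * (if R2 == fset0 :> chords then coef_chords (ucm D1) (dchords D2) R1
       else if R1 == fset0 :> chords then coef_chords (ucm D1) (dchords D2) R2 else 0))%R.
Proof.
move=> d1 d2 n12.
have nz (F : dissection) : (fset0 == dchords F) = false.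
  by rewrite eq_sym; apply/negbTE; case/andP: (valP F).
have q0 m (R : chords) : diagram m R -> R = fset0 -> qpart fset0 fset0 = mone.
  by move=> dR R0; rewrite R0 in dR; rewrite (qpart0 dR) diagram_monom0.
have r0 m (R : chords) : diagram m R -> R = fset0 -> rpart fset0 fset0 = fset0.
  by move=> dR R0; rewrite R0 in dR; exact: rpart0 dR.
case: (eqVneq R2 fset0) => [R2E|R20].
  have [qE rE] := (q0 _ _ d2 R2E, r0 _ _ d2 R2E).
  rewrite R2E !nz !andbF addr0 mulr0 add0r mulr_sumr [RHS]big_mkcond /=.
  apply: eq_bigr => C1 _; rewrite fpowerset0 big_seq_fset1 /pair_cond qE rE.
  by rewrite diagram_monom0 !mulm1 diagram_monom_eq kexp0 addn0 exprD.
case: (eqVneq R1 fset0) => [R1E|R10].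
  have [qE rE] := (q0 _ _ d1 R1E, r0 _ _ d1 R1E).
  rewrite R1E !nz !andFb addr0 mulr0 add0r fpowerset0 big_seq_fset1 mulr_sumr [RHS]big_mkcond.
  apply: eq_bigr => C2 _; rewrite /pair_cond qE rE.
  by rewrite diagram_monom0 !mul1m diagram_monom_eq kexp0 add0n exprD.
rewrite mulr0 addr0.
pose v C1 C2 : K := (x ^+ (k + (kexp R1 C1 + kexp R2 C2)))%R.
have E C1 C2 : C1 \in fpowerset R1 -> C2 \in fpowerset R2 ->
   ((if pair_cond R1 R2 D1 D2 C1 C2 then v C1 C2 else 0) =
     (if [&& C1 == R1, C2 == fset0 & (R1 == dchords D2) && (R2 == dchords D1)]
      then v C1 C2 else 0) +
     (if [&& C1 == fset0, C2 == R2 & (R1 == dchords D1) && (R2 == dchords D2)]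
      then v C1 C2 else 0))%R.
  rewrite !fpowersetE => C1R C2R; rewrite (pair_condE _ _ d1 d2) //.
  case: (eqVneq C1 R1) => [->|_] /=; last by rewrite add0r.
  by rewrite (negPf R10) /= orbF addr0.
rewrite big_seq (eq_bigr (fun C1 => \sum_(C2 <- fpowerset R2)
     (if [&& C1 == R1, C2 == fset0 & (R1 == dchords D2) && (R2 == dchords D1)]
      then v C1 C2 else 0) + \sum_(C2 <- fpowerset R2)
     (if [&& C1 == fset0, C2 == R2 & (R1 == dchords D1) && (R2 == dchords D2)]
      then v C1 C2 else 0))%R); last first.
  move=> C1 C1R; rewrite -big_split big_seq [RHS]big_seq; apply: eq_bigr => C2 C2R.
  exact: E.
rewrite -big_seq big_split !sum2_delta ?fset_uniq ?fpowersetE ?fsub0set ?fsubset_refl //.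
rewrite /v (kexp_full d1) (kexp_full d2) !kexp0 !addn0 addrC.
by rewrite mulrDr; case: (_ && _); case: (_ && _); rewrite ?mulr1 ?mulr0.
Qed.

Lemma prelie_basis_coef (D1 D2 D : dissection) :
  ((prelie_basis x D1 D2)@_D =
   if deg D == (deg D1 + deg D2)%N then coef x D1 D2 D else 0)%R.
Proof.
rewrite raddf_sum /=.
rewrite (eq_bigr (fun E : dissection => if E == D then coef x D1 D2 E else 0)%R); last first.
  by move=> E _; rewrite mcoeffZ mcoeffU; case: ifP => _; [exact: mulr1|exact: mulr0].
case: (boolP (deg D == deg D1 + deg D2)) => degD; last first.
  rewrite big_seq big1; first by [].
  move=> E; rewrite mem_dissections.
  by case: (E =P D) => [->|//]; rewrite (negPf degD).
have : D \in dissections (deg D1 + deg D2) by rewrite mem_dissections degD.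
move: (dissections _) (dissections_uniq (deg D1 + deg D2)) => s us Ds.
rewrite (bigD1_seq D Ds us) /= eqxx.
by rewrite big1 ?addr0 // => E /negPf->.
Qed.

Lemma msupp_prelie_basis (D1 D2 E : dissection) :
  E \in msupp (prelie_basis x D1 D2) -> E \in dissections (deg D1 + deg D2).
Proof.
by rewrite -mcoeff_neq0 prelie_basis_coef mem_dissections; case: ifP => //; rewrite eqxx.
Qed.

Lemma sum_msupp (u : {malg K[dissection]}) (s : seq dissection) (F : dissection -> K) :
    uniq s -> {subset msupp u <= s} ->
  (\sum_(E <- msupp u) u@_E * F E = \sum_(E <- s) u@_E * F E)%R.
Proof.
move=> us sub; rewrite [RHS](bigID (fun E : dissection => E \in msupp u)) /= [X in (_ + X)%R]big1.
  rewrite addr0 -[RHS]big_filter; apply: perm_big.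
  apply: uniq_perm; rewrite ?filter_uniq ?fset_uniq //.
  by move=> E; rewrite mem_filter; case: (boolP (E \in msupp u)) => // /sub.
by move=> E /mcoeff_outdom ->; rewrite mul0r.
Qed.

Lemma prelie_basisl (D1 D : dissection) (v : {malg K[dissection]}) :
  ((prelie x << D1 >> v)@_D = \sum_(E <- msupp v) v@_E * (prelie_basis x D1 E)@_D)%R.
Proof.
rewrite /prelie msuppU oner_eq0 big_seq_fset1 raddf_sum /=; apply: eq_bigr => E _.
by rewrite mcoeffZ mcoeffUU mul1r.
Qed.

Lemma prelie_basisr (D2 D : dissection) (u : {malg K[dissection]}) :
  ((prelie x u << D2 >>)@_D = \sum_(E <- msupp u) u@_E * (prelie_basis x E D2)@_D)%R.
Proof.
rewrite /prelie raddf_sum /=; apply: eq_bigr => E _.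
by rewrite msuppU oner_eq0 big_seq_fset1 mcoeffZ mcoeffUU mulr1.
Qed.

Lemma prelie_basisU (D1 D2 : dissection) :
  prelie x << D1 >> << D2 >> = prelie_basis x D1 D2.
Proof.
rewrite /prelie msuppU oner_eq0 big_seq_fset1 msuppU oner_eq0 big_seq_fset1 !mcoeffUU.
by rewrite mulr1 scale1r.
Qed.

End Sums.

Section Coefficients.
Variables (K : fieldType) (x : K).

Lemma rpart_eq_a n D C : diagram n D -> C `<=` D ->
  (rpart D C == dchords diag_a) = (#|` C| == 1).
Proof.
move=> dD CD; have := rpart_diagram dD CD => -[[rR _] _ cR].
apply/eqP/eqP => [rE|C1]; first by rewrite -cR rE cardfs1.
rewrite C1 in rR cR; have /cardfs1P[c cE] : #|` rpart D C| == 1 by rewrite cR.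
rewrite cE /=; congr [fset _]; have := rR c; rewrite cE inE eqxx => /(_ isT).
by case: c {cE} => a b /= ab; congr (_, _); lia.
Qed.

(** The degree of [rpart D C] is the number of chords of [C], so only singletons contribute. *)
Lemma coef_a n q D : diagram n D ->
  (coef_chords x q (dchords diag_a) D =
   \sum_(c <- D) (if qpart D [fset c] == q then x ^+ kexp D [fset c] else 0))%R.
Proof.
move=> dD; rewrite /coef_chords big_mkcondl /= big_seq_cond.
rewrite (eq_bigl (fun C : chords => (C \in fpowerset D) && (#|` C| == 1))); last first.
  by move=> C /=; rewrite fpowersetE; case CD: (C `<=` D) => //=; rewrite (rpart_eq_a dD CD).
rewrite -big_seq_cond -big_filter -[RHS](big_map (fun c => [fset c]) predT
  (fun C => if qpart D C == q then x ^+ kexp D C else 0)%R).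
apply: perm_big; apply: uniq_perm; first by rewrite filter_uniq ?fset_uniq.
  by rewrite map_inj_uniq ?fset_uniq // => c d /fset1_inj.
move=> C; rewrite mem_filter fpowersetE; apply/andP/mapP => [[/cardfs1P[c ->]]|[c cD ->]].
  by rewrite fsub1set => cD; exists c.
by rewrite cardfs1 fsub1set.
Qed.

Lemma qpart1_deg n D c (F : dissection) : diagram n D -> c \in D ->
  qpart D [fset c] == ucm F -> n = (deg F).+1.
Proof.
move=> dD cD; have := size_halves n c.
have d b := restrict_half_diagram dD cD b.
have H b : size (half_plane n c b) = #|` restrict (half_plane n c b) D|.+1.
  have [_ _ ->] := d b; have := half_neq0 dD cD b.
  by case: (half_plane n c b).
rewrite (qpart1 dD cD) (mul_diagram_monom_eq _ (d true) (d false)) !H /deg => sz.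
by case/orP => /andP[/eqP r1 /eqP r2]; move: sz; rewrite r1 r2 cardfs0; lia.
Qed.

Lemma sum_dissections n m R (G : chords -> K) : diagram m R -> 0 < n ->
  (\sum_(E <- dissections n) (if R == dchords E then G (dchords E) else 0) =
   if m == n then G R else 0)%R.
Proof.
move=> dR n0; have [_ _ cR] := dR; case: (m =P n) => mn; last first.
  rewrite big_seq big1 // => E; rewrite mem_dissections => /eqP dE.
  by case: (R =P _) => // RE; case: mn; rewrite -cR -dE RE.
have [|F RF] := diagram_exists dR; first by rewrite -cardfs_gt0 cR mn.
have : F \in dissections n by rewrite mem_dissections /deg -RF cR mn.
move: (dissections _) (dissections_uniq n) => s us Fs.
rewrite (bigD1_seq F Fs us) /= RF eqxx big1 ?addr0 // => E EF.
by case: eqP => // FE; case/eqP: EF; apply/esym/val_inj.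
Qed.

Lemma coef_a_deg n (F : dissection) D : diagram n D -> n != (deg F).+1 ->
  coef_chords x (ucm F) (dchords diag_a) D = 0%R.
Proof.
move=> dD nF; rewrite (coef_a _ dD) big_seq big1 // => c cD.
by case: ifP => // /(qpart1_deg dD cD) nE; rewrite nE eqxx in nF.
Qed.

Variables D1 D2 : dissection.

(* The contribution to D1 o (D2 o a) of cutting D along C, and then r_C(D) along
   the image of c. *)
Definition flag_term D C c : K :=
  (if (qpart D C == ucm D1) &&
      (qpart (rpart D C) [fset image_chord (min_sides (deg D) C) c] == ucm D2)
   then x ^+ (kexp D C + kexp (rpart D C) [fset image_chord (min_sides (deg D) C) c])
   else 0)%R.

Lemma deg_a : deg diag_a = 1.
Proof. exact: cardfs1. Qed.

(** The intermediate diagram must be [rpart D C], and by injectivity of the contraction its single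
    chords are the images of the chords of [C]; this gives a sum over pairs of [C] and [c]. *)
Lemma prelie_right_coef (D : dissection) :
  ((prelie x << D1 >> (prelie x << D2 >> << diag_a >>))@_D =
   if deg D == (deg D1 + deg D2).+1 then
     \sum_(c <- dchords D) \sum_(C <- fpowerset (dchords D) | c \in (C : chords))
        flag_term D C c
   else 0)%R.
Proof.
have [dD D0] := diagram_dissection D.
rewrite prelie_basisU prelie_basisl.
rewrite (sum_msupp (s := dissections (deg D2 + 1))); first last.
- by move=> E /msupp_prelie_basis; rewrite deg_a.
- exact: dissections_uniq.
rewrite (eq_big_seq (fun E : dissection => if deg D == (deg D1 + deg D2).+1 then
   \sum_(C <- fpowerset (dchords D) | qpart D C == ucm D1)
     (if rpart D C == dchords E then
       x ^+ kexp D C * coef_chords x (ucm D2) (dchords diag_a) (dchords E) else 0)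
   else 0)%R); last first.
  move=> E; rewrite mem_dissections !prelie_basis_coef deg_a => dE; rewrite dE (eqP dE).
  rewrite !coef_chordsE addn1 addnS; case: eqP => _; last by rewrite mulr0.
  rewrite {2}/coef_chords mulr_sumr big_mkcondr /=; apply: eq_bigr => C _.
  by case: eqP => // _; rewrite mulrC.
case: eqP => degD; last by rewrite big1.
rewrite exchange_big /=.
transitivity (\sum_(C <- fpowerset (dchords D) | qpart D C == ucm D1)
   \sum_(c <- C) flag_term D C c)%R.
  rewrite big_seq_cond [RHS]big_seq_cond; apply: eq_bigr => C /andP[].
  rewrite fpowersetE => CD qC; have dR := rpart_diagram dD CD.
  rewrite (sum_dissections (fun E =>
    x ^+ kexp D C * coef_chords x (ucm D2) (dchords diag_a) E)%R dR) ?addn1 //.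
  transitivity (x ^+ kexp D C * coef_chords x (ucm D2) (dchords diag_a) (rpart D C))%R.
    by case: eqP => [//|/eqP ne]; rewrite (coef_a_deg dR) ?mulr0.
  rewrite (coef_a _ dR) mulr_sumr.
  have [[rC _] _ _] := dD; have {}rC : in_range (deg D) C by move=> c /(fsubsetP CD)/rC.
  rewrite (rpartE dD CD) big_restrict; last first.
    by rewrite cutting_min_sides //; exact: image_min_sides_inj dD CD.
  rewrite big_seq_cond [RHS]big_seq.
  apply: eq_big => c; first by case cC: (c \in C) => //=; exact: cuts_min_sides.
  move=> _; rewrite /flag_term qC (rpartE dD CD) /=.
  by case: eqP => _; rewrite ?mulr0 // exprD.
transitivity (\sum_(C <- fpowerset (dchords D)) \sum_(c <- dchords D)
   (if c \in (C : chords) then flag_term D C c else 0))%R.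
  rewrite [LHS]big_mkcond big_seq [RHS]big_seq; apply: eq_bigr => C.
  rewrite fpowersetE => CD.
  transitivity (\sum_(c <- C) flag_term D C c)%R.
    case: (boolP (qpart D C == ucm D1)) => // /negPf qC.
    by symmetry; apply: big1 => c _; rewrite /flag_term qC.
  transitivity (\sum_(c <- dchords D | c \in C) flag_term D C c)%R; last by rewrite [LHS]big_mkcond.
  rewrite -[RHS]big_filter; apply: perm_big; apply: uniq_perm.
  - exact: fset_uniq.
  - by rewrite filter_uniq ?fset_uniq.
  by move=> c; rewrite mem_filter; case cC: (c \in C) => //=; rewrite (fsubsetP CD).
by rewrite exchange_big; apply: eq_bigr => c _; rewrite [RHS]big_mkcond.
Qed.

Lemma prelie_left_coef (D : dissection) :
  ((prelie x (prelie x << D1 >> << D2 >>) << diag_a >>)@_D =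
   if deg D == (deg D1 + deg D2).+1 then
     \sum_(c <- dchords D) \sum_(E <- dissections (deg D1 + deg D2))
        (if qpart D [fset c] == ucm E then
           x ^+ kexp D [fset c] * coef_chords x (ucm D1) (dchords D2) (dchords E)
         else 0)
   else 0)%R.
Proof.
have [dD D0] := diagram_dissection D.
rewrite prelie_basisU prelie_basisr.
rewrite (sum_msupp (s := dissections (deg D1 + deg D2))); first last.
- exact: msupp_prelie_basis.
- exact: dissections_uniq.
rewrite exchange_big /=.
case: eqP => degD.
  apply: eq_big_seq => E; rewrite mem_dissections !prelie_basis_coef deg_a => dE.
  rewrite dE (eqP dE) !coef_chordsE addn1 degD eqxx (coef_a _ dD) mulr_sumr.
  by apply: eq_bigr => c _; case: eqP => _; rewrite ?mulr0 // mulrC.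
rewrite big_seq big1 // => E; rewrite mem_dissections !prelie_basis_coef deg_a => /eqP dE.
by rewrite dE addn1; case: (deg D =P _) => //; rewrite mulr0.
Qed.

(** A number rather than a boolean: for [D1 = D2] both assignments of the halves count. *)
Definition split_by n D (c : nat * nat) : nat :=
  let R b := restrict (half_plane n c b) D in
  ((R true == dchords D1) && (R false == dchords D2)) +
  ((R true == dchords D2) && (R false == dchords D1)).

Lemma L_coef (D : dissection) :
  ((L x D1 D2)@_D =
   if deg D == (deg D1 + deg D2).+1 then
     \sum_(c <- dchords D) x ^+ kexp D [fset c] * (split_by (deg D) D c)%:R
   else 0)%R.
Proof.
rewrite /L mcoeffB prelie_right_coef prelie_left_coef.
case: eqP => degD; last by rewrite subrr.
have [dD _] := diagram_dissection D.
have [[_ n10] [_ n20]] := (diagram_dissection D1, diagram_dissection D2).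
rewrite -sumrB; apply: eq_big_seq => c cD.
have d b := restrict_half_diagram dD cD b.
pose R b := restrict (half_plane (deg D) c b) D.
rewrite (sum_pairs dD cD (G := fun C1 C2 =>
   if pair_cond (R true) (R false) D1 D2 C1 C2 then
   x ^+ (kexp D [fset c] + (kexp (R true) C1 + kexp (R false) C2)) else 0)%R); last first.
  move=> C CD cC; rewrite /flag_term /pair_cond (qpart_halves dD cD CD cC).
  by rewrite (qpart_rpart dD CD cC) (kexp_halves dD CD cC).
have sz := size_halves (deg D) c.
have H b : (size (half_plane (deg D) c b)) = (size (half_plane (deg D) c b)).-1.+1.
  by have := half_neq0 dD cD b; case: (half_plane _ c b).
have n12 : (size (half_plane (deg D) c true)).-1 + (size (half_plane (deg D) c false)).-1 =
   deg D1 + deg D2 by move: sz; rewrite (H true) (H false) degD /=; lia.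
rewrite (pair_sum _ _ _ _ (d true) (d false)); last by rewrite n12; lia.
rewrite -/(R true) -/(R false) /split_by -/(R true) -/(R false) natrD.
(* [B] is the degenerate summand of [pair_sum], and [B'] is what [c] contributes to the subtracted
   product. *)
set B := (X in (_ + X - _)%R); set B' := (X in (_ - X)%R); suff -> : B = B' by rewrite addrK.
rewrite /B /B'.
have dt : diagram _ (R true) := d true; have df : diagram _ (R false) := d false.
have E0 m (T : chords) : diagram m T -> (T == fset0) = (m == 0).
  by case=> _ _ <-; rewrite cardfs_eq0.
have nz (F : dissection) : (fset0 == dchords F) = false.
  by rewrite eq_sym; apply/negbTE; case/andP: (valP F).
rewrite (eq_bigr (fun E : dissection => if (R true == dchords E) && (R false == fset0) ||
   (R true == fset0) && (R false == dchords E) then x ^+ kexp D [fset c] *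
   coef_chords x (ucm D1) (dchords D2) (dchords E) else 0)%R); last first.
  by move=> E _; rewrite (qpart1 dD cD) (mul_diagram_monom_eq _ dt df).
pose G E := (x ^+ kexp D [fset c] * coef_chords x (ucm D1) (dchords D2) E)%R.
case: (eqVneq (R false) fset0) => [Rf|Rf0].
  rewrite Rf; transitivity (G (R true)) => //.
  move: n12; rewrite (eqP (etrans (esym (E0 _ _ df)) (introT eqP Rf))) addn0 => n12.
  have pos : 0 < deg D1 + deg D2 by rewrite addn_gt0 n10.
  have := sum_dissections G dt pos; rewrite n12 eqxx => <-; apply: eq_bigr => E _.
  by rewrite nz andbT andbF orbF.
case: (eqVneq (R true) fset0) => [Rt|Rt0].
  rewrite Rt; transitivity (G (R false)) => //.
  move: n12; rewrite (eqP (etrans (esym (E0 _ _ dt)) (introT eqP Rt))) add0n => n12.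
  have pos : 0 < deg D1 + deg D2 by rewrite addn_gt0 n10.
  have := sum_dissections G df pos; rewrite n12 eqxx => <-; apply: eq_bigr => E _.
  by rewrite nz.
by rewrite mulr0 big1 // => E _; rewrite andbF.
Qed.

End Coefficients.

(** * Insertion of a chord in two diagrams *)

(* [before i w w'] : w is met before w' in the sequence i-1, ..., 0, n, ..., i+1. *)
Definition before i : rel nat :=
  fun w w' => [|| w' < w < i, w < i < w' | i < w' < w].

Lemma before_trans i : transitive (before i).
Proof. by move=> y x z; rewrite /before; lia. Qed.

Lemma mem_neighbours E i w : in_range (deg E) E ->
  (w \in neighbours E i) = (w != i) && (chord i w \in E).
Proof.
move=> rE; rewrite mem_filter mem_cat !mem_rev !mem_iota andbC.
case iE: (chord i w \in E); rewrite ?andbF // !andbT.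
by have := rE _ iE; rewrite /chord /=; lia.
Qed.

Lemma sorted_neighbours E i : sorted (before i) (neighbours E i).
Proof.
apply: (sorted_filter (@before_trans i)).
have rsort a m : pairwise (fun x y => y < x) (rev (iota a m)).
  rewrite -sorted_pairwise; last by move=> y x z /= ? ?; lia.
  by rewrite rev_sorted iota_ltn_sorted.
rewrite sorted_pairwise; last exact: before_trans.
rewrite pairwise_cat; apply/and3P; split.
- apply/allrelP => x y; rewrite !mem_rev !mem_iota /before; lia.
- apply: (sub_in_pairwise (P := fun x => x < i)) (rsort 0 i) => [x y /= xi yi|].
    by rewrite /before; lia.
  by apply/allP => x; rewrite mem_rev mem_iota.
- apply: (sub_in_pairwise (P := fun x => i < x)) (rsort i.+1 _) => [x y /= xi yi|].
    by rewrite /before; lia.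
  by apply/allP => x; rewrite mem_rev mem_iota => /andP[].
Qed.

Lemma neighbours_uniq E i : uniq (neighbours E i).
Proof.
apply: (sorted_uniq (@before_trans i)) (sorted_neighbours E i).
by move=> x; rewrite /before; lia.
Qed.

Lemma fertilityE E i : in_range (deg E) E -> fertility E i = size (neighbours E i).
Proof.
move=> rE; rewrite /fertility -(size_map (chord i)).
have ci_inj : {in neighbours E i &, injective (chord i)}.
  move=> w z; rewrite !mem_neighbours // => /andP[wi _] /andP[zi _] /eqP.
  by rewrite chord_eqE; lia.
have un : uniq [seq chord i w | w <- neighbours E i].
  by rewrite map_inj_in_uniq ?neighbours_uniq.
apply/eqP; rewrite -(uniq_size_uniq un) ?fset_uniq // => c.
rewrite !inE; apply/mapP/andP => [[w]|[cE ci]].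
  rewrite mem_neighbours // => /andP[wi wE] ->; rewrite wE; split=> //.
  by rewrite /chord /=; lia.
have rc : c.1 < c.2 <= deg E := rE c cE.
exists (if c.1 == i then c.2 else c.1).
  rewrite mem_neighbours // (_ : chord _ _ = c) ?cE ?andbT; first by case: ifP; lia.
  by case: c ci rc {cE} => a b /=; rewrite /chord => ab ci; congr (_, _); case: ifP; lia.
by case: c ci rc {cE} => a b /=; rewrite /chord => ab ci; congr (_, _); case: ifP; lia.
Qed.

Lemma take_count (r : rel nat) (P : pred nat) s : pairwise r s ->
  {in s &, forall a b, r a b -> P b -> P a} -> take (count P s) s = filter P s.
Proof.
elim: s => //= a s IHs /andP[ra rs] H.
case Pa: (P a) => /=; first by rewrite IHs // => b c bs cs; apply: H; rewrite inE ?bs ?cs orbT.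
have nP : {in s, forall b, ~~ P b}.
  move=> b bs; apply: contraFN Pa; apply: H; rewrite ?inE ?eqxx ?bs ?orbT //.
  exact: (allP ra).
rewrite (count_none nP) /=; apply/esym/eqP; rewrite -size_eq0 size_filter.
by rewrite (count_none nP).
Qed.

(** A set of chords at [i] closed under predecessors is an initial segment, which is the form in
    which the insertions distribute chords. *)
Lemma take_count_neighbours E i (P : pred nat) :
  {in neighbours E i &, forall a b, before i a b -> P b -> P a} ->
  {in neighbours E i, P =1 first_chords E (count P (neighbours E i)) i}.
Proof.
move=> H w wW; rewrite /first_chords (take_count (r := before i)) //.
  by rewrite mem_filter wW andbT.
by rewrite -sorted_pairwise ?sorted_neighbours //; exact: before_trans.
Qed.

Lemma count_first_chords E i t : t <= size (neighbours E i) ->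
  count (first_chords E t i) (neighbours E i) = t.
Proof.
move=> tle; rewrite -[in LHS](cat_take_drop t (neighbours E i)) count_cat.
have := neighbours_uniq E i; rewrite -{1}(cat_take_drop t (neighbours E i)) cat_uniq.
case/and3P=> _ /hasPn dis _.
rewrite (_ : count _ (take t _) = t); last first.
  by rewrite -[RHS](size_takel tle); apply/eqP; rewrite -all_count; apply/allP.
by rewrite count_none ?addn0 // => w /dis.
Qed.

Section Gamma.
Variables (A B : chords) (j : nat).
Hypotheses (dA : diagram (deg A) A) (dB : diagram (deg B) B) (jB : j <= deg B).

Local Notation nA := (deg A).
Local Notation nB := (deg B).
Local Notation N := (nA + nB).+1.
Local Notation v := (j + nA + 1).
Local Notation c := (j, v).
Local Notation H b := (half_plane N c b).

Let rA : in_range nA A. Proof. by have [[]] := dA. Qed.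
Let rB : in_range nB B. Proof. by have [[]] := dB. Qed.
Let vN : v <= N. Proof. lia. Qed.

(** [A] goes on the arc of the inserted chord and [B] outside it. Here [j = 0] is allowed, so that
    the root insertions are covered as well, by [GammaR_true] and [GammaR_false]. *)
Definition inner_vertex t u w :=
  if 0 < u then u + j else if first_chords A t 0 w then v else j.

Definition outer_vertex tau u w :=
  if u < j then u else if j < u then u + nA + 1
  else if first_chords B tau j w then j else v.

Definition inner t d := chord (inner_vertex t d.1 d.2) (inner_vertex t d.2 d.1).
Definition outer tau d := chord (outer_vertex tau d.1 d.2) (outer_vertex tau d.2 d.1).

Lemma mem_GammaV t tau d : (d \in GammaV t j tau A B) =
  [|| d == c, d \in outer tau @` B | d \in inner t @` A].
Proof. by rewrite /GammaV !in_fsetU in_fset1 chord_span -orbA. Qed.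

Lemma half_true : H true = iota j nA.+1.
Proof.
apply: eq_sorted_ltn; [exact: sorted_half_plane|exact: iota_ltn_sorted|].
by move=> i; rewrite mem_half_plane mem_iota /side_in /=; lia.
Qed.

Lemma size_half_true : size (H true) = nA.+1.
Proof. by rewrite half_true size_iota. Qed.

Lemma size_half_false : size (H false) = nB.+1.
Proof. by have := size_halves N c; rewrite size_half_true; lia. Qed.

Lemma contract_true w : contract (H true) w = minn (w - j) nA.+1 %% nA.+1.
Proof. by rewrite /contract half_true count_ltn_iota size_iota. Qed.

Lemma contract_false w :
  contract (H false) w = (minn w N.+1 - minn (w - j) nA.+1) %% nB.+1.
Proof.
rewrite /contract size_half_false; congr (_ %% _).
have <- : count (fun s => s < w) (H true) = minn (w - j) nA.+1.
  by rewrite half_true count_ltn_iota.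
have <- : count (fun s => s < w) (iota 0 N.+1) = minn w N.+1.
  by rewrite count_ltn_iota subn0.
have E s : count (fun s => s < w) [seq i <- s | side_in c i == true] +
    count (fun s => s < w) [seq i <- s | side_in c i == false] = count (fun s => s < w) s.
  by elim: s => //= i s; case: (side_in c i) => /=; lia.
by rewrite -(E (iota 0 N.+1)) addKn.
Qed.

Lemma contract_inner t u w : u <= nA -> contract (H true) (inner_vertex t u w) = u.
Proof.
move=> uA; rewrite contract_true /inner_vertex; case: ifP => u0.
  by rewrite modn_small; lia.
rewrite (_ : u = 0); last by lia.
case: ifP => _; last by rewrite subnn min0n mod0n.
by rewrite (_ : minn _ _ = nA.+1) ?modnn //; lia.
Qed.

Lemma contract_outer tau u w : u <= nB -> contract (H false) (outer_vertex tau u w) = u.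
Proof.
move=> uB; rewrite contract_false /outer_vertex.
by case: ifP; [|case: ifP; [|case: ifP]] => *; rewrite modn_small; lia.
Qed.

Lemma image_inner t d : d \in A -> image_chord (H true) (inner t d) = d.
Proof.
move=> dA'; have rd : d.1 < d.2 <= nA := rA dA'.
have [le1 le2] : d.1 <= nA /\ d.2 <= nA by lia.
rewrite /image_chord /inner /chord /=.
by case: leqP => _; rewrite !contract_inner //; case: d rd {le1 le2 dA'} => a b /= ab;
   congr (_, _); lia.
Qed.

Lemma image_outer tau d : d \in B -> image_chord (H false) (outer tau d) = d.
Proof.
move=> dB'; have rd : d.1 < d.2 <= nB := rB dB'.
have [le1 le2] : d.1 <= nB /\ d.2 <= nB by lia.
rewrite /image_chord /outer /chord /=.
by case: leqP => _; rewrite !contract_outer //; case: d rd {le1 le2 dB'} => a b /= ab;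
   congr (_, _); lia.
Qed.

Lemma chord_le u w : (chord u w).1 <= (chord u w).2.
Proof. by rewrite /chord /=; lia. Qed.

Lemma cuts_inner t d : d \in A -> cuts (H true) (inner t d).
Proof.
move=> dA'; have rd : d.1 < d.2 <= nA := rA dA'.
by rewrite -image_chord_loop ?image_inner ?sorted_half_plane ?chord_le //; lia.
Qed.

Lemma cuts_outer tau d : d \in B -> cuts (H false) (outer tau d).
Proof.
move=> dB'; have rd : d.1 < d.2 <= nB := rB dB'.
by rewrite -image_chord_loop ?image_outer ?sorted_half_plane ?chord_le //; lia.
Qed.

Lemma not_cuts_inner t d : d \in A -> ~~ cuts (H false) (inner t d).
Proof.
move=> dA'; have rd : d.1 < d.2 <= nA := rA dA'.
apply/cutsPn => i k; rewrite !mem_half_plane /side_in /inner /inner_vertex /chord /=.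
by do ?case: ifP; lia.
Qed.

Lemma not_cuts_outer tau d : d \in B -> ~~ cuts (H true) (outer tau d).
Proof.
move=> dB'; have rd : d.1 < d.2 <= nB := rB dB'.
apply/cutsPn => i k; rewrite !mem_half_plane /side_in /outer /outer_vertex /chord /=.
by do ?case: ifP; lia.
Qed.

Lemma restrict_GammaV_true t tau : restrict (H true) (GammaV t j tau A B) = A.
Proof.
apply/fsetP => e; apply/mem_restrict/idP => [[d]|eA].
  rewrite mem_GammaV => /or3P[/eqP->|/imfsetP[f /= fB ->]|/imfsetP[f /= fA ->]] [].
  - by rewrite (negPf (not_cuts_half _ _ _)).
  - by rewrite (negPf (not_cuts_outer _ fB)).
  - by rewrite image_inner // => _ ->.
exists (inner t e); last by rewrite image_inner // cuts_inner.
by rewrite mem_GammaV; apply/or3P/Or33/imfsetP; exists e.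
Qed.

Lemma restrict_GammaV_false t tau : restrict (H false) (GammaV t j tau A B) = B.
Proof.
apply/fsetP => e; apply/mem_restrict/idP => [[d]|eB].
  rewrite mem_GammaV => /or3P[/eqP->|/imfsetP[f /= fB ->]|/imfsetP[f /= fA ->]] [].
  - by rewrite (negPf (not_cuts_half _ _ _)).
  - by rewrite image_outer // => _ ->.
  - by rewrite (negPf (not_cuts_inner _ fA)).
exists (outer tau e); last by rewrite image_outer // cuts_outer.
by rewrite mem_GammaV; apply/or3P/Or32/imfsetP; exists e.
Qed.

Lemma c_in_GammaV t tau : c \in GammaV t j tau A B.
Proof. by rewrite mem_GammaV eqxx. Qed.

(** Contraction to the halves inverts the two vertex maps, and the three parts of the union are
    disjoint because they cut different halves. *)
Lemma deg_GammaV t tau : deg (GammaV t j tau A B) = N.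
Proof.
have inj1 : {in A &, injective (inner t)}.
  by move=> d e dA' eA' /(congr1 (image_chord (H true))); rewrite !image_inner.
have inj2 : {in B &, injective (outer tau)}.
  by move=> d e dB' eB' /(congr1 (image_chord (H false))); rewrite !image_outer.
rewrite /deg /GammaV chord_span -fsetUA cardfsU1 cardfsU.
rewrite -[map_chords _ B]/(outer tau @` B) -[map_chords _ A]/(inner t @` A).
have -> : outer tau @` B `&` inner t @` A = fset0.
  apply/fsetP => e; rewrite !inE; apply/negP => /andP[/imfsetP[d /= dB' ->]].
  case/imfsetP => f /= fA E; have := not_cuts_outer tau dB'.
  by rewrite E cuts_inner.
have -> : c \notin outer tau @` B `|` inner t @` A.
  rewrite !inE; apply/norP; split; apply/imfsetP => -[d /= dX E].
    by have := not_cuts_half N c false; rewrite {2}E cuts_outer.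
  by have := not_cuts_half N c true; rewrite {2}E cuts_inner.
by rewrite cardfs0 !card_in_imfset //= subn0 add1n addnC.
Qed.

End Gamma.

Section Classification.
Variables (A B : chords) (j : nat).
Hypotheses (dA : diagram (deg A) A) (dB : diagram (deg B) B) (jB : j <= deg B).

Local Notation nA := (deg A).
Local Notation nB := (deg B).
Local Notation N := (nA + nB).+1.
Local Notation v := (j + nA + 1).
Local Notation c := (j, v).
Local Notation H b := (half_plane N c b).

Let rA : in_range nA A. Proof. by have [[]] := dA. Qed.
Let rB : in_range nB B. Proof. by have [[]] := dB. Qed.

Definition shift w := if w < j then w else w + nA + 1.

(** The end of the inserted chord to which a root chord of [A] is attached is visible in the result.
    Counting therefore recovers [t], and [outer_kept] does the same for [tau], so different
    parameters give different sets of chords. *)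
Lemma inner_moved t tau w : w \in neighbours A 0 ->
  (chord (w + j) v \in GammaV t j tau A B) = first_chords A t 0 w.
Proof.
rewrite mem_neighbours // => /andP[w0 wA].
have wn : w <= nA by have := rA wA; rewrite /chord /=; lia.
rewrite mem_GammaV //; apply/idP/idP =>
  [/or3P[/eqP E|/imfsetP[[a b] /= abB E]|/imfsetP[[a b] /= abA E]]|fw].
- by move: E; rewrite /chord => -[]; lia.
- have rd : a < b <= nB := rB abB; move: E => /eqP.
  by rewrite chord_eqE /outer_vertex /=; do ?case: ifP; lia.
- have rd : a < b <= nA := rA abA; move: E => /eqP.
  have b0 : 0 < b by lia.
  rewrite chord_eqE /inner_vertex /= b0; case: (ltnP 0 a) => a0 /=; first by lia.
  case: ifP => f E; last by lia.
  by have -> : w = b by lia.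
apply/or3P/Or33/imfsetP; exists (chord 0 w) => //=.
rewrite /inner /chord /= min0n max0n /inner_vertex /= lt0n w0 fw.
by congr (_, _); lia.
Qed.

Lemma outer_at tau w : w != j -> outer A B j tau (chord j w) =
  chord (if first_chords B tau j w then j else v) (shift w).
Proof.
rewrite neq_ltn /shift => /orP[lt|lt].
  have -> : chord j w = (w, j) by rewrite /chord; congr (_, _); lia.
  by rewrite /outer /outer_vertex /= lt ltnn chordC.
have -> : chord j w = (j, w) by rewrite /chord; congr (_, _); lia.
have wj : (w < j) = false by apply/negbTE; rewrite -leqNgt ltnW.
by rewrite /outer /outer_vertex /= lt wj ltnn.
Qed.

Lemma outer_kept t tau w : w \in neighbours B j ->
  (chord j (shift w) \in GammaV t j tau A B) = first_chords B tau j w.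
Proof.
rewrite mem_neighbours // => /andP[wj wB].
rewrite mem_GammaV //; apply/idP/idP =>
  [/or3P[/eqP E|/imfsetP[[a b] /= abB E]|/imfsetP[[a b] /= abA E]]|fw].
- by move: E; rewrite /chord /shift => -[]; case: ifP; lia.
- have rd : a < b <= nB := rB abB; move: E => /eqP.
  rewrite chord_eqE /outer_vertex /shift /=.
  case: (ltngtP a j) => aj; case: (ltngtP b j) => bj; try by [lia|case: ifP; lia].
  + case f: (first_chords B tau j a); last by case: ifP; lia.
    by move=> E; have -> : w = a by move: E; case: ifP; lia.
  + case f: (first_chords B tau j b); last by case: ifP; lia.
    by move=> E; have -> : w = b by move: E; case: ifP; lia.
- have rd : a < b <= nA := rA abA; move: E => /eqP.
  by rewrite chord_eqE /inner_vertex /shift /=; do ?case: ifP; lia.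
apply/or3P/Or32/imfsetP; exists (chord j w) => //=.
by rewrite outer_at // fw.
Qed.

Lemma count_inner_moved t tau : t <= size (neighbours A 0) ->
  count (fun w => chord (w + j) v \in GammaV t j tau A B) (neighbours A 0) = t.
Proof.
move=> tle; rewrite -[RHS](count_first_chords tle).
by apply: eq_in_count => w wW; exact: inner_moved.
Qed.

Lemma count_outer_kept t tau : tau <= size (neighbours B j) ->
  count (fun w => chord j (shift w) \in GammaV t j tau A B) (neighbours B j) = tau.
Proof.
move=> tle; rewrite -[RHS](count_first_chords tle).
by apply: eq_in_count => w wW; exact: outer_kept.
Qed.

Section Converse.
Variable D : chords.
Hypotheses (dD : diagram N D) (cD : c \in D).
Hypotheses (DA : restrict (H true) D = A) (DB : restrict (H false) D = B).

Let rD : in_range N D. Proof. by have [[]] := dD. Qed.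
Let xD : {in D &, forall d e, ~~ crossing d e}. Proof. by have [[]] := dD. Qed.

Let t := count (fun w => chord (w + j) v \in D) (neighbours A 0).
Let tau := count (fun w => chord j (shift w) \in D) (neighbours B j).

(** A chord that cuts the inner half without crossing [c] has both ends between [j] and [v]; as [v]
    contracts to 0, a chord ending there becomes a root chord of [A]. *)
Lemma inner_image d : d \in D -> cuts (H true) d ->
  [/\ j <= d.1, d.2 < v & image_chord (H true) d = (d.1 - j, d.2 - j)] \/
  [/\ j < d.1, d.2 = v & image_chord (H true) d = (0, d.1 - j)].
Proof.
move=> dD' db; have rd : d.1 < d.2 <= N := rD dD'; have xd := xD dD' cD; have xd' := xD cD dD'.
have lo : j <= d.1 /\ d.2 <= v.
  case/cutsP: db => i [k []]; rewrite !mem_half_plane.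
  by move: xd xd'; rewrite /crossing /side_in /=; lia.
have dc : d != c by apply: contraTneq db => ->; exact: not_cuts_half.
have E w : w < v -> contract (H true) w = w - j.
  by move=> wv; rewrite contract_true // modn_small; lia.
have Ev : contract (H true) v = 0.
  by rewrite contract_true // (_ : minn _ _ = nA.+1) ?modnn //; lia.
case: (ltnP d.2 v) => d2v; [left|right].
  by split=> //; [lia|rewrite /image_chord /chord !E; [congr (_, _)|..]; lia].
have d2 : d.2 = v by lia.
have d1 : j < d.1.
  rewrite ltn_neqAle lo.1 andbT; apply: contraNneq dc => d1.
  by case: (d) d1 d2 => a b /= <- ->.
by split=> //; rewrite /image_chord d2 Ev E; [rewrite /chord minn0 maxn0|lia].
Qed.

Lemma outer_image d : d \in D -> cuts (H false) d ->
  let q w := if w <= j then w else w - nA.+1 in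
  [/\ d.1 <= j \/ v <= d.1, d.2 <= j \/ v <= d.2, q d.1 < q d.2 <= nB
    & image_chord (H false) d = (q d.1, q d.2)].
Proof.
move=> dD' db q; have rd : d.1 < d.2 <= N := rD dD'; have xd := xD dD' cD; have xd' := xD cD dD'.
have [lo1 lo2] : (d.1 <= j \/ v <= d.1) /\ (d.2 <= j \/ v <= d.2).
  case/cutsP: db => i [k []]; rewrite !mem_half_plane.
  by move: xd xd'; rewrite /crossing /side_in /=; lia.
have dc : d != c by apply: contraTneq db => ->; exact: not_cuts_half.
have E w : w <= N -> w <= j \/ v <= w -> contract (H false) w = q w.
  by move=> wN wj; rewrite contract_false // /q; case: ifP => ?; rewrite modn_small; lia.
have lt : q d.1 < q d.2 <= nB.
  have ne : d.1 = j -> d.2 = v -> False.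
    by move=> d1 d2; case/eqP: dc; case: (d) d1 d2 => a b /= -> ->.
  by rewrite /q; case: ifP; case: ifP; lia.
split=> //; rewrite /image_chord !E //; [|lia|lia].
by rewrite /chord; congr (_, _); lia.
Qed.

Lemma inner_origin w : w \in neighbours A 0 ->
  (chord (w + j) v \in D) || (chord j (w + j) \in D).
Proof.
rewrite mem_neighbours // => /andP[w0 wA].
have /mem_restrict[d dD' [db]] : chord 0 w \in restrict (H true) D by rewrite DA.
rewrite {1}/chord min0n max0n => E; have rd : d.1 < d.2 <= N := rD dD'.
case: (inner_image dD' db) => -[d1 d2]; rewrite -E => -[];
  case: d dD' rd d1 d2 {db E} => a b /= dD' rd d1 d2.
  move=> e1 e2; apply/orP; right; rewrite (_ : chord _ _ = (a, b)) //.
  by rewrite /chord; congr (_, _); lia.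
move=> e1; apply/orP; left; rewrite (_ : chord _ _ = (a, b)) //.
by rewrite /chord; congr (_, _); lia.
Qed.

Lemma outer_origin w : w \in neighbours B j ->
  (chord j (shift w) \in D) || (chord v (shift w) \in D).
Proof.
rewrite mem_neighbours // => /andP[wj wB].
have /mem_restrict[d dD' [db]] : chord j w \in restrict (H false) D by rewrite DB.
have [lo1 lo2 lt ->] := outer_image dD' db.
have rd : d.1 < d.2 <= N := rD dD'; case: d dD' {db} lo1 lo2 lt rd => a b /= dD' lo1 lo2 lt rd.
rewrite /chord => -[e1 e2].
have : (minn j (shift w), maxn j (shift w)) = (a, b) \/
       (minn v (shift w), maxn v (shift w)) = (a, b).
  have [ajv|ajv] : (a == j) || (b == j) \/ ~~ ((a == j) || (b == j)) by lia.
    by left; move: e1 e2 lt; rewrite /shift; do ?case: ifP => ?; move=> *; congr (_, _); lia.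
  by right; move: e1 e2 lt; rewrite /shift; do ?case: ifP => ?; move=> *; congr (_, _); lia.
by case=> ->; rewrite dD' ?orbT.
Qed.

(** A chord attached to [v] that came after one attached to [j] would cross it, so the moved chords
    come first. *)
Lemma inner_first : {in neighbours A 0, forall w,
  (chord (w + j) v \in D) = first_chords A t 0 w}.
Proof.
apply: take_count_neighbours => a b aW bW ab Pb.
case/orP: (inner_origin aW) => // Qa; have := xD Qa Pb; move: ab aW bW.
rewrite !mem_neighbours // => ab /andP[a0 aA] /andP[b0 bA].
have := rA aA; have := rA bA; move: ab a0 b0.
by rewrite /before /crossing /chord /=; lia.
Qed.

Lemma outer_first : {in neighbours B j, forall w,
  (chord j (shift w) \in D) = first_chords B tau j w}.
Proof.
apply: take_count_neighbours => a b aW bW ab Qb.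
case/orP: (outer_origin aW) => // Pa; have := xD Qb Pa; have := xD Pa Qb; move: ab.
by rewrite /before /crossing /chord /shift /=; do ?case: ifP; lia.
Qed.

Lemma inner_root w : 0 < w ->
  inner A j t (0, w) = chord (w + j) (if first_chords A t 0 w then v else j).
Proof. by move=> w0; rewrite /inner /inner_vertex /= w0 chordC. Qed.

(** One inclusion is enough, since both sets have [N] chords. *)
Lemma GammaV_sub : GammaV t j tau A B `<=` D.
Proof.
apply/fsubsetP => e; rewrite mem_GammaV //.
case/or3P => [/eqP->//|/imfsetP[f /= fB ->]|/imfsetP[f /= fA ->]].
  have at_j w : w != j -> chord j w \in B -> outer A B j tau (chord j w) \in D.
    move=> wj wB; have wW : w \in neighbours B j by rewrite mem_neighbours // wj.
    have := outer_origin wW; rewrite outer_at // -outer_first //.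
    by case: ifP => //= ->.
  case: f fB => a b abB; have rd : a < b <= nB := rB abB.
  case: (eqVneq a j) => aj.
    have E : (a, b) = chord j b by rewrite /chord; congr (_, _); lia.
    by rewrite E at_j -?E //; lia.
  case: (eqVneq b j) => bj.
    have E : (a, b) = chord j a by rewrite /chord; congr (_, _); lia.
    by rewrite E at_j -?E.
  have /mem_restrict[d dD' [db]] : (a, b) \in restrict (H false) D by rewrite DB.
  have [lo1 lo2 lt ->] := outer_image dD' db.
  have rd' : d.1 < d.2 <= N := rD dD'.
  case: d dD' {db} lo1 lo2 lt rd' => a' b' /= dD' lo1 lo2 lt rd' -[ea eb].
  rewrite (_ : outer _ _ _ _ _ = (a', b')) //.
  rewrite /outer /outer_vertex /chord /=; move: ea eb lt.
  clear -aj bj lo1 lo2 rd rd'.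
  by do ?case: ifP => ?; move=> *; congr (_, _); lia.
case: f fA => a b abA; have rd : a < b <= nA := rA abA.
have /mem_restrict[d dD' [db]] : (a, b) \in restrict (H true) D by rewrite DA.
case: (posnP a) => a0.
  have wW : b \in neighbours A 0.
    by rewrite mem_neighbours // /chord min0n max0n -a0 abA andbT; lia.
  move=> _; rewrite a0 inner_root -?inner_first //=; last by lia.
  by have := inner_origin wW; case: ifP => //= _; rewrite chordC.
have rd' : d.1 < d.2 <= N := rD dD'.
case: (inner_image dD' db) => -[d1 d2 ->] [ea eb]; last by lia.
rewrite (_ : inner _ _ _ _ = d) //.
case: d {db} dD' d1 d2 ea eb rd' => a' b' /= *.
rewrite /inner /inner_vertex /chord /= !ifT; [congr (_, _)|..]; lia.
Qed.

Lemma GammaV_eq : GammaV t j tau A B = D.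
Proof.
apply/eqP; rewrite eqEfcard GammaV_sub /=; have [_ _ ->] := dD.
by rewrite -/(deg (GammaV t j tau A B)) deg_GammaV.
Qed.

End Converse.
End Classification.

(** * The exponent of the inserted chord *)

Lemma parent_exists n E i : diagram n E -> 0 < i <= n ->
  exists w, [/\ w != i, chord i w \in E & towards E i w].
Proof.
move=> dE /andP[i0 ilen]; have [[rE _] _ _] := dE.
have gE := connect_preserved (inord i : 'I_n.+1) rE.
have lti : i < n.+1 by [].
have iv : (inord i : 'I_n.+1) = i :> nat by rewrite inordK.
have : connect (@ord_adj n E) (inord i) (inord 0).
  have := diagram_connected dE gE (leq0n n); have := diagram_connected dE gE ilen.
  by rewrite connect0 => <-.
case/connectP => p0 /shortenP[[|w p] pp pu _] p0E {p0}.
  by move: p0E => /(congr1 val); rewrite /= iv inordK // => i0'; rewrite -i0' in i0.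
move: pp => /= /andP[iw pp]; rewrite /ord_adj iv in iw.
have iwE : chord i w \in E by case/andP: iw.
have wi : val w != i by case/andP: iw; rewrite eq_sym.
exists (val w); split=> //.
have [q [r dqr]] := dual_exists dE iwE; have [qn rn cqr _] := dqr.
have wn : w <= n by rewrite -ltnS.
rewrite (towardsE dE ilen wn iwE dqr).
have gP := dual_colour_preserved rE dqr.
have pE : path (adj E) w [seq val k | k <- p] by rewrite path_map.
have nip : i \notin val w :: [seq val k | k <- p].
  by move: pu; rewrite /= => /andP[+ _]; rewrite -{2}iv -map_cons mem_map //; exact: val_inj.
(* The path goes on from [w] to the root without returning to [i], hence without the chord [iw]; so
   [w] is on the side of the root. *)
have g0 : dual_colour q r w = false.
  have <- := preserved_path gP (path_adjD1 (val w) nip pE) (mem_last _ _).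
  by move: p0E => /= p0E; rewrite last_map -p0E inordK // /dual_colour; lia.
have := dual_colour_cut (rE _ iwE) qn rn cqr.
by rewrite /chord /=; case: (leqP i w) => _; rewrite g0; case: dual_colour.
Qed.

(** For [j = 0] the arc of the inserted chord is an initial segment of the sides, so its dual side
    on the arc is the smaller one before and after contraction. *)
Lemma kexp_GammaV0 A B t tau : diagram (deg A) A -> diagram (deg B) B ->
  diagram (deg A + deg B).+1 (GammaV t 0 tau A B) ->
  kexp (GammaV t 0 tau A B) [fset (0, 0 + deg A + 1)] = 0.
Proof.
move=> dA dB dG; have cG : (0, 0 + deg A + 1) \in GammaV t 0 tau A B by exact: c_in_GammaV.
have [p [q dpq]] := dual_exists dG cG; have [pn qn cpq _] := dpq.
rewrite (kexp1 dG cG dpq); move: cpq; rewrite /side_in /=; lia.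
Qed.

(** The chord [(a, b)] of [B] becomes [(a', b')] when [n + 1] sides are inserted at vertex [j]; [p]
    is an inserted side, and [q] is an old one with former number [s]. A chord leaving [p'] and [q']
    together but separating them from an [s] beyond them would end up separating [q] from [p]. *)
Lemma outer_side_arith (a b a' b' j n p q p' q' s : nat) :
    a < b -> p' < j -> j <= q' -> j <= p < j + n + 1 -> ~~ (j <= q < j + n + 1) ->
    s = (if q < j then q else q - n.+1) ->
    (a < j -> a' = a) -> (j < a -> a' = a + n + 1) -> (a = j -> a' = j \/ a' = j + n + 1) ->
    (b < j -> b' = b) -> (j < b -> b' = b + n + 1) -> (b = j -> b' = j \/ b' = j + n + 1) ->
    (a' <= q < b') = (a' <= p < b') ->
    (a <= s < b) != (a <= p' < b) -> (a <= p' < b) = (a <= q' < b) ->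
  (s < p') && (q < j) || (q' < s) && (j <= q) -> False.
Proof.
move=> ab pj jq hp hq ->.
by case: (ltnP q j) => qj; case: (ltngtP a j) => aj; case: (ltngtP b j) => bj; lia.
Qed.

(** Side 0 is off the arc of the inserted chord, so the exponent asks whether the dual side [p] on
    the arc precedes the dual side [q] off it. The chord labelled [j] must not separate [p] from
    [q]; the end to which it is attached therefore decides on which side of [j] the side [q]
    lies. *)
Lemma kexp_GammaV A B j t tau : diagram (deg A) A -> diagram (deg B) B ->
  0 < j <= deg B -> diagram (deg A + deg B).+1 (GammaV t j tau A B) ->
  kexp (GammaV t j tau A B) [fset (j, j + deg A + 1)] = (label_index B j <= tau).
Proof.
move=> dA dB /andP[j0 jB] dG.
have cG : (j, j + deg A + 1) \in GammaV t j tau A B by exact: c_in_GammaV.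
have [p [q [dpq cp cq]]] : exists p q, [/\ dual (deg A + deg B).+1 (GammaV t j tau A B)
    (j, j + deg A + 1) p q, side_in (j, j + deg A + 1) p & ~~ side_in (j, j + deg A + 1) q].
  have [p [q dpq]] := dual_exists dG cG; have [_ _ cpq _] := dpq.
  case cp: (side_in (j, j + deg A + 1) p) cpq => cpq; first by exists p, q; split.
  by exists q, p; split; [exact: dual_sym| |rewrite cp]; move: cpq; case: side_in.
have [pn qn _ _] := dpq; have [[rB _] sB _] := dB.
have c0 : side_in (j, j + deg A + 1) 0 = false by rewrite /side_in /= leqNgt j0.
have -> : kexp (GammaV t j tau A B) [fset (j, j + deg A + 1)] = (p < q).
  by rewrite (kexp1 dG cG dpq) cp c0; case: (p < q).
congr nat_of_bool.
have rBd : in_range (deg B) B by [].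
set W := neighbours B j.
have hasW : has (towards B j) W.
  have [w [wj wB tw]] := parent_exists dB (introT andP (conj j0 jB)).
  by apply/hasP; exists w; rewrite // mem_neighbours // wj.
pose w := nth 0 W (find (towards B j) W).
have tw : towards B j w by exact: nth_find.
have wW : w \in W by rewrite mem_nth -?has_find.
have fw : first_chords B tau j w = (label_index B j <= tau).
  by rewrite /first_chords in_take // index_uniq ?neighbours_uniq -?has_find.
rewrite -fw; move: (wW); rewrite mem_neighbours // => /andP[wj wB].
have wn : w <= deg B by have := rBd _ wB; rewrite /chord /=; lia.
(* The chord points from [j] to the root, so [j] is on the arc of vertices cut off by its dual
   sides, from [p' + 1] to [q']. *)
have [p' [q' [dpq' p'j q'j]]] : exists p' q', [/\ dual (deg B) B (chord j w) p' q',
    p' < j & j <= q'].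
  have [p' [q' d']] := dual_exists dB wB; have [p'n q'n _ _] := d'.
  move: tw; rewrite (towardsE dB jB wn wB d') /dual_colour => tw.
  case: (ltnP p' q') => lt; first by exists p', q'; split=> //; lia.
  by exists q', p'; split; [exact: dual_sym|lia..].
have [p'n q'n wpq' _] := dpq'.
(* s is the side of B that the outer end q of the dual of c comes from *)
pose s := if q < j then q else q - (deg A).+1.
have lift e : e \in B -> side_in (outer A B j tau e) q = side_in (outer A B j tau e) p.
  move=> eB; symmetry; apply: (dual_other dpq).
    by rewrite mem_GammaV //; apply/or3P/Or32/imfsetP; exists e.
  apply/eqP => E; have := cuts_outer A dB jB tau eB; rewrite E.
  by rewrite (negPf (not_cuts_half _ _ _)).
have lw := lift _ wB; rewrite outer_at // in lw.
(* Distinct sides of [B] are separated by some chord of [B]; unless it is the chord labelled [j], it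
   leaves [p'] and [q'] together. *)
have sep a : a \in [:: p'; q'] -> s != a -> exists e, [/\ e \in B, e != chord j w &
    side_in e s != side_in e p' /\ side_in e p' = side_in e q'] \/
    side_in (chord j w) s != side_in (chord j w) a.
  move=> aP sa; have an : a <= deg B by move: aP; rewrite !inE => /orP[]/eqP->.
  have sn : s <= deg B.
    by move: cq; rewrite /s /side_in /=; clear -qn jB; case: ifP; lia.
  have [[e [eB es]]|] : (exists e, e \in B /\ side_in e s != side_in e a) \/ same_face B s a.
    case: (boolP (same_face B s a)) => [|/allPn[e eB es]]; [by right|left].
    by exists e.
  - exists e; case: (eqVneq e (chord j w)) => [<-|ew]; first by right.
    left; split=> //; have E := dual_other dpq' eB ew; split=> //.
    by move: aP es; rewrite !inE => /orP[]/eqP->; rewrite ?E.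
  by move/(sB _ _ sn an) => eq_sa; rewrite eq_sa eqxx in sa.
have no_sep e : e \in B -> side_in e s != side_in e p' -> side_in e p' = side_in e q' ->
    (s < p') && (q < j) || (q' < s) && (j <= q) -> False.
  case: e => a b eB; have /andP[ab _] : a < b <= deg B := rBd _ eB.
  have lt : outer_vertex A B j tau a b < outer_vertex A B j tau b a.
    rewrite /outer_vertex /=; clear -ab.
    by case: (ltngtP a j) => aj; case: (ltngtP b j) => bj; do ?case: ifP => _; lia.
  have := lift _ eB; rewrite /outer (chord_sort (ltnW lt)).
  move=> l; apply: (outer_side_arith ab p'j q'j cp cq (erefl s) _ _ _ _ _ _ l);
    rewrite /outer_vertex /=; clear -ab.
  - by move=> ->.
  - by move=> lt; rewrite ltnNge (ltnW lt) lt.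
  - by move=> ->; rewrite ltnn; case: ifP; [left|right].
  - by move=> ->.
  - by move=> lt; rewrite ltnNge (ltnW lt) lt.
  - by move=> ->; rewrite ltnn; case: ifP; [left|right].
case: (ltngtP w j) wj => // wlt _.
  have ew : chord j w = (w, j) by rewrite chordC chord_sort // ltnW.
  have sw : shift A j w = w by rewrite /shift wlt.
  rewrite ew in wpq' sep; rewrite sw in lw; case: first_chords lw => lw.
    have {}lw : side_in (w, j) q = side_in (w, j) p by rewrite -ew.
    (* Kept at [j], the chord [(w, j)] has [p] off its arc, hence [q] too. If [q] were below [j], it
       would lie before [w], thus before [p'], against [no_sep]. *)
    suff qj : ~~ (q < j) by move: cp cq; rewrite /side_in /=; clear -qj; lia.
    apply/negP => qj; have sE : s = q by rewrite /s qj.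
    have sq' : s != q' by rewrite sE; clear -qj q'j; lia.
    have := sep q'; rewrite !inE eqxx orbT => /(_ isT sq')[e [[eB _ [es e']]|]].
      apply: (no_sep e eB es e'); rewrite sE; move: lw wpq' cp cq.
      by rewrite /side_in /=; clear -qj p'j q'j; lia.
    by rewrite sE; move: lw wpq' cp cq; rewrite /side_in /=; clear -qj p'j q'j; lia.
  (* Moved to the upper end, the chord has [p] on its arc, hence also [q], which forces [q < j]. *)
  move: lw cp cq; rewrite chordC chord_sort; last by clear -wlt; lia.
  by rewrite /side_in /=; clear -wlt; lia.
(* The mirror case: now the kept chord has [p] on its arc and the moved one does not. *)
have ew : chord j w = (j, w) by rewrite chord_sort // ltnW.
have sw : shift A j w = w + deg A + 1 by rewrite /shift ltnNge (ltnW wlt).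
rewrite ew in wpq' sep; rewrite sw in lw; case: first_chords lw => lw.
  move: lw cp cq; rewrite chord_sort; last by clear -wlt; lia.
  by rewrite /side_in /=; clear -wlt; lia.
have {}lw : side_in (j + deg A + 1, w + deg A + 1) q = side_in (j + deg A + 1, w + deg A + 1) p.
  by move: lw; rewrite chord_sort //; clear -wlt; lia.
suff qj : q < j by move: cp cq; rewrite /side_in /=; clear -qj; lia.
rewrite ltnNge; apply/negP => qj; have sE : s = q - (deg A).+1 by rewrite /s ltnNge qj.
have sp' : s != p' by rewrite sE; move: cq; rewrite /side_in /=; clear -qj p'j; lia.
have := sep p'; rewrite !inE eqxx => /(_ isT sp')[e [[eB _ [es e']]|]].
  apply: (no_sep e eB es e'); rewrite sE; move: lw wpq' cp cq.
  by rewrite /side_in /=; clear -qj p'j q'j; lia.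
by rewrite sE; move: lw wpq' cp cq; rewrite /side_in /=; clear -qj p'j q'j; lia.
Qed.

(** * Comparison of the insertions with the cuts *)

Section Theta.
Variables (K : fieldType) (x : K).
Implicit Types A B : dissection.

Lemma vec_coef E (D : dissection) : ((vec K E)@_D = if E == dchords D then 1 else 0)%R.
Proof.
rewrite /vec; case: insubP => [F _ <-|nE].
  by rewrite mcoeffU; case: (F =P D) => [->|ne]; [rewrite eqxx|case: eqP => // /val_inj].
rewrite mcoeff0; case: eqP => // ED; case/negP: nE; rewrite ED; exact: (valP D).
Qed.

Lemma vec_diagram E : vec K E != 0%R -> diagram (deg E) E.
Proof.
rewrite /vec; case: insubP => [F _ <- _|_]; last by rewrite eqxx.
by have [] := diagram_dissection F.
Qed.

Definition cuts_into A B n D c :=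
  (restrict (half_plane n c true) D == dchords A) &&
  (restrict (half_plane n c false) D == dchords B).

(* Since vec vanishes off the dissection diagrams, the sets of chords GammaV need
   not be shown to be dissection diagrams. *)
Lemma sum_GammaV A B (D : dissection) j (y : K) : j <= deg B ->
  (\sum_(0 <= t < (fertility A 0).+1) \sum_(0 <= tau < (fertility B j).+1)
     (if GammaV t j tau A B == dchords D then y else 0) =
   if [&& deg D == (deg A + deg B).+1, (j, j + deg A + 1) \in dchords D
        & cuts_into A B (deg D) D (j, j + deg A + 1)] then y else 0)%R.
Proof.
move=> jB; have [[dA _] [dB _]] := (diagram_dissection A, diagram_dissection B).
have [dD _] := diagram_dissection D.
have [[[rA _] _ _] [[rB _] _ _]] := (dA, dB).
rewrite !fertilityE //; set c := (j, _).
case: ifP => [/and3P[/eqP degD cD /andP[/eqP DA /eqP DB]]|noD]; last first.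
  rewrite big1 // => t _; rewrite big1 // => tau _; case: eqP => // GD.
  have degD : deg D = (deg A + deg B).+1 by rewrite -GD deg_GammaV.
  move: noD; rewrite degD eqxx -GD c_in_GammaV // /cuts_into.
  by rewrite restrict_GammaV_true // restrict_GammaV_false // !eqxx.
rewrite degD in dD DA DB.
pose t0 := count (fun w => chord (w + j) (j + deg A + 1) \in dchords D) (neighbours A 0).
pose tau0 := count (fun w => chord j (shift A j w) \in dchords D) (neighbours B j).
have GE : GammaV t0 j tau0 A B = D := GammaV_eq dA dB jB dD cD DA DB.
have lt0 : t0 \in index_iota 0 (size (neighbours A 0)).+1.
  by rewrite mem_index_iota ltnS count_size.
have ltau0 : tau0 \in index_iota 0 (size (neighbours B j)).+1.
  by rewrite mem_index_iota ltnS count_size.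
rewrite -[RHS](sum2_delta true (fun _ _ => y) (iota_uniq _ _) (iota_uniq _ _) lt0 ltau0).
apply: eq_big_seq => t; rewrite mem_index_iota ltnS => tle.
apply: eq_big_seq => tau; rewrite mem_index_iota ltnS => taule; rewrite andbT.
suff -> : (GammaV t j tau A B == dchords D) = (t == t0) && (tau == tau0) by [].
apply/eqP/andP => [GD|[/eqP-> /eqP->]] //; split; apply/eqP.
  by rewrite -(count_inner_moved dA dB jB tau tle) GD.
by rewrite -(count_outer_kept dA dB jB t taule) GD.
Qed.

Lemma half_plane_iota n c : c.1 < c.2 <= n -> half_plane n c true = iota c.1 (c.2 - c.1).
Proof.
move=> rc; apply: eq_sorted_ltn; [exact: sorted_half_plane|exact: iota_ltn_sorted|].
by move=> i; rewrite mem_half_plane mem_iota /side_in; lia.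
Qed.

(** The arc of a chord that cuts off [A] carries [deg A + 1] sides, so its starting vertex [j]
    determines the chord. *)
Lemma sum_cuts_into A B (D : dissection) (F : nat * nat -> K) :
    deg D = (deg A + deg B).+1 ->
  (\sum_(c <- dchords D) (if cuts_into A B (deg D) D c then F c else 0) =
   \sum_(0 <= j < (deg B).+1)
     (if ((j, j + deg A + 1)%N \in dchords D) && cuts_into A B (deg D) D (j, j + deg A + 1)%N
      then F (j, j + deg A + 1)%N else 0))%R.
Proof.
move=> degD; have [dD _] := diagram_dissection D.
rewrite -big_mkcond -[RHS]big_mkcond -[LHS]big_filter -[RHS]big_filter.
pose cj j := (j, j + deg A + 1).
rewrite -[RHS](big_map cj predT F); apply: perm_big; apply: uniq_perm.
- by rewrite filter_uniq ?fset_uniq.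
- by rewrite map_inj_uniq ?filter_uniq ?iota_uniq // => i k [].
case=> u v; rewrite mem_filter; apply/andP/mapP => [[Pc cD]|[j]]; last first.
  by rewrite mem_filter => /andP[/andP[cD Pc] _ ->].
have rc : u < v <= deg D by have [[rD _] _ _] := dD; exact: rD cD.
have sz : v - u = (deg A).+1.
  have := restrict_half_diagram dD cD true; case/andP: (Pc) => /eqP -> _ -[_ _].
  by rewrite half_plane_iota // size_iota /deg /=; lia.
have cE : (u, v) = cj u by rewrite /cj; congr (_, _); lia.
exists u; last exact: cE.
by rewrite mem_filter mem_index_iota -/(cj u) -cE cD Pc /=; lia.
Qed.

(** Starting at [j = 0] merges the root insertions with the others: the sum then runs over all cuts
    with [A] on the arc of the chord and [B] off it. *)
Definition theta A B : {malg K[dissection]} :=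
  (\sum_(0 <= t < (fertility A 0).+1) \sum_(0 <= j < (deg B).+1)
     \sum_(0 <= tau < (fertility B j).+1)
       x ^+ kexp (GammaV t j tau A B) [fset chord j (j + deg A + 1)%N]
         *: vec K (GammaV t j tau A B))%R.

Lemma theta_coef A B (D : dissection) :
  ((theta A B)@_D =
   if deg D == (deg A + deg B).+1 then
     \sum_(c <- dchords D) (if cuts_into A B (deg D) D c then x ^+ kexp D [fset c] else 0)
   else 0)%R.
Proof.
rewrite /theta raddf_sum /=.
under eq_bigr => t _.
  rewrite raddf_sum /=.
  under eq_bigr => j _.
    rewrite raddf_sum /=.
    under eq_bigr => tau _.
      rewrite mcoeffZ vec_coef chord_span.
      rewrite (_ : _ * _ = if GammaV t j tau A B == dchords D then
        x ^+ kexp D [fset (j, j + deg A + 1)%N] else 0)%R; last first.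
        by case: eqP => [->|_]; rewrite ?mulr1 ?mulr0.
      over.
    over.
  over.
rewrite exchange_big /=.
rewrite (eq_big_nat _ _ (F2 := fun j => if [&& deg D == (deg A + deg B).+1,
    (j, j + deg A + 1)%N \in dchords D & cuts_into A B (deg D) D (j, j + deg A + 1)%N]
    then x ^+ kexp D [fset (j, j + deg A + 1)%N] else 0)%R); last first.
  by move=> j /andP[_]; rewrite ltnS => jB; rewrite sum_GammaV.
case: eqP => degD; first by rewrite (sum_cuts_into (fun c => x ^+ kexp D [fset c])%R degD).
by rewrite big1.
Qed.

(** The two orders are the two summands of [split_by], according to which diagram is on the arc of
    the cutting chord. *)
Lemma L_theta A B : (L x A B = theta A B + theta B A)%R.
Proof.
suff E (D : dissection) : ((L x A B)@_D = (theta A B)@_D + (theta B A)@_D)%R.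
  by apply/malgP => D; exact: etrans (E D) (esym (mcoeffD _ _ _)).
rewrite L_coef !theta_coef (addnC (deg B)).
case: eqP => _; last by rewrite addr0.
rewrite -big_split; apply: eq_bigr => c _; rewrite /split_by -/(cuts_into A B _ D c).
rewrite -/(cuts_into B A _ D c) natrD mulrDr.
by case: cuts_into; case: cuts_into; rewrite ?mulr1 ?mulr0.
Qed.

Lemma GammaR_true t tau A B : GammaR true t tau A B = GammaV t 0 tau A B.
Proof.
rewrite /GammaR /GammaV fsetUAC add0n; congr (_ `|` _ `|` _); apply: eq_in_imfset => // c _ /=.
by rewrite !addn0.
Qed.

Lemma GammaR_false t tau A B : GammaR false t tau A B = GammaV tau 0 t B A.
Proof. exact: GammaR_true. Qed.

Definition theta_pos A B : {malg K[dissection]} :=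
  (\sum_(0 <= t < (fertility A 0).+1) \sum_(1 <= j < (deg B).+1)
     \sum_(0 <= tau < (fertility B j).+1)
       x ^+ kexp (GammaV t j tau A B) [fset chord j (j + deg A + 1)%N]
         *: vec K (GammaV t j tau A B))%R.

Lemma diagram_GammaV A B t j tau : j <= deg B -> vec K (GammaV t j tau A B) != 0%R ->
  diagram (deg A + deg B).+1 (GammaV t j tau A B).
Proof.
move=> jB /vec_diagram; have [[dA _] [dB _]] := (diagram_dissection A, diagram_dissection B).
by rewrite deg_GammaV.
Qed.

Lemma theta_split A B : (theta A B = theta_pos A B +
  \sum_(0 <= t < (fertility A 0).+1) \sum_(0 <= tau < (fertility B 0).+1)
    vec K (GammaV t 0 tau A B))%R.
Proof.
have [[dA _] [dB _]] := (diagram_dissection A, diagram_dissection B).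
rewrite /theta /theta_pos -big_split; apply: eq_bigr => t _ /=.
rewrite big_ltn // addrC; congr (_ + _)%R; apply: eq_bigr => tau _.
(* A vanishing [vec] makes the power of [x] irrelevant; otherwise the set of chords is a diagram and
   its exponent is known. *)
case: (eqVneq (vec K (GammaV t 0 tau A B)) 0%R) => [->|nz]; first by rewrite scaler0.
by rewrite chord_span kexp_GammaV0 ?scale1r //; exact: diagram_GammaV nz.
Qed.

Lemma theta_pos_label A B : (theta_pos A B =
  \sum_(0 <= t < (fertility A 0).+1) \sum_(1 <= j < (deg B).+1)
    \sum_(0 <= tau < label_index B j) vec K (GammaV t j tau A B) +
  x *: \sum_(0 <= t < (fertility A 0).+1) \sum_(1 <= j < (deg B).+1)
    \sum_(label_index B j <= tau < (fertility B j).+1) vec K (GammaV t j tau A B))%R.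
Proof.
have [[dA _] [dB _]] := (diagram_dissection A, diagram_dissection B).
have [[rB _] _ _] := dB.
rewrite /theta_pos scaler_sumr -big_split; apply: eq_bigr => t _ /=.
rewrite scaler_sumr -big_split; apply: eq_big_nat => j /andP[j0]; rewrite ltnS => jB /=.
have term tau : (x ^+ kexp (GammaV t j tau A B) [fset chord j (j + deg A + 1)%N]
         *: vec K (GammaV t j tau A B) =
    (if (label_index B j <= tau)%N then x else 1) *: vec K (GammaV t j tau A B))%R.
  case: (eqVneq (vec K (GammaV t j tau A B)) 0%R) => [->|nz]; first by rewrite !scaler0.
  rewrite chord_span kexp_GammaV ?j0 //; last exact: diagram_GammaV nz.
  by case: ifP.
(* Positions count from 1: for [tau] below [label_index] the chord labelled [j] is not among the
   first [tau], and from there on it is, which costs one factor [x]. *)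
have le : label_index B j <= (fertility B j).+1.
  by rewrite fertilityE // ltnS find_size.
rewrite (big_cat_nat (leq0n _) le) /=; congr (_ + _)%R; last rewrite scaler_sumr.
  by apply: eq_big_nat => tau /andP[_ lt]; rewrite term leqNgt lt scale1r.
by apply: eq_big_nat => tau /andP[lt _]; rewrite term lt.
Qed.

End Theta.

Local Open Scope ring_scope.

Theorem proposition45 (K : fieldType) (K0 : [pchar K] =i pred0) (x : K)
    (D1 D2 : dissection) :
  let n1 := deg D1 in
  let n2 := deg D2 in
  L x D1 D2 =
    \sum_(0 <= t < (fertility D1 0).+1) \sum_(1 <= j < n2.+1)
      \sum_(0 <= tau < (fertility D2 j).+1)
        x ^+ kexp (GammaV t j tau D1 D2) [fset chord j (j + n1 + 1)]
          *: vec K (GammaV t j tau D1 D2)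
  + \sum_(0 <= tau < (fertility D2 0).+1) \sum_(1 <= i < n1.+1)
      \sum_(0 <= t < (fertility D1 i).+1)
        x ^+ kexp (GammaV tau i t D2 D1) [fset chord i (i + n2 + 1)]
          *: vec K (GammaV tau i t D2 D1)
  + \sum_(lambda : bool) \sum_(0 <= t < (fertility D1 0).+1)
      \sum_(0 <= tau < (fertility D2 0).+1)
        vec K (GammaR lambda t tau D1 D2)
  /\
  L x D1 D2 =
    \sum_(0 <= t < (fertility D1 0).+1) \sum_(1 <= j < n2.+1)
      \sum_(0 <= tau < label_index D2 j)
        vec K (GammaV t j tau D1 D2)
  + x *: \sum_(0 <= t < (fertility D1 0).+1) \sum_(1 <= j < n2.+1)
      \sum_(label_index D2 j <= tau < (fertility D2 j).+1)
        vec K (GammaV t j tau D1 D2)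
  + \sum_(0 <= tau < (fertility D2 0).+1) \sum_(1 <= i < n1.+1)
      \sum_(0 <= t < label_index D1 i)
        vec K (GammaV tau i t D2 D1)
  + x *: \sum_(0 <= tau < (fertility D2 0).+1) \sum_(1 <= i < n1.+1)
      \sum_(label_index D1 i <= t < (fertility D1 i).+1)
        vec K (GammaV tau i t D2 D1)
  + \sum_(lambda : bool) \sum_(0 <= t < (fertility D1 0).+1)
      \sum_(0 <= tau < (fertility D2 0).+1)
        vec K (GammaR lambda t tau D1 D2).
Proof.
move=> n1 n2.
have Et : \sum_(0 <= t < (fertility D1 0).+1) \sum_(0 <= tau < (fertility D2 0).+1)
      vec K (GammaR true t tau D1 D2) =
    \sum_(0 <= t < (fertility D1 0).+1) \sum_(0 <= tau < (fertility D2 0).+1)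
      vec K (GammaV t 0 tau D1 D2).
  by apply: eq_bigr => t _; apply: eq_bigr => tau _; rewrite GammaR_true.
have Ef : \sum_(0 <= t < (fertility D1 0).+1) \sum_(0 <= tau < (fertility D2 0).+1)
      vec K (GammaR false t tau D1 D2) =
    \sum_(0 <= tau < (fertility D2 0).+1) \sum_(0 <= t < (fertility D1 0).+1)
      vec K (GammaV tau 0 t D2 D1).
  rewrite exchange_big; apply: eq_bigr => tau _; apply: eq_bigr => t _.
  by rewrite GammaR_false.
have main : L x D1 D2 = theta_pos x D1 D2 + theta_pos x D2 D1 +
    \sum_(lambda : bool) \sum_(0 <= t < (fertility D1 0).+1)
      \sum_(0 <= tau < (fertility D2 0).+1) vec K (GammaR lambda t tau D1 D2).
  (* The parts [j = 0] of the two [theta] are the terms [true] and [false] of the sum over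
     [lambda]. *)
  by rewrite big_bool Et Ef L_theta !theta_split addrACA.
split; first exact: main.
by rewrite main !theta_pos_label addrA.
Qed.
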